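(* Let $n\ge 1$ and let $G$ be a countable subgroup of $\mathrm{GL}_n(\mathbb C)$ of integral characteristic. Then $G$ lies in $\mathbf{H}^{\mathfrak F_{vc}}\mathfrak F_{vc}$, where $\mathfrak F_{vc}$ is the class of all virtually cyclic groups.
   Context: A subgroup $G$ of $\mathrm{GL}_n(\mathbb C)$ is of integral characteristic if the coefficients of the characteristic polynomial of every element of $G$ are algebraic integers. For a class $\mathfrak F$ of groups closed under isomorphism and taking subgroups and a group $G$, put $\mathfrak F\cap G=\{H\le G : H \text{ is isomorphic to a group in } \mathfrak F\}$. Every cellular action of a group on a CW-complex is assumed admissible: if a group element stabilises a cell, then it fixes that cell pointwise. $\mathbf{H}^{\mathfrak F}\mathfrak F$ is the smallest class of groups containing $\mathfrak F$ such that: if a group $G$ acts cellularly on a finite dimensional CW-complex $X$ with all isotropy subgroups in $\mathbf{H}^{\mathfrak F}\mathfrak F$, and such that for each $F\in\mathfrak F\cap G$ the fixed point set $X^F$ is contractible, then $G\in\mathbf{H}^{\mathfrak F}\mathfrak F$. *)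

(* Defs.v *)
From HB Require Import structures.
From mathcomp Require Import all_boot all_order all_algebra.
From mathcomp Require Import all_classical all_reals all_analysis.
From mathcomp Require Import complex.

Set Implicit Arguments.
Unset Strict Implicit.
Unset Printing Implicit Defensive.

Import Order.TTheory GRing.Theory Num.Theory.
Import numFieldNormedType.Exports.

Local Open Scope classical_set_scope.
Local Open Scope ring_scope.

(* A subgroup of a (possibly infinite) group [G : groupType] is given by
   [H : groupClosed G]; [subgrp H] is the same subgroup as a [groupType]. *)
Definition subgrp (G : groupType) (H : groupClosed G) : Type :=
  {x : G | x \in H}.

Section SubgrpGroup.
Variables (G : groupType) (H : groupClosed G).

Lemma subgrp_closed : group_closed (fun x : G => x \in H).
Proof. by split; [exact: gpred1 | move=> x y xH yH; exact: gpredF]. Qed.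

HB.instance Definition _ := SubChoice.on (subgrp H).
HB.instance Definition _ :=
  SubChoice_isSubGroup.Build G _ (subgrp H) subgrp_closed.

End SubgrpGroup.

Definition isomorphic (G H : groupType) : Prop :=
  exists f : G -> H, {morph f : x y / (x * y)%g} /\ bijective f.

Definition cyclic_group (G : groupType) : Prop :=
  exists c : G, forall g : G, exists k : nat, g = (c ^+ k)%g \/ g = (c ^- k)%g.

Definition finite_index (G : groupType) (H : groupClosed G) : Prop :=
  finite_set (range (fun g : G => [set (g * h)%g | h in [set` H]])).

Definition virtually_cyclic (G : groupType) : Prop :=
  exists H : groupClosed G, cyclic_group (subgrp H) /\ finite_index H.

(* [in_cap F H] is "H belongs to F ∩ G" *)
Definition in_cap (F : groupType -> Prop) (G : groupType) (H : groupClosed G)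
    : Prop :=
  exists K : groupType, F K /\ isomorphic K (subgrp H).

Section CW.
Variable R : realType.

Definition sqnorm n (v : 'rV[R]_n) : R := \sum_i v 0 i ^+ 2.
Definition disk n : set 'rV[R]_n := [set v | sqnorm v <= 1].
Definition open_disk n : set 'rV[R]_n := [set v | sqnorm v < 1].
Definition sphere n : set 'rV[R]_n := [set v | sqnorm v = 1].
Arguments disk n : clear implicits.
Arguments open_disk n : clear implicits.
Arguments sphere n : clear implicits.

(* Only the values of [char_map e] on [disk (cell_dim e)] are relevant. *)
Record CW_structure (X : topologicalType) := CWStructure {
  cell : Type;
  cell_dim : cell -> nat;
  char_map : forall e : cell, 'rV[R]_(cell_dim e) -> X;
  open_cell : cell -> set X :=
    fun e => @char_map e @` open_disk (cell_dim e);
  closed_cell : cell -> set X :=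
    fun e => @char_map e @` disk (cell_dim e);
  CW_hausdorff : hausdorff_space X;
  CW_cover : \bigcup_e open_cell e = setT;
  CW_disjoint : trivIset setT open_cell;
  CW_continuous : forall e,
    {within disk (cell_dim e), continuous (@char_map e)};
  CW_homeo : forall e, exists2 g : X -> 'rV[R]_(cell_dim e),
    {in open_disk (cell_dim e), cancel (@char_map e) g} &
    {within open_cell e, continuous g};
  CW_closure_finite : forall e, exists2 S : set cell,
    finite_set S /\ (forall f, S f -> (cell_dim f < cell_dim e)%N) &
    @char_map e @` sphere (cell_dim e) `<=` \bigcup_(f in S) open_cell f;
  CW_weak_topology : forall A : set X,
    (forall e, closed (A `&` closed_cell e)) -> closed A
}.

Definition finite_dimensional (X : topologicalType) (C : CW_structure X)
    : Prop :=
  exists d : nat, forall e : cell C, (cell_dim e <= d)%N.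

Definition contractible (X : topologicalType) (A : set X) : Prop :=
  exists2 a : X, A a &
  exists h : R * X -> X,
    [/\ {within `[0, 1]%classic `*` A, continuous h},
        (forall t x, `[0, 1]%classic t -> A x -> A (h (t, x))),
        (forall x, A x -> h (0, x) = x)
      & (forall x, A x -> h (1, x) = a)].

End CW.
Arguments disk R n : clear implicits.
Arguments open_disk R n : clear implicits.
Arguments sphere R n : clear implicits.
Arguments char_map {R X} _ e.
Arguments open_cell {R X} _ e.
Arguments closed_cell {R X} _ e.

Record group_action (G : groupType) (X : Type) := GroupAction {
  act :> G -> X -> X;
  act1 : forall x, act 1%g x = x;
  actM : forall g h x, act (g * h)%g x = act g (act h x)
}.

Section Actions.
Variables (G : groupType) (X : topologicalType) (a : group_action G X).

Definition isotropy (x : X) : {pred G} := fun g => `[< a g x = x >].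

Section IsotropyClosed.
Variable x : X.

Lemma isotropy_mul : mulg_closed (isotropy x).
Proof.
move=> g h /asboolP gx /asboolP hx; apply/asboolP.
by rewrite actM hx gx.
Qed.

Lemma isotropy_one : 1%g \in isotropy x.
Proof. by apply/asboolP; exact: act1. Qed.

Lemma isotropy_inv : invg_closed (isotropy x).
Proof.
move=> g /asboolP gx; apply/asboolP.
by rewrite -{1}gx -actM mulVg act1.
Qed.

HB.instance Definition _ := isMulClosed.Build G (isotropy x) isotropy_mul.
HB.instance Definition _ := isMul1Closed.Build G (isotropy x) isotropy_one.
HB.instance Definition _ := isInvClosed.Build G (isotropy x) isotropy_inv.

End IsotropyClosed.

Definition fixed_points (H : groupClosed G) : set X :=
  [set x | forall h, h \in H -> a h x = x].

Definition cellular_action (R : realType) (C : CW_structure R X) : Prop :=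
  (forall g, continuous (a g)) /\
  (forall g (e : cell C), exists2 f : cell C,
     cell_dim f = cell_dim e & a g @` open_cell C e = open_cell C f).

Definition admissible_cellular_action (R : realType) (C : CW_structure R X)
    : Prop :=
  cellular_action C /\
  (forall g (e : cell C), a g @` open_cell C e = open_cell C e ->
     forall x, open_cell C e x -> a g x = x).

End Actions.

(* [HFF R F] is the class H^F F, CW-complexes being built over the reals [R] *)
Inductive HFF (R : realType) (F : groupType -> Prop) : groupType -> Prop :=
| HFF_base (G : groupType) : F G -> HFF R F G
| HFF_step (G : groupType) (X : topologicalType) (C : CW_structure R X)
    (a : group_action G X) :
    finite_dimensional C ->
    admissible_cellular_action a C ->
    (forall x : X, HFF R F (subgrp (isotropy a x))) ->
    (forall H : groupClosed G, in_cap F H ->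
       contractible R (fixed_points a H)) ->
    HFF R F G.

Definition GL (n : nat) (K : fieldType) : Type := {A : 'M[K]_n | A \in unitmx}.

Section GLGroup.
Variables (n : nat) (K : fieldType).

HB.instance Definition _ := SubChoice.on (GL n K).

Let GL_mul (A B : GL n K) : GL n K :=
  exist _ (val A *m val B)
    (etrans (unitmx_mul _ _) (introT andP (conj (valP A) (valP B)))).
Let GL_one : GL n K := exist _ 1%:M (unitmx1 K n).
Let GL_inv (A : GL n K) : GL n K :=
  exist _ (invmx (val A)) (etrans (unitmx_inv _) (valP A)).

Let GL_mulA : associative GL_mul.
Proof. by move=> A B C; apply/val_inj; exact: mulmxA. Qed.
Let GL_mul1 : left_id GL_one GL_mul.
Proof. by move=> A; apply/val_inj; exact: mul1mx. Qed.
Let GL_1mul : right_id GL_one GL_mul.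
Proof. by move=> A; apply/val_inj; exact: mulmx1. Qed.
Let GL_mulV : left_inverse GL_one GL_inv GL_mul.
Proof. by move=> A; apply/val_inj; exact: mulVmx (valP A). Qed.
Let GL_Vmul : right_inverse GL_one GL_inv GL_mul.
Proof. by move=> A; apply/val_inj; exact: mulmxV (valP A). Qed.

HB.instance Definition _ :=
  isGroup.Build (GL n K) GL_mulA GL_mul1 GL_1mul GL_mulV GL_Vmul.

End GLGroup.

Definition algebraic_integer (K : fieldType) (z : K) : Prop :=
  integralOver (intr : int -> K) z.

Definition integral_characteristic (n : nat) (K : fieldType)
    (G : groupClosed (GL n K)) : Prop :=
  forall g : GL n K, g \in G ->
  forall i : nat, algebraic_integer (char_poly (val g))`_i.

(* Main.v *)
(* Call [HP] the class of groups built like the class of the theorem, but from actions on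
   finite dimensional simplicial complexes; barycentric cells show that it is smaller.

   A finitely generated subgroup of [G] spans a finitely generated Z-module: eigenvalues of
   words in the generators are algebraic integers, and long words can be rewritten, either
   shortening a power of a short word or permuting a descending product by the standard
   identity (Shirshov). Hence a subgroup [N] of finite index consists of matrices
   [g = 1 + 3 y] with [y] in a ring [L] which is a lattice. If [L] is not made of scalars,
   [N] acts by conjugation on the lattice of traceless parts of [L]; as [g] commutes with
   [y], every [g] fixes a nonzero vector, and stabilisers of nonzero vectors are reducible,
   so that induction on the degree applies to their diagonal blocks and leaves extensions
   of subgroups of Z^2 by a lattice.

   The complex attached to such a lattice action has as simplices the sets of vectors which
   are almost shortest for some norm: its vertices are incongruent modulo 3 within a simplex,
   and fixed sets contract because norms form a convex cone. Extensions, groups of finite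
   index, directed unions and lines in Z^2 are handled by pulled back complexes, joins of
   translates, trees of cosets and joins of lines. *)

Require Import Defs.
From HB Require Import structures.
From mathcomp Require Import all_boot all_order all_algebra.
From mathcomp Require Import all_classical all_reals all_analysis.
From mathcomp Require Import perm complex finmap.
From mathcomp Require Import zify ring lra.

Set Implicit Arguments.
Unset Strict Implicit.
Unset Printing Implicit Defensive.

Import Order.TTheory GRing.Theory Num.Theory.
Import numFieldNormedType.Exports.

Local Open Scope classical_set_scope.
Local Open Scope ring_scope.

(** * Virtually cyclic images *)

(** The obstacle is that fixed sets of infinite cyclic subgroups must be contractible, hence
    nonempty. A lattice on which some group element has no nonzero fixed vector is useless; this is
    why the group acts by conjugation on its own order, where [1 + 3 y] commutes with [y], and why
    an extension of the integers acts affinely, in one dimension more. Scalars must be discarded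
    because the whole group fixes them, so that their stabiliser is no smaller than the group.

    The modulus 3 serves twice: it bounds the dimension of the complex of short vectors, and an
    automorphism congruent to 1 modulo 3 fixes every vector fixed by one of its positive powers. The
    latter fails modulo 2, for the automorphism -1. It makes finite orbits trivial, so that a
    virtually cyclic group has the same fixed vectors as a cyclic subgroup of finite index, and
    simplices are never permuted nontrivially by their stabilisers. *)

Definition is_hom (G H : groupType) (f : G -> H) :=
  {morph f : x y / (x * y)%g}.

Section Hom.
Variables (G H : groupType) (f : G -> H) (fM : is_hom f).

Lemma hom1 : f 1%g = 1%g.
Proof. by apply: (@mulgI _ (f 1%g)); rewrite -fM !mulg1. Qed.

Lemma homV x : f x^-1%g = (f x)^-1%g.
Proof. by apply: (@mulgI _ (f x)); rewrite -fM !mulgV hom1. Qed.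

Lemma homX x n : f (x ^+ n)%g = (f x ^+ n)%g.
Proof. by elim: n => [|n IH]; rewrite ?hom1 // !expgS fM IH. Qed.

End Hom.

Lemma hom_comp (G H K : groupType) (f : G -> H) (g : H -> K) :
  is_hom f -> is_hom g -> is_hom (g \o f).
Proof. by move=> fM gM x y /=; rewrite fM gM. Qed.

Definition zexp (G : groupType) (c : G) (z : int) : G :=
  match z with Posz n => (c ^+ n)%g | Negz n => (c ^- n.+1)%g end.

Section Zexp.
Variables (G : groupType) (c : G).

Lemma zexp1 : zexp c 1 = c. Proof. by []. Qed.

Lemma zexpS z : zexp c (z + 1) = (zexp c z * c)%g.
Proof.
case: z => n; first by rewrite /= addn1 expgSr.
have -> : Negz n + 1 = - (n%:Z) by rewrite NegzE; lia.
case: n => [|n]; first by rewrite oppr0 /= expg1 mulVg.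
have -> : - (n.+1)%:Z = Negz n by [].
by rewrite /= [in RHS]expgS invgM mulgVK.
Qed.

Lemma zexpP z : zexp c (z - 1) = (zexp c z * c^-1)%g.
Proof. by apply: (@mulIg _ c); rewrite -zexpS subrK mulgVK. Qed.

Lemma zexpD a b : zexp c (a + b) = (zexp c a * zexp c b)%g.
Proof.
elim/int_ind: b a => [a|n IH a|n IH a]; first by rewrite addr0 mulg1.
  by rewrite -addn1 PoszD addrA !zexpS IH mulgA.
have -> : a - n.+1%:Z = a + - n%:Z - 1 by lia.
have -> : - n.+1%:Z = - n%:Z - 1 by lia.
by rewrite !zexpP IH mulgA.
Qed.

Lemma zexpN a : zexp c (- a) = (zexp c a)^-1%g.
Proof. by apply: (@mulgI _ (zexp c a)); rewrite -zexpD mulgV subrr. Qed.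

Lemma zexpB a b : zexp c (a - b) = (zexp c a * (zexp c b)^-1)%g.
Proof. by rewrite zexpD zexpN. Qed.

End Zexp.

Lemma zexp_mul (G : groupType) (c : G) a b : zexp c (a * b) = zexp (zexp c a) b.
Proof.
elim/int_ind: b => [|n IH|n IH]; first by rewrite mulr0.
  by rewrite -addn1 PoszD mulrDr mulr1 !zexpD IH.
have -> : - n.+1%:Z = - n%:Z - 1 by lia.
by rewrite mulrBr mulr1 zexpB IH zexpB zexp1.
Qed.

Lemma hom_zexp (G H : groupType) (f : G -> H) c z :
  is_hom f -> f (zexp c z) = zexp (f c) z.
Proof. by move=> fM; case: z => n; rewrite /= ?(homV fM) (homX fM). Qed.

(* [vcimg f] for a homomorphism [f] says that its image is virtually cyclic. *)
Definition vcimg (G : groupType) (T : Type) (f : G -> T) : Prop :=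
  exists (c : G) (l : seq G), forall x, exists2 r, r \in l &
    exists z, f x = f (r * zexp c z)%g.

Lemma vcimg_comp (G : groupType) (T U : Type) (f : G -> T) (g : T -> U) :
  vcimg f -> vcimg (g \o f).
Proof.
move=> [c [l cl]]; exists c, l => x; have [r rl [z e]] := cl x.
by exists r => //; exists z; rewrite /= e.
Qed.

Lemma vcimg_inj (G : groupType) (T U : Type) (f : G -> T) (g : G -> U) :
  (forall x y, f x = f y -> g x = g y) -> vcimg f -> vcimg g.
Proof.
move=> fg [c [l cl]]; exists c, l => x; have [r rl [z e]] := cl x.
by exists r => //; exists z; apply: fg.
Qed.

(* Either the image of [K] meets the cyclic part trivially, and then it is
   finite, or a least positive power of [c] in it generates a subgroup of finite
   index. *)
Lemma vcimg_sub (K H G : groupType) (j : K -> H) (f : H -> G) :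
  is_hom j -> is_hom f -> vcimg f -> vcimg (f \o j).
Proof.
move=> jM fM [c [l cl]].
pose A r z := exists x, f (j x) = f (r * zexp c z)%g.
have diff r a b x y : f (j x) = f (r * zexp c a)%g ->
    f (j y) = f (r * zexp c b)%g ->
    f (j (y^-1 * x)%g) = f (zexp c (a - b)).
  move=> ex ey; rewrite jM fM (homV jM) (homV fM) ex ey -(homV fM) -fM.
  by rewrite invgM -mulgA mulKg -zexpN -zexpD addrC.
have [[n n0 [h0 h0n]]|no] := pselect (exists2 n : nat, (0 < n)%N & A 1%g n); last first.
  exists 1%g, [seq (xget 1%g [set x | exists z, f (j x) = f (r * zexp c z)%g]) | r <- l].
  move=> x; have [r rl [z e]] := cl (j x).
  exists (xget 1%g [set x | exists z, f (j x) = f (r * zexp c z)%g]).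
    exact: map_f.
  exists 0; rewrite /= mulg1.
  have [z' e'] : [set x | exists z, f (j x) = f (r * zexp c z)%g] 
      (xget 1%g [set x | exists z, f (j x) = f (r * zexp c z)%g]).
    by apply: xgetPex; exists x; exists z.
  set y := xget _ _ in e' *.
  have [zz|zz] := eqVneq z z'; first by rewrite e e' zz.
  case: no; have [d0|d0|d0] := ltrgtP (z - z') 0; last first.
  - by move: zz; rewrite -subr_eq0 d0 eqxx.
  - exists (absz (z - z')); first by lia.
    exists (y^-1 * x)%g; rewrite (diff _ _ _ _ _ e e') mul1g; congr (f (zexp c _)); lia.
  - exists (absz (z - z')); first by lia.
    exists (x^-1 * y)%g; rewrite (diff _ _ _ _ _ e' e) mul1g; congr (f (zexp c _)); lia.
rewrite mul1g in h0n.
(* The cosets of the subgroup generated by [h0] are indexed by a representative in [l] and an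
   exponent modulo [n]. For an index that no element of [K] realises, the default of [xget] is
   listed, harmlessly. *)
pose B r i := [set x | exists q, f (j x) = f (r * zexp c (q * n%:Z + i%:Z))%g].
exists h0, [seq xget 1%g (B ri.1 ri.2) | ri <- [seq (r, i) | r <- l, i <- iota 0 n]].
move=> x; have [r rl [z e]] := cl (j x).
pose i := absz (z %% n%:Z)%Z.
have iE : i%:Z = (z %% n%:Z)%Z by rewrite /i gez0_abs // modz_ge0; lia.
have [q' e'] : B r i (xget 1%g (B r i)).
  apply: xgetPex; exists x; exists (z %/ n%:Z)%Z.
  by rewrite e iE -divz_eq.
exists (xget 1%g (B r i)).
  apply/mapP; exists (r, i) => //; apply/allpairsP; exists (r, i); split => //=.
  by rewrite mem_iota /= add0n; have := ltz_pmod z (d := n%:Z); lia.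
exists ((z %/ n%:Z)%Z - q').
rewrite /= jM fM e' (hom_zexp _ _ jM) (hom_zexp _ _ fM) h0n -(hom_zexp _ _ fM) -fM -mulgA -zexp_mul.
rewrite -zexpD e; congr (f (r * zexp c _)%g).
by rewrite {1}(divz_eq z n%:Z) -iE; ring.
Qed.

(** * Subgroups given by a predicate, and homomorphisms into them *)

Section Subgroup.
Variables (G : groupType) (P : G -> Prop).
Hypotheses (P1 : P 1%g) (PM : forall x y, P x -> P y -> P (x * y)%g).
Hypothesis PV : forall x, P x -> P x^-1%g.

Definition spred : {pred G} := fun x => `[< P x >].

Fact spred_mul : mulg_closed spred.
Proof. by move=> x y /asboolP Px /asboolP Py; apply/asboolP; exact: PM. Qed.

Fact spred_one : 1%g \in spred. Proof. exact/asboolP. Qed.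

Fact spred_inv : invg_closed spred.
Proof. by move=> x /asboolP Px; apply/asboolP; exact: PV. Qed.

Definition sgroup : groupClosed G :=
  HB.pack spred (isMulClosed.Build G spred spred_mul)
    (isMul1Closed.Build G spred spred_one) (isInvClosed.Build G spred spred_inv).

Lemma sgroupP x : reflect (P x) (x \in sgroup).
Proof. exact: asboolP. Qed.

End Subgroup.

Section Subgrp.
Variables (G : groupType) (H : groupClosed G).

Lemma sval_hom : is_hom (val : subgrp H -> G).
Proof. by move=> x y; rewrite -valM. Qed.

Lemma sval_inj : injective (val : subgrp H -> G).
Proof. exact: val_inj. Qed.

Definition sub_hom (K : groupType) (f : K -> G) (fH : forall k, f k \in H)
  (k : K) : subgrp H := Sub (f k) (fH k).

Lemma sub_homE (K : groupType) (f : K -> G) (fH : forall k, f k \in H) k :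
  val (sub_hom fH k) = f k.
Proof. by rewrite SubK. Qed.

Lemma sub_hom_hom (K : groupType) (f : K -> G) (fH : forall k, f k \in H) :
  is_hom f -> is_hom (sub_hom fH).
Proof. by move=> fM x y; apply: val_inj; rewrite valM !sub_homE fM. Qed.

End Subgrp.

(** * Simplicial complexes and their contractions *)

Section Cvg.
Variables (R : realType) (T : Type) (F : set_system T) (FF : Filter F).
Implicit Types f g : T -> R.

Lemma cvg_maxr f g (a b : R) : f @ F --> a -> g @ F --> b ->
  (fun x => Num.max (f x) (g x)) @ F --> Num.max a b.
Proof.
move=> fa gb; rewrite [X in X @ F](_ : _ =
  (fun x => (f x + g x + `|f x - g x|) / 2)); last first.
  by apply/funext => x; rewrite maxr_absE.
rewrite maxr_absE.
apply: cvgM; last exact: cvg_cst.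
by apply: cvgD; [exact: cvgD|apply: cvg_norm; exact: cvgB].
Qed.

Lemma cvg_minr f g (a b : R) : f @ F --> a -> g @ F --> b ->
  (fun x => Num.min (f x) (g x)) @ F --> Num.min a b.
Proof.
move=> fa gb; rewrite [X in X @ F](_ : _ =
  (fun x => (f x + g x - `|f x - g x|) / 2)); last first.
  by apply/funext => x; rewrite minr_absE.
rewrite minr_absE.
apply: cvgM; last exact: cvg_cst.
by apply: cvgB; [exact: cvgD|apply: cvg_norm; exact: cvgB].
Qed.

Lemma cvg_bigmax (I : eqType) (s : seq I) (f : I -> T -> R) (a : I -> R) :
  (forall i, i \in s -> f i @ F --> a i) ->
  (fun x => \big[Num.max/0]_(i <- s) f i x) @ F --> \big[Num.max/0]_(i <- s) a i.
Proof.
elim: s => [|i s IH] fa.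
  by under eq_fun do rewrite big_nil; rewrite big_nil; exact: cvg_cst.
under eq_fun do rewrite big_cons; rewrite big_cons.
apply: cvg_maxr; first by apply: fa; rewrite inE eqxx.
by apply: IH => j js; apply: fa; rewrite inE js orbT.
Qed.

Lemma cvg_bigsum (I : eqType) (s : seq I) (f : I -> T -> R) (a : I -> R) :
  (forall i, i \in s -> f i @ F --> a i) ->
  (fun x => \sum_(i <- s) f i x) @ F --> \sum_(i <- s) a i.
Proof.
elim: s => [|i s IH] fa.
  by under eq_fun do rewrite big_nil; rewrite big_nil; exact: cvg_cst.
under eq_fun do rewrite big_cons; rewrite big_cons.
apply: cvgD; first by apply: fa; rewrite inE eqxx.
by apply: IH => j js; apply: fa; rewrite inE js orbT.
Qed.

Lemma cvg_bigprod (I : eqType) (s : seq I) (f : I -> T -> R) (a : I -> R) :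
  (forall i, i \in s -> f i @ F --> a i) ->
  (fun x => \prod_(i <- s) f i x) @ F --> \prod_(i <- s) a i.
Proof.
elim: s => [|i s IH] fa.
  by under eq_fun do rewrite big_nil; rewrite big_nil; exact: cvg_cst.
under eq_fun do rewrite big_cons; rewrite big_cons.
apply: cvgM; first by apply: fa; rewrite inE eqxx.
by apply: IH => j js; apply: fa; rewrite inE js orbT.
Qed.

End Cvg.

Section Complex.
Variables (R : realType) (V : choiceType).
Implicit Types (X : {fset V} -> Prop) (S : {fset V}) (p : V -> R).

Definition simplicial X : Prop :=
  (forall S, X S -> S != fset0) /\
  (forall S T, X S -> fsubset T S -> T != fset0 -> X T).

Definition carrier p S : Prop := forall v, 0 <= p v /\ (v \in S) = (0 < p v).

Definition cone X p : Prop := exists2 S, X S & carrier p S.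

(* [real X p]: [p] is a point of the geometric realisation of [X], in
   barycentric coordinates normalised by [max p = 1] rather than [sum p = 1]. *)
Definition real X p : Prop :=
  [/\ cone X p, forall v, p v <= 1 & exists v, p v = 1].

Definition below S p : Prop := forall v, v \notin S -> p v = 0.

Definition dom X (I : (V -> R) -> Prop) S (t : R) p : Prop :=
  [/\ 0 <= t <= 1, real X p, I p & below S p].

(** Continuity is tested on one closed simplex at a time, for pointwise convergence along arbitrary
    filters. The common finite bound [T] on the supports of the images is what turns convergence of
    coordinates into convergence in the weak topology. *)
Definition homotopy_continuous X I (h : R -> (V -> R) -> V -> R) : Prop :=
  forall S, X S -> exists2 T : {fset V},
    (forall t p, dom X I S t p -> below T (h t p)) &
    forall (F : set_system (R * (V -> R))), Filter F ->
    forall t0 p0, dom X I S t0 p0 -> F [set x | dom X I S x.1 x.2] ->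
    fst @ F --> t0 -> (forall v, (fun x => x.2 v) @ F --> p0 v) ->
    forall v, (fun x => h x.1 x.2 v) @ F --> h t0 p0 v.

Definition contr X I : Prop := exists h a,
  [/\ real X a /\ I a,
      (forall t p, 0 <= t <= 1 -> real X p -> I p -> real X (h t p) /\ I (h t p)),
      (forall p, real X p -> I p -> h 0 p = p),
      (forall p, real X p -> I p -> h 1 p = a)
    & homotopy_continuous X I h].

Lemma carrier_ge0 p S v : carrier p S -> 0 <= p v.
Proof. by case/(_ v). Qed.

Lemma carrier_below p S : carrier p S -> below S p.
Proof.
move=> /(_ _) pS v vS; have [p0 e] := pS v.
by apply/eqP; move: vS; rewrite e lt_def p0 andbT negbK.
Qed.

Lemma carrier_gt0 p S v : carrier p S -> v \in S -> 0 < p v.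
Proof. by move=> /(_ v) [_ ->]. Qed.

Lemma carrier_uniq p S T : carrier p S -> carrier p T -> S = T.
Proof.
by move=> pS pT; apply/fsetP => v; have [_ ->] := pS v; have [_ ->] := pT v.
Qed.

Lemma carrier_sub p S T : carrier p S -> below T p -> fsubset S T.
Proof.
move=> pS pT; apply/fsubsetP => v; have [_ ->] := pS v.
by apply: contraTT => /pT ->; rewrite ltxx.
Qed.

Lemma below_carrier p S : below S p -> (forall v, 0 <= p v) ->
  carrier p [fset v in S | 0 < p v]%fset.
Proof.
move=> pS p0 v; split => //; rewrite !inE /=.
have [//|vS] := boolP (v \in S).
by rewrite (pS v vS) ltxx.
Qed.

Lemma cone_ge0 X p v : cone X p -> 0 <= p v.
Proof. by move=> [S _ /carrier_ge0]. Qed.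

Lemma cone_below X p S : simplicial X -> X S -> below S p ->
  (forall v, 0 <= p v) -> (exists v, 0 < p v) -> cone X p.
Proof.
move=> [_ cX] XS pS p0 [v pv]; exists [fset v in S | 0 < p v]%fset; last first.
  exact: below_carrier.
apply: (cX _ _ XS); first by apply/fsubsetP => w; rewrite !inE => /andP[].
by apply/fset0Pn; exists v; have [_ ->] := below_carrier pS p0 v.
Qed.

Lemma cone_scale X p k : 0 < k -> cone X p -> cone X (fun v => k * p v).
Proof.
move=> k0 [S XS pS]; exists S => // v; have [p0 ->] := pS v.
by rewrite pmulr_rgt0 // mulr_ge0 // ltW.
Qed.

Lemma real_cone X p : real X p -> cone X p. Proof. by case. Qed.

Lemma real_ge0 X p v : real X p -> 0 <= p v.
Proof. by case=> /cone_ge0. Qed.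

Lemma real_le1 X p v : real X p -> p v <= 1.
Proof. by case. Qed.

Definition nrm p : R := sup (range p).

Lemma nrmE p (S : {fset V}) : below S p -> (forall v, 0 <= p v) ->
  (exists v, 0 < p v) -> nrm p = \big[Num.max/0]_(v <- S) p v.
Proof.
move=> pS p0 [v0 pv0].
have ub v : p v <= \big[Num.max/0]_(v <- S) p v.
  have [vS|/pS ->] := boolP (v \in S); last exact: bigmax_ge_id.
  exact: le_bigmax_seq.
apply/le_anti/andP; split.
  by apply: ge_sup; [exists (p v0), v0 | move=> _ [v _ <-]].
apply: bigmax_le; last first.
  move=> i _; apply: ub_le_sup; last by exists i.
  by exists (\big[Num.max/0]_(v <- S) p v) => _ [v _ <-].
apply: (le_trans (ltW pv0)); apply: ub_le_sup; last by exists v0.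
by exists (\big[Num.max/0]_(v <- S) p v) => _ [v _ <-].
Qed.

Lemma cone_nrm X p : simplicial X -> cone X p ->
  [/\ 0 < nrm p, forall v, p v <= nrm p & exists v, p v = nrm p].
Proof.
move=> [X0 _] [S XS pS].
have /fset0Pn[v0 v0S] := X0 _ XS; have pv0 := carrier_gt0 pS v0S.
have e := nrmE (carrier_below pS) (fun v => carrier_ge0 v pS) (ex_intro _ v0 pv0).
have ub v : p v <= nrm p.
  rewrite e; have [vS|/(carrier_below pS) ->] := boolP (v \in S).
    exact: le_bigmax_seq.
  exact: bigmax_ge_id.
have n0 : 0 < nrm p := lt_le_trans pv0 (ub v0).
split => //; apply: contrapT => no.
suff : nrm p < nrm p by rewrite ltxx.
rewrite {1}e; apply: bigmax_lt => // v _; rewrite lt_def ub andbT.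
by apply/eqP => ev; apply: no; exists v.
Qed.

Lemma cone_real X p : simplicial X -> cone X p -> real X (fun v => (nrm p)^-1 * p v).
Proof.
move=> cX Xp; have [n0 le [v ve]] := cone_nrm cX Xp; split.
- by apply: cone_scale => //; rewrite invr_gt0.
- by move=> w; rewrite ler_pdivrMl // mulr1.
- by exists v; rewrite ve mulVf // gt_eqF.
Qed.

Lemma real_nrm X p : simplicial X -> real X p -> nrm p = 1.
Proof.
move=> cX [Xp p1 [v pv]]; have [n0 le [w we]] := cone_nrm cX Xp.
by apply/le_anti; rewrite -{1}we p1 -pv le.
Qed.

Definition scale_closed (I : (V -> R) -> Prop) :=
  forall k p, 0 < k -> I p -> I (fun v => k * p v).

(** Homotopies may be written in the cone, without normalisation. Dividing by the largest coordinate
    brings them back to the realisation; this is continuous because over one simplex the maximum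
    runs over the fixed finite set [T]. *)
Lemma contr_cone X I (W : R -> (V -> R) -> V -> R) a :
  simplicial X -> scale_closed I -> cone X a -> I a ->
  (forall t p, 0 <= t <= 1 -> real X p -> I p -> cone X (W t p) /\ I (W t p)) ->
  (forall p, real X p -> I p -> W 0 p = p) ->
  (forall p, real X p -> I p -> W 1 p = a) ->
  homotopy_continuous X I W -> contr X I.
Proof.
move=> cX sI Xa Ia WX W0 W1 Wc.
exists (fun t p v => (nrm (W t p))^-1 * W t p v), (fun v => (nrm a)^-1 * a v).
have inv0 p : cone X p -> 0 < (nrm p)^-1.
  by move=> Xp; rewrite invr_gt0; case: (cone_nrm cX Xp).
split.
- by split; [exact: cone_real | apply: sI => //; exact: inv0].
- move=> t p t01 Xp Ip; have [Wp IW] := WX t p t01 Xp Ip.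
  by split; [exact: cone_real | apply: sI => //; exact: inv0].
- move=> p Xp Ip; rewrite W0 //; apply/funext => v.
  by rewrite (real_nrm cX Xp) invr1 mul1r.
- by move=> p Xp Ip; rewrite W1.
move=> S XS; have [T WT Wcv] := Wc S XS; exists T => [t p D v vT|].
  by rewrite (WT t p D v vT) mulr0.
move=> F FF t0 p0 D0 FD Ft Fp v.
have Wcvv := Wcv F FF t0 p0 D0 FD Ft Fp.
have nrmT t p : dom X I S t p -> nrm (W t p) = \big[Num.max/0]_(v <- T) W t p v.
  move=> D; have [t01 Xp Ip pS] := D; have [WC _] := WX t p t01 Xp Ip.
  apply: nrmE; [exact: WT|by move=> w; apply: cone_ge0 WC|].
  case: (cone_nrm cX WC) => n0 _ [w we]; exists w; by rewrite we.
apply: cvgM; last exact: Wcvv.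
apply: cvgV.
  have [t01 Xp Ip pS] := D0; have [WC _] := WX _ _ t01 Xp Ip.
  by case: (cone_nrm cX WC) => n0 _ _; rewrite gt_eqF.
rewrite nrmT //.
suff : (fun x => \big[Num.max/0]_(v <- T) W x.1 x.2 v) @ F -->
    \big[Num.max/0]_(v <- T) W t0 p0 v.
  apply: cvg_trans; apply: near_eq_cvg; near=> x.
  by rewrite nrmT //; near: x.
by apply: cvg_bigmax => w _; exact: Wcvv.
Unshelve. all: by end_near. Qed.

End Complex.

(** * The barycentric cell structure *)

Lemma cvg_mx (R : realType) (T : Type) (F : set_system T) (FF : Filter F) m n
    (f : T -> 'M[R]_(m, n)) (M : 'M[R]_(m, n)) :
  (forall i j, (fun x => f x i j) @ F --> M i j) -> f @ F --> M.
Proof.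
move=> fM; apply/cvg_ballP => e e0.
have : \forall x \near F, forall ij : 'I_m * 'I_n,
    ball (M ij.1 ij.2) e (f x ij.1 ij.2).
  apply: filter_forall => -[i j] /=.
  by have /cvg_ballP/(_ e e0) := fM i j.
by apply: filterS => x H /=; split => // i j; exact: (H (i, j)).
Qed.

(* A disk is mapped onto a simplex by rescaling each ray issued from the centre;
   [gauge u] is the gauge of the simplex, read off the displacement [u] of the
   barycentric coordinates from the barycentre. *)
Section Simplex.
Variables (R : realType) (k : nat).
Implicit Types (v : 'rV[R]_k) (u w : 'I_k.+1 -> R).

Definition disp v (i : 'I_k.+1) : R :=
  if unlift ord_max i is Some j then v 0 j else - \sum_j v 0 j.

Definition drop_last u : 'rV[R]_k := \row_j u (lift ord_max j).

Definition gauge u : R := k.+1%:R * \big[Num.max/0]_(i < k.+1) (- u i).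

Definition rad v : R := Num.sqrt (sqnorm v).

Definition bary v i : R := k.+1%:R^-1 + disp v i * (rad v / gauge (disp v)).

Definition unbary w : 'rV[R]_k := let u i := w i - k.+1%:R^-1 in
  (gauge u / rad (drop_last u)) *: drop_last u.

Lemma sum_lift (f : 'I_k.+1 -> R) :
  \sum_i f i = \sum_j f (lift ord_max j) + f ord_max.
Proof.
rewrite big_ord_recr /=; congr (_ + _); apply: eq_bigr => j _; congr f.
by apply: val_inj; rewrite [RHS]lift_max.
Qed.

Lemma disp_lift v j : disp v (lift ord_max j) = v 0 j.
Proof. by rewrite /disp liftK. Qed.

Lemma disp_max v : disp v ord_max = - \sum_j v 0 j.
Proof. by rewrite /disp unlift_none. Qed.

Lemma sum_disp v : \sum_i disp v i = 0.
Proof.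
by rewrite sum_lift disp_max (eq_bigr (fun j => v 0 j)) ?subrr // => j _; rewrite disp_lift.
Qed.

Lemma drop_lastK u : \sum_i u i = 0 -> disp (drop_last u) =1 u.
Proof.
rewrite sum_lift => /eqP; rewrite addrC addr_eq0 => /eqP u0 i.
case: (unliftP ord_max i) => [j|] ->; first by rewrite disp_lift mxE.
by rewrite disp_max u0; congr (- _); apply: eq_bigr => j _; rewrite mxE.
Qed.

Lemma disp_eq0 v : disp v =1 (fun=> 0) -> v = 0.
Proof. by move=> e; apply/rowP => j; rewrite -disp_lift e mxE. Qed.

Lemma gauge_ge0 u : 0 <= gauge u.
Proof. by rewrite mulr_ge0 // bigmax_ge_id. Qed.

Lemma gauge_ge u i : - u i <= gauge u / k.+1%:R.
Proof. by rewrite mulrAC divff ?mul1r ?pnatr_eq0 //; exact: le_bigmax_cond. Qed.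

Lemma gaugeZ u c : 0 <= c -> gauge (fun i => c * u i) = c * gauge u.
Proof.
move=> c0; rewrite /gauge mulrCA; congr (_ * _).
apply: (big_ind2 (fun x y => x = c * y)) => [|x1 y1 x2 y2 -> ->|i _].
- by rewrite mulr0.
- by rewrite maxr_pMr.
- by rewrite mulrN.
Qed.

(** A negative entry is bounded by the [k.+1]-th part of the gauge; a positive one is minus the sum
    of the [k] others. This yields definiteness of the gauge on vectors of sum 0, and continuity at
    the centre of the disk. *)
Lemma le_gauge u i : \sum_j u j = 0 -> `|u i| <= gauge u.
Proof.
move=> u0; set m := gauge u / k.+1%:R.
have gE : gauge u = \sum_(j < k.+1) m.
  by rewrite sumr_const card_ord -mulr_natr /m divfK // pnatr_eq0.
have m0 : 0 <= m by rewrite divr_ge0 // gauge_ge0.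
rewrite ler_norml lerNl gE; apply/andP; split.
  rewrite (bigD1 i) //= (le_trans (gauge_ge u i)) // lerDl.
  by apply: sumr_ge0.
move/eqP: u0; rewrite (bigD1 i) //= addr_eq0 => /eqP ->.
rewrite -sumrN [leRHS](bigD1 i) //= -[leLHS]add0r lerD //.
by apply: ler_sum => j _; exact: gauge_ge.
Qed.

Lemma gauge_eq0 u : \sum_j u j = 0 -> gauge u = 0 -> u =1 (fun=> 0).
Proof.
by move=> u0 g0 i; apply/normr0_eq0/le_anti; rewrite normr_ge0 -{1}g0 le_gauge.
Qed.

Lemma gauge_disp_eq0 v : gauge (disp v) = 0 -> v = 0.
Proof. by move/(gauge_eq0 (sum_disp v))/disp_eq0. Qed.

Lemma sqnorm_ge0 v : 0 <= sqnorm v.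
Proof. by apply: sumr_ge0 => i _; exact: sqr_ge0. Qed.

Lemma rad_ge0 v : 0 <= rad v. Proof. exact: sqrtr_ge0. Qed.

Lemma rad0 : rad 0 = 0.
Proof.
rewrite /rad (_ : sqnorm 0 = 0) ?sqrtr0 //.
by apply: big1 => i _; rewrite mxE expr0n.
Qed.

Lemma le_rad v j : `|v 0 j| <= rad v.
Proof.
rewrite -sqrtr_sqr; apply: ler_wsqrtr.
by rewrite /sqnorm (bigD1 j) //= lerDl; apply: sumr_ge0 => i _; exact: sqr_ge0.
Qed.

Lemma rad_eq0 v : rad v = 0 -> v = 0.
Proof.
by move=> r0; apply/rowP => j; rewrite mxE; apply/normr0_eq0/le_anti;
  rewrite normr_ge0 -{1}r0 le_rad.
Qed.

Lemma radZ c v : 0 <= c -> rad (c *: v) = c * rad v.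
Proof.
move=> c0; rewrite -{2}(ger0_norm c0) -sqrtr_sqr -sqrtrM ?sqr_ge0 //.
congr Num.sqrt; rewrite /sqnorm mulr_sumr; apply: eq_bigr => i _.
by rewrite mxE exprMn.
Qed.

Lemma dispZ c v i : disp (c *: v) i = c * disp v i.
Proof.
case: (unliftP ord_max i) => [j|] ->; rewrite ?disp_lift ?disp_max ?mxE //.
by rewrite mulrN mulr_sumr; congr (- _); apply: eq_bigr => j _; rewrite mxE.
Qed.

Lemma sqnorm_rad v : sqnorm v = rad v ^+ 2.
Proof. by rewrite sqr_sqrtr // sqnorm_ge0. Qed.

Lemma disk_rad v : disk R k v <-> rad v <= 1.
Proof. by rewrite /disk /= sqnorm_rad expr_le1 // rad_ge0. Qed.

Lemma open_disk_rad v : open_disk R k v <-> rad v < 1.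
Proof. by rewrite /open_disk /= sqnorm_rad expr_lt1 // rad_ge0. Qed.

Lemma sphere_rad v : sphere R k v <-> rad v = 1.
Proof.
rewrite /sphere /= sqnorm_rad; split=> [/eqP|->]; last by rewrite expr1n.
by rewrite sqrp_eq1 ?rad_ge0 // => /eqP.
Qed.

Lemma sum_bary v : \sum_i bary v i = 1.
Proof.
rewrite big_split /= sumr_const card_ord -mulr_suml sum_disp mul0r addr0.
by rewrite -(mulr_natr k.+1%:R^-1) mulVf // pnatr_eq0.
Qed.

Lemma bary_ge v i : k.+1%:R^-1 * (1 - rad v) <= bary v i.
Proof.
rewrite /bary mulrBr mulr1 lerD2l -lerN2 opprK.
have [g0|g0] := eqVneq (gauge (disp v)) 0.
  by rewrite g0 invr0 mulr0 mulr0 oppr0 mulr_ge0 // ?invr_ge0 // rad_ge0.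
rewrite -mulNr (le_trans (ler_wpM2r _ (gauge_ge _ i))) //.
  by rewrite divr_ge0 ?rad_ge0 ?gauge_ge0.
rewrite [leLHS](_ : _ = k.+1%:R^-1 * rad v) //.
by field; rewrite g0 /= addrC natr1 pnatr_eq0.
Qed.

Lemma bary_ge0 v i : disk R k v -> 0 <= bary v i.
Proof.
move/disk_rad => r1; apply: le_trans (bary_ge v i).
by rewrite mulr_ge0 ?invr_ge0 // subr_ge0.
Qed.

Lemma bary_gt0 v i : open_disk R k v -> 0 < bary v i.
Proof.
move/open_disk_rad => r1; apply: lt_le_trans (bary_ge v i).
by rewrite mulr_gt0 ?invr_gt0 // subr_gt0.
Qed.

Lemma sphere_bary v : sphere R k v -> exists i, bary v i = 0.
Proof.
move/sphere_rad => r1.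
have g0 : gauge (disp v) != 0.
  by apply/eqP => /gauge_disp_eq0 v0; move: r1; rewrite v0 rad0 => /eqP; rewrite eq_sym oner_eq0.
have gk : gauge (disp v) / k.+1%:R != 0 by rewrite mulf_neq0 ?invr_eq0 ?pnatr_eq0.
have m0 : 0 < gauge (disp v) / k.+1%:R.
  by rewrite lt_def gk divr_ge0 // gauge_ge0.
have [i ie] : exists i, - disp v i = gauge (disp v) / k.+1%:R.
  apply: contrapT => no.
  suff : \big[Num.max/0]_(i < k.+1) (- disp v i) < gauge (disp v) / k.+1%:R.
    by rewrite /gauge mulrAC divff ?mul1r ?pnatr_eq0 // ltxx.
  apply: bigmax_lt => // i _; rewrite lt_def gauge_ge andbT.
  by apply/eqP => e; apply: no; exists i.
exists i; rewrite /bary r1 -[disp v i]opprK ie.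
by field; rewrite g0 /= addrC natr1 pnatr_eq0.
Qed.

Lemma baryK v : open_disk R k v -> unbary (bary v) = v.
Proof.
move=> _; rewrite /unbary /=.
have [v0|v0] := eqVneq v 0.
  rewrite (_ : drop_last _ = 0) ?scaler0 ?v0 //; apply/rowP => j.
  by rewrite !mxE /bary disp_lift mxE mul0r addr0 subrr.
have g0 : gauge (disp v) != 0 by apply: contra_neq v0; exact: gauge_disp_eq0.
have r0 : rad v != 0 by apply: contra_neq v0; exact: rad_eq0.
set c := rad v / gauge (disp v).
have c0 : 0 <= c by rewrite divr_ge0 ?rad_ge0 ?gauge_ge0.
have uE i : bary v i - k.+1%:R^-1 = c * disp v i.
  by rewrite /bary addrC addKr mulrC.
rewrite (_ : drop_last _ = c *: v); last first.
  by apply/rowP => j; rewrite !mxE uE disp_lift.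
rewrite (_ : (fun i => _) = (fun i => c * disp v i)); last exact/funext.
rewrite gaugeZ // radZ // scalerA -[RHS]scale1r; congr (_ *: _).
by rewrite /c; field; rewrite r0 g0.
Qed.

Lemma unbaryK w : \sum_i w i = 1 -> (forall i, 0 < w i) ->
  open_disk R k (unbary w) /\ bary (unbary w) =1 w.
Proof.
move=> w1 w0; rewrite /unbary /=; set u := fun i => w i - k.+1%:R^-1.
have u0 : \sum_i u i = 0.
  rewrite sumrB w1 sumr_const card_ord -(mulr_natr k.+1%:R^-1) mulVf ?subrr //.
have du := drop_lastK u0.
have [v0|v0] := eqVneq (drop_last u) 0.
  rewrite v0 scaler0; split; first by apply/open_disk_rad; rewrite rad0.
  move=> i; rewrite /bary rad0 mul0r mulr0 addr0; apply/eqP.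
  rewrite eq_sym -subr_eq0 -/(u i) -du v0; apply/eqP.
  case: (unliftP ord_max i) => [j|] ->; rewrite ?disp_lift ?disp_max ?mxE //.
  by rewrite big1 ?oppr0 // => j _; rewrite mxE.
have r0 : rad (drop_last u) != 0 by apply: contra_neq v0; exact: rad_eq0.
have g0 : gauge u != 0.
  apply: contra_neq v0 => /(gauge_eq0 u0) e.
  by apply/rowP => j; rewrite !mxE -du du e.
set c := gauge u / rad (drop_last u).
have c0 : 0 <= c by rewrite divr_ge0 ?rad_ge0 ?gauge_ge0.
split.
  apply/open_disk_rad; rewrite radZ // /c divfK // /gauge.
  rewrite mulrC -ltr_pdivlMr // mul1r; apply: bigmax_lt => [|i _].
    by rewrite invr_gt0.
  by rewrite /u opprB ltrBlDr ltrDl.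
move=> i; rewrite /bary dispZ du radZ //.
rewrite (_ : disp _ = (fun i => c * u i)); last first.
  by apply/funext => j; rewrite dispZ du.
rewrite gaugeZ // {1}/c.
have -> : w i = k.+1%:R^-1 + u i by rewrite /u addrC subrK.
congr (_ + _); rewrite /c; field.
by rewrite r0 g0.
Qed.

Lemma cvg_gauge (T : Type) (F : set_system T) (FF : Filter F)
    (u : T -> 'I_k.+1 -> R) (u0 : 'I_k.+1 -> R) :
  (forall i, (fun x => u x i) @ F --> u0 i) ->
  (fun x => gauge (u x)) @ F --> gauge u0.
Proof.
by move=> cu; apply: cvgM; [exact: cvg_cst|apply: cvg_bigmax => i _; exact: cvgN].
Qed.

Lemma cvg_rad (T : Type) (F : set_system T) (FF : Filter F)
    (v : T -> 'rV[R]_k) (v0 : 'rV[R]_k) :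
  (forall j, (fun x => v x 0 j) @ F --> v0 0 j) ->
  (fun x => rad (v x)) @ F --> rad v0.
Proof.
move=> cv; apply: (@continuous_cvg _ _ _ F FF (fun x => sqnorm (v x)) Num.sqrt (sqnorm v0)).
  exact: sqrt_continuous.
by apply: cvg_bigsum => j _; under eq_fun do rewrite expr2; apply: cvgM.
Qed.

Lemma cvg_bary (T : Type) (F : set_system T) (FF : Filter F)
    (v : T -> 'rV[R]_k) (v0 : 'rV[R]_k) :
  (forall j, (fun x => v x 0 j) @ F --> v0 0 j) ->
  forall i, (fun x => bary (v x) i) @ F --> bary v0 i.
Proof.
move=> cv i.
have cr := cvg_rad FF cv.
have cd l : (fun x => disp (v x) l) @ F --> disp v0 l.
  case: (unliftP ord_max l) => [j|] ->.
    under eq_fun do rewrite disp_lift; rewrite disp_lift; exact: cv.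
  under eq_fun do rewrite disp_max; rewrite disp_max.
  by apply: cvgN; apply: cvg_bigsum => j _; exact: cv.
apply: cvgD; first exact: cvg_cst.
have [v00|v00] := eqVneq v0 0; last first.
  apply: cvgM; first exact: cd.
  apply: cvgM; first exact: cr.
  apply: cvgV; last exact: cvg_gauge.
  by apply: contra_neq v00; exact: gauge_disp_eq0.
(* At the centre the quotient of [rad] by [gauge] need not converge, but by [le_gauge] its product
   with [disp] is bounded by [rad], which tends to 0. *)
rewrite v00 rad0 mul0r mulr0; apply: norm_cvg0.
rewrite v00 rad0 in cr.
apply: (@squeeze_cvgr _ _ _ _ (fun=> 0) (fun x => rad (v x))).
- apply: nearW => x; rewrite normr_ge0 /= normrM normf_div.
  rewrite (ger0_norm (rad_ge0 _)) (ger0_norm (gauge_ge0 _)).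
  have [->|g0] := eqVneq (gauge (disp (v x))) 0.
    by rewrite invr0 !mulr0 rad_ge0.
  rewrite mulrCA -[leRHS]mulr1 ler_wpM2l ?rad_ge0 //.
  rewrite ler_pdivrMr ?lt_def ?g0 ?gauge_ge0 // mul1r le_gauge //.
  exact: sum_disp.
- exact: cvg_cst.
- exact: cr.
Qed.

Lemma cvg_unbary (T : Type) (F : set_system T) (FF : Filter F)
    (w : T -> 'I_k.+1 -> R) (w0 : 'I_k.+1 -> R) :
  \sum_i w0 i = 1 ->
  (forall i, (fun x => w x i) @ F --> w0 i) ->
  (fun x => unbary (w x)) @ F --> unbary w0.
Proof.
move=> w01 cw; apply: cvg_mx => i j; rewrite (ord1 i) {i}.
rewrite /unbary /=; set u := fun x i => w x i - k.+1%:R^-1.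
set u0 := fun i => w0 i - k.+1%:R^-1.
have su : \sum_i u0 i = 0.
  rewrite sumrB w01 sumr_const card_ord -(mulr_natr k.+1%:R^-1) mulVf ?subrr //.
have cu i : (fun x => u x i) @ F --> u0 i by apply: cvgB => //; exact: cvg_cst.
have cg : (fun x => gauge (u x)) @ F --> gauge u0 by exact: cvg_gauge.
have cp l : (fun x => drop_last (u x) 0 l) @ F --> drop_last u0 0 l.
  by under eq_fun do rewrite mxE; rewrite mxE; exact: cu.
rewrite mxE; under eq_fun do rewrite mxE.
have [v0|v0] := eqVneq (drop_last u0) 0; last first.
  apply: cvgM; last exact: cp.
  apply: cvgM; first exact: cg.
  apply: cvgV; last exact: cvg_rad.
  by apply: contra_neq v0; exact: rad_eq0.
have g0 : gauge u0 = 0.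
  have e l : u0 l = 0.
    rewrite -(drop_lastK su) v0.
    by have := dispZ 0 0 l; rewrite scale0r mul0r.
  rewrite (_ : u0 = (fun i => 0 * u0 i)) ?gaugeZ ?mul0r //.
  by apply/funext => l; rewrite mul0r e.
rewrite v0 mxE mulr0; rewrite g0 in cg; apply: norm_cvg0.
apply: (@squeeze_cvgr _ _ _ _ (fun=> 0) (fun x => gauge (u x))) => //.
- apply: nearW => x; rewrite normr_ge0 /= normrM normf_div.
  rewrite (ger0_norm (rad_ge0 _)) (ger0_norm (gauge_ge0 _)).
  have [->|r0] := eqVneq (rad (drop_last (u x))) 0.
    by rewrite invr0 !mulr0 mul0r gauge_ge0.
  rewrite -mulrA -[leRHS]mulr1 ler_wpM2l ?gauge_ge0 //.
  rewrite mulrC ler_pdivrMr ?lt_def ?r0 ?rad_ge0 // mul1r.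
  exact: le_rad.
- exact: cvg_cst.
Qed.

End Simplex.

(** * The realisation with its weak topology, and its cells *)

Section Realisation.
Variables (R : realType) (V : choiceType) (X : {fset V} -> Prop).
Hypothesis cX : simplicial X.

Definition rpt : Type := {p : V -> R | real X p}.

HB.instance Definition _ := gen_eqMixin rpt.
HB.instance Definition _ := gen_choiceMixin rpt.

Implicit Types (p q : rpt) (S : {fset V}).

Lemma rpt_inj p q : sval p = sval q -> p = q.
Proof. by case: p q => [p hp] [q hq] /= e; subst q; congr exist; exact: Prop_irrelevance. Qed.

Definition near_on S (e : R) p q : Prop :=
  below S (sval q) /\ forall v, `|sval p v - sval q v| < e.

(* the weak topology determined by the closed simplices *)
Definition ropen (U : set rpt) : Prop :=
  forall S, X S -> forall p, U p -> below S (sval p) ->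
  exists2 e : R, 0 < e & forall q, near_on S e p q -> U q.

Fact ropenT : ropen setT.
Proof. by move=> S _ p _ _; exists 1. Qed.

Fact ropenI : setI_closed ropen.
Proof.
move=> A B oA oB S XS p [Ap Bp] pS.
have [e e0 eA] := oA S XS p Ap pS; have [d d0 dB] := oB S XS p Bp pS.
exists (Num.min e d); first by rewrite lt_min e0 d0.
move=> q [qS pq]; split; [apply: eA|apply: dB]; split => // v;
  by have := pq v; rewrite lt_min => /andP[].
Qed.

Fact ropenU (I : Type) (f : I -> set rpt) : (forall i, ropen (f i)) ->
  ropen (\bigcup_i f i).
Proof.
move=> of_ S XS p [i _ fp] pS; have [e e0 ef] := of_ i S XS p fp pS.
by exists e => // q /ef fq; exists i.
Qed.

HB.instance Definition _ := isOpenTopological.Build rpt ropenT ropenI ropenU.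

Lemma ropenE (U : set rpt) : open U = ropen U. Proof. by []. Qed.

Lemma real_belowP (p : rpt) : exists2 S, X S & carrier (sval p) S.
Proof. by case: (svalP p) => -[S XS pS] _ _; exists S. Qed.

Lemma coordinate_continuous v : continuous (fun p : rpt => sval p v).
Proof.
apply/continuousP => A oA; rewrite ropenE => S XS p /= Ap pS.
have := open_nbhs_nbhs (conj oA Ap) => /nbhs_ballP[e /= e0 eA].
by exists e => // q [_ /(_ v) pq]; apply: eA.
Qed.

(** Only the finitely many subsets of [S] can carry the points [f x], so an open set containing [p]
    is entered on each of these simplices separately. A simplex that misses part of the support of
    [p] is eventually avoided, because some coordinate outside it is positive at [p]. *)
Lemma cvg_rpt (T : Type) (F : set_system T) (FF : Filter F) (f : T -> rpt) p
    (S : {fset V}) :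
  (\forall x \near F, below S (sval (f x))) ->
  (forall v, (fun x => sval (f x) v) @ F --> sval p v) ->
  f @ F --> p.
Proof.
move=> fS fp U; rewrite nbhsE => -[B [oB Bp] BU].
suff : \forall x \near F, B (f x) by apply: filterS => x; exact: BU.
have key (T1 : {fset V}) : \forall x \near F,
    below T1 (sval (f x)) -> X T1 -> B (f x).
  have [XT|nXT] := pselect (X T1); last by apply: nearW.
  have [pT|/existsNP[v /not_implyP[vT pv]]] := pselect (below T1 (sval p)); last first.
    have pv0 : 0 < sval p v by rewrite lt_def (real_ge0 v (svalP p)) andbT; apply/eqP.
    have : \forall x \near F, 0 < sval (f x) v.
      by have /cvgrPdist_lt/(_ _ pv0) := fp v; apply: filterS => x; rewrite ltr_norml => /andP[]; lra.
    by apply: filterS => x fx bT; move: fx; rewrite bT // ltxx.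
  have [e e0 eB] := oB T1 XT p Bp pT.
  have : \forall x \near F, forall v : T1, `|sval p (val v) - sval (f x) (val v)| < e.
    by apply: filter_forall => v; have /cvgrPdist_lt/(_ _ e0) := fp (val v).
  apply: filterS => x fx bT _; apply: eB; split => // v.
  have [vT|vT] := boolP (v \in T1); first exact: (fx [` vT]%fset).
  by rewrite pT // bT // subrr normr0.
have : \forall x \near F, forall T1 : fpowerset S,
    below (val T1) (sval (f x)) -> X (val T1) -> B (f x).
  by apply: filter_forall => T1; exact: key.
apply: filterS2 fS => x bS H.
have [T1 XT1 cT1] := real_belowP (f x).
have T1S : T1 \in fpowerset S by rewrite fpowersetE; exact: carrier_sub bS.
by apply: (H [` T1S]%fset) => //=; exact: carrier_below.
Qed.

Lemma rpt_hausdorff : hausdorff_space rpt.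
Proof.
rewrite open_hausdorff => p q pq.
have [v pqv] : exists v, sval p v != sval q v.
  apply: contrapT => no; move/eqP: pq; apply; apply: rpt_inj; apply/funext => v.
  by apply/eqP/negPn/negP => h; apply: no; exists v.
have := @norm_hausdorff R R; rewrite open_hausdorff => /(_ _ _ pqv).
move=> [[A B] [/= /set_mem Ap /set_mem Bq] [oA oB /eqP AB]].
exists ((fun p => sval p v) @^-1` A, (fun p => sval p v) @^-1` B).
  by split; apply/mem_set.
split => /=.
- by apply: open_comp => // x _; exact: coordinate_continuous.
- by apply: open_comp => // x _; exact: coordinate_continuous.
- by apply/eqP; rewrite -preimage_setI AB preimage_set0.
Qed.

(** Cells of the barycentric subdivision. Subdividing makes actions admissible: a group element that
    preserves a chain preserves each of its members, and the coordinates of a point of the cell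
    depend only on which members contain a vertex. *)
Record flag := Flag {
  chain :> seq {fset V};
  chain_neq : chain != [::];
  chain_sorted : sorted (@fproper V) chain;
  chain_X : forall S, S \in chain -> X S }.

HB.instance Definition _ := gen_eqMixin flag.
HB.instance Definition _ := gen_choiceMixin flag.

Implicit Types e : flag.

Lemma flag_inj : injective chain.
Proof.
move=> [e a b c] [e' a' b' c'] /= ee; subst e'.
by congr Flag; exact: Prop_irrelevance.
Qed.

Definition fdim e := (size e).-1.

Lemma fdimS e : (fdim e).+1 = size e.
Proof. by rewrite /fdim prednK // lt0n size_eq0 chain_neq. Qed.

Definition level e i : {fset V} := nth fset0 e i.

Lemma level_mem e (i : nat) : (i <= fdim e)%N -> level e i \in chain e.
Proof. by move=> ie; rewrite mem_nth // -fdimS. Qed.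

Lemma memP_level e S : S \in chain e -> exists2 i : nat, (i <= fdim e)%N & S = level e i.
Proof. by case/(nthP fset0) => i ie <-; exists i => //; rewrite -ltnS fdimS. Qed.

Lemma fproper_trans' : transitive (@fproper V).
Proof. by move=> B A C AB /fproper_sub; exact: fproper_sub_trans. Qed.

Lemma fproper_irr : irreflexive (@fproper V).
Proof. by move=> A; apply/negbTE/fproper_irrefl. Qed.

Lemma level_lt e (i j : nat) : (i < j)%N -> (j <= fdim e)%N ->
  fproper (level e i) (level e j).
Proof.
move=> ij je; apply: (sorted_ltn_nth fproper_trans') => //.
- exact: chain_sorted.
- by rewrite inE -fdimS ltnS ltnW // (leq_trans ij).
- by rewrite inE -fdimS.
Qed.

Lemma level_le e (i j : nat) : (i <= j)%N -> (j <= fdim e)%N ->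
  fsubset (level e i) (level e j).
Proof.
rewrite leq_eqVlt => /orP[/eqP->|ij je]; first by rewrite fsubset_refl.
exact/fproper_sub/level_lt.
Qed.

Lemma level_pick e (i : nat) : (i <= fdim e)%N -> exists v, v \in level e i /\
  forall j : nat, (j < i)%N -> v \notin level e j.
Proof.
case: i => [|i] ie.
  by have /(proj1 cX)/fset0Pn[v] := chain_X (level_mem ie); exists v; split.
have := level_lt (ltnSn i) ie; rewrite fproperE => /andP[_ /fsubsetPn[v v1 v2]].
exists v; split => // j ji; apply: contra v2; apply/fsubsetP.
by apply: level_le => //; exact: ltnW.
Qed.

(** A vertex that enters the chain at the [i]-th simplex. The coordinate of a point of the cell
    there is the sum of its weights from [i] on, so that consecutive pivots recover the weights. The
    second branch is a default for [i] beyond the end of the chain. *)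
Definition pivot e (i : nat) : V :=
  match pselect (exists v, v \in level e i /\
    forall j : nat, (j < i)%N -> v \notin level e j) with
  | left H => sval (cid H)
  | right _ => sval (cid (fset0Pn _ (proj1 cX _ (chain_X (level_mem (leq0n (fdim e)))))))
  end.

Lemma pivotP e (i j : nat) : (i <= fdim e)%N -> (j <= fdim e)%N ->
  (pivot e i \in level e j) = (i <= j)%N.
Proof.
move=> ie je; rewrite /pivot; case: pselect => [H|]; last by case; exact: level_pick.
case: (cid H) => /= v [vi vj]; case: leqP => ij; last by apply/negbTE/vj.
by move: vi; apply/fsubsetP; exact: level_le.
Qed.

(** In coordinates normalised by their maximum the barycentre of a simplex is its indicator
    function; the points of the cell are convex combinations of these. *)
Definition chain_pt e (w : 'I_(fdim e).+1 -> R) : V -> R :=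
  fun v => \sum_i w i * (v \in level e i)%:R.

Definition tail e (w : 'I_(fdim e).+1 -> R) (i : nat) : R :=
  \sum_(j : 'I_(fdim e).+1 | (i <= j)%N) w j.

Arguments tail : clear implicits.

Section Weights.
Variables (e : flag) (w : 'I_(fdim e).+1 -> R).

Lemma chain_pt_pivot (i : nat) : (i <= fdim e)%N -> chain_pt w (pivot e i) = tail e w i.
Proof.
move=> ie; rewrite /chain_pt /tail [RHS]big_mkcond; apply: eq_bigr => j _.
rewrite pivotP //; last by rewrite -ltnS.
by case: leqP; rewrite ?mulr1 ?mulr0.
Qed.

Lemma tailS (i : 'I_(fdim e).+1) : tail e w i - tail e w i.+1 = w i.
Proof.
rewrite /tail (bigD1 i) //= -addrA [X in _ + X](_ : _ = 0) ?addr0 //.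
apply/eqP; rewrite subr_eq0; apply/eqP; apply: eq_bigl => j.
by rewrite ltn_neqAle andbC eq_sym.
Qed.

Lemma tail_ge (i : nat) : (fdim e < i)%N -> tail e w i = 0.
Proof.
move=> ie; rewrite /tail big_pred0 // => j; apply/negbTE.
by rewrite -ltnNge (leq_trans (ltn_ord j)).
Qed.

Hypotheses (w0 : forall i, 0 <= w i) (w1 : \sum_i w i = 1).

Lemma tail0 : tail e w 0 = 1. Proof. by rewrite -w1 /tail. Qed.

Lemma chain_pt_ge v (i : nat) : (i <= fdim e)%N -> v \in level e i ->
  tail e w i <= chain_pt w v.
Proof.
move=> ie vi; rewrite /tail big_mkcond; apply: ler_sum => j _.
case: leqP => ij; last by rewrite mulr_ge0.
have sij : fsubset (level e i) (level e j) by apply: level_le; rewrite // -ltnS.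
by rewrite (fsubsetP sij) // mulr1.
Qed.

Lemma chain_pt_le v (i : nat) : (i <= fdim e)%N -> v \notin level e i ->
  chain_pt w v <= tail e w i.+1.
Proof.
move=> ie vi; rewrite /tail [leRHS]big_mkcond; apply: ler_sum => j _.
case: ltnP => ij; first by case: (_ \in _); rewrite ?mulr1 ?mulr0.
suff /negbTE -> : v \notin level e j by rewrite mulr0.
by apply: contra vi; apply/fsubsetP; exact: level_le.
Qed.

Lemma chain_pt_le1 v : chain_pt w v <= 1.
Proof.
rewrite -w1; apply: ler_sum => i _.
by case: (_ \in _); rewrite ?mulr1 ?mulr0.
Qed.

Lemma chain_pt_below : below (level e (fdim e)) (chain_pt w).
Proof.
move=> v vS; apply: big1 => i _.
suff /negbTE -> : v \notin level e i by rewrite mulr0.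
apply: contra vS; apply/fsubsetP; apply: level_le => //.
by rewrite -ltnS.
Qed.

Lemma chain_pt_real : real X (chain_pt w).
Proof.
have p0 : chain_pt w (pivot e 0) = 1 by rewrite chain_pt_pivot // tail0.
split; last by exists (pivot e 0).
- apply: (cone_below cX (chain_X (level_mem (leqnn (fdim e))))).
  + exact: chain_pt_below.
  + by move=> v; apply: sumr_ge0 => i _; rewrite mulr_ge0.
  + by exists (pivot e 0); rewrite p0 ltr01.
- exact: chain_pt_le1.
Qed.

(** The chain carrying a point consists of the superlevel sets of its coordinates. This is how a
    point determines its cell. *)
Definition superlevel (f : V -> R) S : Prop :=
  S != fset0 /\ exists2 a, 0 < a & forall v, (v \in S) = (a <= f v).

Lemma superlevel_chain S : superlevel (chain_pt w) S -> S \in chain e.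
Proof.
move=> [/fset0Pn[v0 v0S] [a a0 aS]].
pose P (i : nat) := (i <= fdim e)%N && (a <= tail e w i).
have P0 : exists i, P i.
  by exists 0%N; rewrite /P leq0n tail0 (le_trans _ (chain_pt_le1 v0)) // -aS.
have Pb i : P i -> (i <= fdim e)%N by case/andP.
case: (ex_maxnP P0 Pb) => i /andP[ie ai] im.
have ti : tail e w i.+1 < a.
  have [ie'|/tail_ge -> //] := leqP i.+1 (fdim e).
  rewrite ltNge; apply/negP => h.
  by have := im i.+1; rewrite /P ie' h ltnn => /(_ isT).
suff -> : S = level e i by exact: level_mem.
apply/fsetP => v; rewrite aS; have [vi|vi] := boolP (v \in level e i).
  exact: le_trans ai (chain_pt_ge ie vi).
by apply/negbTE; rewrite -ltNge (le_lt_trans (chain_pt_le ie vi)).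
Qed.

End Weights.

Lemma chain_superlevel e (w : 'I_(fdim e).+1 -> R) S : (forall i, 0 < w i) ->
  S \in chain e -> superlevel (chain_pt w) S.
Proof.
move=> w0 /[dup] Se /memP_level[i ie Si]; split; first exact: (proj1 cX _ (chain_X Se)).
have w0' j : 0 <= w j by exact: ltW.
have lt : tail e w i.+1 < tail e w i.
  by rewrite -subr_gt0 (tailS w (Ordinal (ie : (i < _.+1)%N))).
exists (tail e w i).
  apply: le_lt_trans lt; exact: sumr_ge0.
move=> v; rewrite Si; have [vi|vi] := boolP (v \in level e i).
  by rewrite chain_pt_ge.
by apply/esym/negbTE; rewrite -ltNge (le_lt_trans (chain_pt_le w0' ie vi)).
Qed.

Lemma flag_uniq e e' (w : 'I_(fdim e).+1 -> R) (w' : 'I_(fdim e').+1 -> R) :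
  (forall i, 0 < w i) -> \sum_i w i = 1 ->
  (forall i, 0 < w' i) -> \sum_i w' i = 1 ->
  chain_pt w = chain_pt w' -> e = e'.
Proof.
move=> w0 w1 w0' w1' ww; apply: flag_inj.
apply: (irr_sorted_eq fproper_trans' fproper_irr).
- exact: chain_sorted.
- exact: chain_sorted.
move=> S; apply/idP/idP => /chain_superlevel.
  by move=> /(_ w w0); rewrite ww; apply: superlevel_chain => // i; exact: ltW.
by move=> /(_ w' w0'); rewrite -ww; apply: superlevel_chain => // i; exact: ltW.
Qed.

(** Layer decomposition: subtracting from [f] its minimum on the support, times the indicator of the
    support, leaves a function of strictly smaller support. The induction is on the size of the
    support. *)
Lemma seq_chain (f : V -> R) S : carrier f S -> S != fset0 ->
  exists (s : seq {fset V}) (w : seq R), 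
  [/\ sorted (@fproper V) (rcons s S), size w = (size s).+1,
      forall x, x \in w -> 0 < x,
      forall T, T \in s -> fsubset T S /\ T != fset0 &
      forall v, f v = \sum_(i < (size s).+1) w`_i * (v \in nth fset0 (rcons s S) i)%:R].
Proof.
move: {2}#|` S|.+1 (ltnSn #|` S|) => n; elim: n => // n IH in f S *.
rewrite ltnS => Sn fS S0.
have /fset0Pn[v0 v0S] := S0.
have [m [m0 mle [vm vmS vme]]] : exists m, [/\ 0 < m, forall v, v \in S -> m <= f v &
    exists2 v, v \in S & f v = m].
  have [v vS vm] := arg_minP (fun v : S => f (val v)) (erefl true : xpredT ([` v0S]%fset)).
  exists (f (val v)); split; first exact: (carrier_gt0 fS (valP v)).
    by move=> u uS; exact: (vm [` uS]%fset).
  by exists (val v) => //; exact: valP.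
pose g v := f v - m * (v \in S)%:R.
have [S'0|S'0] := eqVneq ([fset v in S | 0 < g v]%fset) fset0.
  exists [::], [:: m]; split => //.
  - by move=> x; rewrite inE => /eqP ->.
  - move=> v; rewrite big_ord1 /=; have [vS|vS] := boolP (v \in S); last first.
      by rewrite (carrier_below fS) // mulr0.
    rewrite mulr1; apply/eqP; rewrite eq_le mle // andbT leNgt; apply/negP => h.
    have : v \in [fset v in S | 0 < g v]%fset.
      by rewrite !inE /= vS /g vS mulr1 subr_gt0.
    by rewrite S'0.
set S' := [fset v in S | 0 < g v]%fset in S'0 *.
have gS' : carrier g S'.
  apply: below_carrier.
    by move=> v vS; rewrite /g (negbTE vS) mulr0 subr0 (carrier_below fS).
  move=> v; rewrite /g; have [vS|vS] := boolP (v \in S).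
    by rewrite mulr1 subr_ge0 mle.
  by rewrite mulr0 subr0 (carrier_ge0 _ fS).
have S'S : fproper S' S.
  rewrite fproperE; apply/andP; split.
    by apply/fsubsetP => v; rewrite !inE => /andP[].
  apply/fsubsetPn; exists vm => //.
  by rewrite !inE /= vmS /g vmS mulr1 vme subrr ltxx.
have [|s [w [ss sw w0 sS sg]]] := IH g S' _ gS' S'0.
  exact: leq_trans (fproper_ltn_card S'S) Sn.
exists (rcons s S'), (rcons w m); split.
- case: (s) ss => [|x s'] /=; first by rewrite S'S.
  by move=> ss; rewrite rcons_path ss last_rcons S'S.
- by rewrite !size_rcons sw.
- by move=> x; rewrite mem_rcons inE => /orP[/eqP ->|/w0].
- move=> T; rewrite mem_rcons inE => /orP[/eqP ->|/sS[TS T0]]; split => //.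
  + exact: fproper_sub.
  + exact: fsubset_trans TS (fproper_sub S'S).
- move=> v; rewrite size_rcons big_ord_recr /= !nth_rcons !size_rcons sw ltnn eqxx.
  rewrite -[f v](subrK (m * (v \in S)%:R)) -/(g v) sg; congr (_ + _).
  by apply: eq_bigr => i _; rewrite [in RHS]nth_rcons sw ltn_ord [in RHS]nth_rcons size_rcons ltn_ord.
Qed.

Lemma flag_exists p : exists e (w : 'I_(fdim e).+1 -> R),
  [/\ forall i, 0 < w i, \sum_i w i = 1 & sval p = chain_pt w].
Proof.
have [S XS pS] := real_belowP p; have S0 := proj1 cX _ XS.
have [s [w [ss sw w0 sS sp]]] := seq_chain pS S0.
have eX T : T \in rcons s S -> X T.
  rewrite mem_rcons inE => /orP[/eqP -> //|/sS[TS T0]].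
  exact: (proj2 cX _ _ XS TS).
have e0 : rcons s S != [::] by rewrite -size_eq0 size_rcons.
pose e := Flag e0 ss eX.
have de : fdim e = size s by rewrite /fdim size_rcons.
exists e, (fun i => w`_i).
have wp (i : 'I_(fdim e).+1) : 0 < w`_i.
  by apply: w0; rewrite mem_nth // sw -de.
have pE : sval p = chain_pt (fun i : 'I_(fdim e).+1 => w`_i).
  by apply/funext => v; rewrite sp /chain_pt de.
split => //; case: (svalP p) => _ p1 [v pv].
apply/le_anti; apply/andP; split.
  rewrite -[leLHS]/(tail e (fun i => w`_i) 0) -chain_pt_pivot //.
  by rewrite -pE.
rewrite -pv pE; apply: ler_sum => i _.
by have := wp i; case: (_ \in _); rewrite ?mulr1 ?mulr0 => /ltW.
Qed.

Definition center e : rpt := exist _ _ (chain_pt_real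
  (fun i => ltW (bary_gt0 i (iffRL (open_disk_rad 0)
     (eq_ind_r (fun x => x < 1) ltr01 (rad0 R (fdim e))))))
  (sum_bary 0)).

Definition char_pt e (v : 'rV[R]_(fdim e)) : rpt :=
  match pselect (disk R (fdim e) v) with
  | left H => exist _ _ (chain_pt_real (fun i => bary_ge0 i H) (sum_bary v))
  | right _ => center e
  end.

Lemma open_diskW k : open_disk R k `<=` disk R k.
Proof. by move=> v; rewrite /disk /open_disk /= => /ltW. Qed.

Lemma char_ptE e v : disk R (fdim e) v -> sval (char_pt v) = chain_pt (bary v).
Proof. by move=> dv; rewrite /char_pt; case: pselect. Qed.

Lemma open_cellP e p : (@char_pt e @` open_disk R (fdim e)) p <->
  exists w : 'I_(fdim e).+1 -> R,
  [/\ forall i, 0 < w i, \sum_i w i = 1 & sval p = chain_pt w].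
Proof.
split=> [[v dv <-]|[w [w0 w1 pw]]].
  exists (bary v); split; [by move=> i; exact: bary_gt0|exact: sum_bary|].
  exact/char_ptE/open_diskW.
have [d we] := unbaryK w1 w0.
exists (unbary w) => //; apply: rpt_inj; rewrite char_ptE ?pw; last exact: open_diskW.
by congr chain_pt; apply/funext.
Qed.

Lemma char_cover : \bigcup_e (@char_pt e @` open_disk R (fdim e)) = setT.
Proof.
apply/seteqP; split => // p _; have [e [w H]] := flag_exists p.
by exists e => //; apply/open_cellP; exists w.
Qed.

Lemma char_disjoint : trivIset setT (fun e => @char_pt e @` open_disk R (fdim e)).
Proof.
move=> e e' _ _ [p [/open_cellP[w [w0 w1 pw]] /open_cellP[w' [w0' w1' pw']]]].
by apply: (flag_uniq w0 w1 w0' w1'); rewrite -pw.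
Qed.

Lemma char_continuous e : {within disk R (fdim e), continuous (@char_pt e)}.
Proof.
apply/subspace_continuousP => v dv.
apply: (@cvg_rpt _ _ _ _ _ (level e (fdim e))).
  near=> u; rewrite char_ptE; first exact: chain_pt_below.
  near: u; exact: withinT.
move=> x; rewrite char_ptE //.
suff : (fun u => chain_pt (bary u) x) @ within (disk R (fdim e)) (nbhs v) -->
    chain_pt (bary v) x.
  apply: cvg_trans; apply: near_eq_cvg; near=> u; rewrite char_ptE //.
  near: u; exact: withinT.
apply: cvg_bigsum => i _; apply: cvgM; last exact: cvg_cst.
apply: cvg_bary => j; apply: cvg_within_filter.
exact: coord_continuous.
Unshelve. all: by end_near. Qed.

Definition chart e p : 'rV[R]_(fdim e) := unbary (fun i =>
  sval p (pivot e i) - if (i < fdim e)%N then sval p (pivot e i.+1) else 0).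

Lemma weightE e (f : V -> R) (w : 'I_(fdim e).+1 -> R) (i : 'I_(fdim e).+1) :
  f = chain_pt w ->
  f (pivot e i) - (if (i < fdim e)%N then f (pivot e i.+1) else 0) = w i.
Proof.
move=> ->; have ie : (i <= fdim e)%N by rewrite -ltnS.
rewrite (chain_pt_pivot w ie) -[RHS]tailS; congr (_ - _).
by case: ltnP => ie'; [rewrite chain_pt_pivot|rewrite tail_ge].
Qed.

Lemma chartE e p (w : 'I_(fdim e).+1 -> R) : sval p = chain_pt w ->
  chart e p = unbary w.
Proof. by move=> pw; congr unbary; apply/funext => i; exact: weightE. Qed.

Lemma char_homeo e : exists2 g : rpt -> 'rV[R]_(fdim e),
  {in open_disk R (fdim e), cancel (@char_pt e) g} &
  {within @char_pt e @` open_disk R (fdim e), continuous g}.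
Proof.
exists (chart e).
  move=> v /set_mem dv; rewrite (chartE (char_ptE (open_diskW dv))).
  exact: baryK.
apply/subspace_continuousP => p /open_cellP[w [w0 w1 pw]].
apply: cvg_unbary.
  by rewrite -w1; apply: eq_bigr => i _; exact: weightE.
move=> i; apply: cvg_within_filter; apply: cvgB; first exact: coordinate_continuous.
case: ifP => _; first exact: coordinate_continuous.
exact: cvg_cst.
Qed.

Lemma finite_flags (B : {fset {fset V}}) :
  finite_set [set e : flag | forall S, S \in chain e -> S \in B].
Proof.
pose f e : {fset {fset V}} := [fset S in chain e]%fset.
apply: (@sub_finite_set _ _ (f @^-1` [set` fpowerset B])).
  move=> e eB /=; rewrite fpowersetE; apply/fsubsetP => S.
  by rewrite !inE => /eB.
apply: finite_preimage; last exact: finite_fset.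
move=> e e' _ _ ee; apply: flag_inj.
apply: (irr_sorted_eq fproper_trans' fproper_irr).
- exact: chain_sorted.
- exact: chain_sorted.
by move=> S; have /fsetP/(_ S) := ee; rewrite !inE.
Qed.

(** Superlevel sets show that the chain of a boundary point is part of the chain of the cell. The
    two are different: a point determines its weights, and on the sphere one of the weights of [e]
    vanishes. *)
Lemma char_closure_finite e : exists2 D : set flag,
  finite_set D /\ (forall f, D f -> (fdim f < fdim e)%N) &
  @char_pt e @` sphere R (fdim e) `<=`
    \bigcup_(f in D) (@char_pt f @` open_disk R (fdim f)).
Proof.
exists [set f : flag | (forall S, S \in chain f -> S \in [fset S in chain e]%fset) /\
   (fdim f < fdim e)%N].
  split; last by move=> f [].
  apply: sub_finite_set (finite_flags [fset S in chain e]%fset).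
  by move=> f [].
move=> p [v sv vp].
have dv : disk R (fdim e) v.
  by move: sv; rewrite /sphere /disk /= => ->.
have pE : sval p = chain_pt (bary v) by rewrite -vp char_ptE.
have [i0 bi0] := sphere_bary sv.
have [f [w [w0 w1 pw]]] := flag_exists p.
have fe S : S \in chain f -> S \in chain e.
  move=> /(chain_superlevel w0); rewrite -pw pE; apply: superlevel_chain.
    by move=> i; exact: bary_ge0.
  exact: sum_bary.
exists f; last by apply/open_cellP; exists w.
split; first by move=> S /fe; rewrite !inE.
have us h : uniq (chain h) by apply: (sorted_uniq fproper_trans' fproper_irr); exact: chain_sorted.
have le : (size f <= size e)%N by apply: uniq_leq_size.
rewrite -ltnS !fdimS ltn_neqAle le andbT; apply/eqP => ff.
have fE : f = e.
  apply: flag_inj; apply: (irr_sorted_eq fproper_trans' fproper_irr).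
  - exact: chain_sorted.
  - exact: chain_sorted.
  by case: (uniq_min_size (us f) fe _); rewrite ?ff.
subst f.
have : 0 < bary v i0; last by rewrite bi0 ltxx.
by rewrite -(weightE i0 pE) (weightE i0 pw).
Qed.

(** A closed simplex meets only cells whose chains consist of faces of it, and these are finite in
    number. *)
Lemma char_weak_topology (A : set rpt) :
  (forall e, closed (A `&` @char_pt e @` disk R (fdim e))) -> closed A.
Proof.
move=> clA; rewrite -openC ropenE => S XS p Ap pS.
pose D := [set e : flag | forall T, T \in chain e -> T \in fpowerset S].
pose C := \bigcup_(e in D) (A `&` @char_pt e @` disk R (fdim e)).
have : closed C by apply: closed_bigcup => //; exact: finite_flags.
rewrite -openC ropenE => /(_ S XS p) [||d d0 dC].
- by move=> [e _ [Ae _]].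
- exact: pS.
exists d => // q pq Aq; have := dC q pq; apply.
have [e [w H]] := flag_exists q; have [w0 w1 qw] := H.
exists e; last first.
  split=> //; have /open_cellP[v dv <-] : (exists w, _) := ex_intro _ w H.
  by exists v => //; exact: open_diskW.
move=> T /memP_level[i ie ->]; rewrite fpowersetE; apply/fsubsetP => v vi.
have w0' j : 0 <= w j by exact: ltW.
have := chain_pt_ge w0' ie vi; rewrite -qw; apply: contraTT => vS.
case: pq => /(_ v vS) -> _; rewrite -ltNge.
apply: (@lt_le_trans _ _ (w (Ordinal (ie : (i < _.+1)%N)))) => //.
by rewrite /tail (bigD1 (Ordinal (ie : (i < _.+1)%N))) //= lerDl sumr_ge0.
Qed.

Definition barycentric : CW_structure R rpt :=
  @CWStructure R rpt flag fdim char_pt rpt_hausdorff char_cover char_disjoint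
    char_continuous char_homeo char_closure_finite char_weak_topology.

Lemma barycentric_dim (d : nat) : (forall S, X S -> (#|` S| <= d)%N) ->
  finite_dimensional barycentric.
Proof.
move=> Xd; exists d => e /=.
have H (i : nat) : (i <= fdim e)%N -> (i < #|` level e i|)%N.
  elim: i => [|i IH] ie.
    by rewrite cardfs_gt0 (proj1 cX) //; apply: chain_X; exact: level_mem.
  apply: (leq_ltn_trans (IH (ltnW ie))); apply: fproper_ltn_card.
  exact: level_lt.
apply: ltnW; apply: (leq_trans (H _ (leqnn _))); apply: Xd.
by apply: chain_X; exact: level_mem.
Qed.

End Realisation.

(** * From simplicial complexes to cell complexes *)

Section Contraction.
Variables (R : realType) (V : choiceType) (X : {fset V} -> Prop).
Hypothesis cX : simplicial X.
Variable I : (V -> R) -> Prop.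
Hypothesis Icl : forall p : V -> R, ~ I p ->
  exists2 e : R, 0 < e & forall q, (forall v, `|p v - q v| < e) -> ~ I q.

Let F : set (rpt R X) := [set p | I (sval p)].

Variables (h : R -> (V -> R) -> V -> R).
Hypothesis hX : forall t p, 0 <= t <= 1 -> real X p -> I p ->
  real X (h t p) /\ I (h t p).
Hypothesis hc : homotopy_continuous X I h.

Definition lift_homotopy (tx : R * rpt R X) : rpt R X :=
  match pselect (0 <= tx.1 <= 1 /\ I (sval tx.2)) with
  | left H => exist _ _ (proj1 (hX (proj1 H) (svalP tx.2) (proj2 H)))
  | right _ => tx.2
  end.

Let J : set R := [set t | 0 <= t <= 1].

Lemma lift_homotopyE t (p : rpt R X) : J t -> I (sval p) ->
  sval (lift_homotopy (t, p)) = h t (sval p).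
Proof. by move=> t01 Ip; rewrite /lift_homotopy; case: pselect => //= -[]. Qed.

Lemma lift_homotopy_near S (U : set (rpt R X)) t (p : rpt R X) : X S -> open U ->
  J t -> F p -> below S (sval p) -> U (lift_homotopy (t, p)) ->
  exists2 e : R, 0 < e & forall s (q : rpt R X), J s -> F q -> `|t - s| < e ->
    near_on S e p q -> U (lift_homotopy (s, q)).
Proof.
move=> XS oU Jt Fp pS Uh; have [T hT hcv] := hc XS.
pose D e : set (R * (V -> R)) := [set x | dom X I S x.1 x.2 /\
  `|t - x.1| < e /\ forall v, `|sval p v - x.2 v| < e].
pose FF := filter_from [set e : R | 0 < e] D.
have FFF : Filter FF.
  apply: filter_from_filter; first by exists 1 => /=.
  move=> d e /= d0 e0; exists (Num.min d e); first by rewrite /= lt_min d0 e0.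
  move=> x [Dx []]; rewrite lt_min => /andP[td te] H.
  by split; (split=> //; split => // v; have := H v; rewrite lt_min => /andP[]).
have Dp : dom X I S t (sval p) by split => //; exact: svalP.
have FD : FF [set x | dom X I S x.1 x.2] by exists 1 => //= x [].
have F1 : fst @ FF --> t.
  by apply/cvgrPdist_lt => e e0; exists e => //= x [_ []].
have F2 v : (fun x => x.2 v) @ FF --> sval p v.
  by apply/cvgrPdist_lt => e e0; exists e => //= x [_ [_]].
pose lh (x : R * (V -> R)) : rpt R X :=
  match pselect (real X x.2) with
  | left H => lift_homotopy (x.1, exist _ _ H) | right _ => p end.
have lhE x : dom X I S x.1 x.2 -> sval (lh x) = h x.1 x.2.
  by move=> [x01 Xx Ix _]; rewrite /lh; case: pselect => // H; rewrite lift_homotopyE.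
have lc : lh @ FF --> lift_homotopy (t, p).
  apply: (@cvg_rpt _ _ _ _ FF FFF _ _ T).
    by apply: filterS FD => x Dx; rewrite lhE //; exact: hT.
  move=> v; rewrite lift_homotopyE //.
  have := hcv _ FFF t (sval p) Dp FD F1 F2 v.
  apply: cvg_trans; apply: near_eq_cvg; apply: filterS FD => x Dx.
  by rewrite lhE.
have [e e0 eU] := lc _ (open_nbhs_nbhs (conj oU Uh)).
exists e => // s q Js Fq ts pq; have [qS pqv] := pq.
have := eU (s, sval q); rewrite /= /lh; case: pselect => [H|nH].
  rewrite (_ : exist _ _ H = q); last exact: rpt_inj.
  by apply; split; [split|split].
by case: nH; exact: svalP.
Qed.

(** The homotopy is controlled on the product of the interval with each closed simplex, while the
    topology at hand is a product topology. The tube argument closes the gap: the points [q] for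
    which a whole compact set [K] of times near [t] is carried into [B] form an open set, and this
    openness can be checked simplex by simplex. *)
Lemma lift_homotopy_continuous :
  {within (J `*` F)%classic, continuous lift_homotopy}.
Proof.
apply/subspace_continuousP => -[t p] [/= Jt Fp] U.
rewrite nbhsE => -[B [oB Bp] BU].
have [S XS /carrier_below pS] := real_belowP p.
have [e e0 eB] := lift_homotopy_near XS oB Jt Fp pS Bp.
pose K : set R := [set s | J s /\ `|t - s| <= e / 2].
have cK : compact K.
  have -> : K = (`[0, 1]%classic `&` `[t - e / 2, t + e / 2]%classic).
    apply/seteqP; split => s; rewrite /K /J /= !in_itv /=.
      by move=> [s01]; rewrite ler_norml => /andP[*]; split => //; apply/andP; split; lra.
    by move=> [s01 /andP[*]]; split => //; rewrite ler_norml; apply/andP; split; lra.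
  apply: (@compact_closedI R); first exact: segment_compact.
  by apply: interval_closed.
pose A : set (rpt R X) := [set q | F q -> forall s, K s -> B (lift_homotopy (s, q))].
have Ap : A p.
  move=> _ s [Js ts]; apply: eB => //.
    by apply: le_lt_trans ts _; lra.
  by split => // v; rewrite subrr normr0.
have oA : open A.
  rewrite ropenE => T XT q Aq qT.
  (* A point outside [F] lies in [A] for trivial reasons; here the openness of the complement of [F]
     enters. *)
  have [Fq|nFq] := pselect (F q); last first.
    have [d d0 dI] := Icl nFq; exists d => // r [_ qr] Fr.
    by case: (dI (sval r)).
  have /compact_near_coveringP/near_covering_withinP := cK.
  move=> /(_ R (0%R^'+) (fun d s => forall r, F r -> near_on T d q r ->
     B (lift_homotopy (s, r))) _) H.
  have : \forall d \near 0%R^'+, K `<=` (fun s => forall r, F r -> near_on T d q r ->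
     B (lift_homotopy (s, r))).
    apply: H => s Ks; have [d d0 dB] := lift_homotopy_near XT oB Ks.1 Fq qT (Aq Fq s Ks).
    exists ([set s' | `|s - s'| < d], [set d' | d' < d]) => /=.
      split; first exact: nbhsx_ballx.
      by apply: nbhs_right_lt.
    move=> [s' d'] /= [ss dd] [Js' _] r Fr [rT qr]; apply: dB => //.
    by split => // v; apply: lt_trans dd.
  move=> Hd; have [d [d0 Kd]] : exists d : R, 0 < d /\ K `<=` (fun s => forall r, F r ->
      near_on T d q r -> B (lift_homotopy (s, r))).
    near (0:R)^'+ => d; exists d; split; last by near: d.
    by near: d; exact: nbhs_right_gt.
  by exists d => // r qr Fr s Ks; exact: Kd.
rewrite /within /= nbhs_simpl.
exists ([set s | `|t - s| < e / 2], A) => /=.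
  split; first by apply: nbhsx_ballx; rewrite divr_gt0.
  exact: open_nbhs_nbhs.
move=> [s q] /= [ts Aq] [Js Fq]; apply: BU; apply: Aq => //.
by split => //; exact: ltW.
Unshelve. all: by end_near. Qed.

End Contraction.

Lemma contr_contractible (R : realType) (V : choiceType) (X : {fset V} -> Prop)
    (I : (V -> R) -> Prop) : simplicial X ->
  (forall p : V -> R, ~ I p ->
    exists2 e : R, 0 < e & forall q, (forall v, `|p v - q v| < e) -> ~ I q) ->
  contr X I -> contractible R [set p : rpt R X | I (sval p)].
Proof.
move=> cX Icl [h [a [[Xa Ia] hX h0 h1 hc]]].
exists (exist _ a Xa) => //; exists (lift_homotopy hX).
have J01 : `[0%R, 1%R]%classic = [set t : R | 0 <= t <= 1].
  by apply/seteqP; split => t /=; rewrite in_itv.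
split.
- by rewrite J01; exact: lift_homotopy_continuous.
- move=> t x; rewrite J01 => t01 /= Ix; rewrite lift_homotopyE //.
  by case: (hX t _ t01 (svalP x) Ix).
- move=> x /= Ix; apply: rpt_inj; rewrite lift_homotopyE //=.
    by rewrite h0 //; exact: svalP.
  by rewrite lexx ler01.
- move=> x /= Ix; apply: rpt_inj; rewrite lift_homotopyE //=.
    by rewrite h1 //; exact: svalP.
  by rewrite lexx ler01.
Qed.

(** * Actions on simplicial complexes and on their realisations *)

Definition vact (G : groupType) (V : Type) (a : G -> V -> V) : Prop :=
  (forall v, a 1%g v = v) /\ forall g h v, a (g * h)%g v = a g (a h v).

Definition push (G : Type) (V : choiceType) (a : G -> V -> V) g (S : {fset V}) :
  {fset V} := [fset a g v | v in S]%fset.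

Definition fixed_by (R : realType) (G H : groupType) (V : Type)
    (a : G -> V -> V) (f : H -> G) (p : V -> R) : Prop :=
  forall h v, p (a (f h) v) = p v.

(* A combinatorial analogue of [HFF]: the group acts on a simplicial complex, and
   subgroups are replaced by homomorphisms into the group. *)
Inductive HP (R : realType) : groupType -> Prop :=
| HP_vc (G : groupType) : vcimg (@id G) -> HP R G
| HP_step (G : groupType) (V : choiceType) (X : {fset V} -> Prop)
    (a : G -> V -> V) (d : nat) :
    simplicial X -> (forall S, X S -> (#|` S| <= d)%N) ->
    vact a -> (forall g S, X S -> X (push a g S)) ->
    (forall S, X S -> forall (H : groupType) (f : H -> G), is_hom f -> injective f ->
       (forall h, push a (f h) S = S) -> HP R H) ->
    (forall (H : groupType) (f : H -> G), is_hom f -> vcimg f ->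
       contr X (fixed_by (R := R) a f)) ->
    HP R G.

Lemma virtually_cyclicP (G : groupType) : virtually_cyclic G <-> vcimg (@id G).
Proof.
split=> [[H [[c cH] fH]]|[c [l cl]]].
  have [l lE] : exists l : seq G, forall g, exists2 r, r \in l & exists2 h, h \in H & g = (r * h)%g.
    have /finite_fsetP[L LE] := fH.
    exists [seq xget 1%g [set r | [set (r * h)%g | h in [set` H]] = C] | C <- L] => g.
    set C := [set (g * h)%g | h in [set` H]].
    have CL : C \in L.
      have : range (fun g : G => [set (g * h)%g | h in [set` H]]) C by exists g.
      by rewrite LE.
    have Cr : [set (xget 1%g [set r | [set (r * h)%g | h in [set` H]] = C] * h)%g | h in [set` H]] = C.
      apply: (@xgetPex _ 1%g [set r | [set (r * h)%g | h in [set` H]] = C]).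
      by exists g.
    exists (xget 1%g [set r | [set (r * h)%g | h in [set` H]] = C]); first exact: map_f.
    have : C g by exists 1%g; rewrite /= ?mulg1 //; exact: gpred1.
    by rewrite -[X in X g]Cr => -[h hH <-]; exists h.
  exists (val c), l => g; have [r rl [h hH ->]] := lE g; exists r => //.
  have [k [e|e]] := cH (Sub h hH : subgrp H).
    exists k%:Z => /=; congr (_ * _)%g.
    by rewrite -[h](SubK (subgrp H)) e (homX (@sval_hom _ _)).
  exists (- k%:Z); rewrite zexpN /=; congr (_ * _)%g.
  by rewrite -[h](SubK (subgrp H)) e (homV (@sval_hom _ _)) (homX (@sval_hom _ _)).
pose P x := exists z, x = zexp c z.
have P1 : P 1%g by exists 0.
have PM x y : P x -> P y -> P (x * y)%g.
  by move=> [z ->] [z' ->]; exists (z + z'); rewrite zexpD.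
have PV x : P x -> P x^-1%g by move=> [z ->]; exists (- z); rewrite zexpN.
have Pc : c \in sgroup P1 PM PV by apply/sgroupP; exists 1.
exists (sgroup P1 PM PV); split.
  exists (Sub c Pc) => g; have /sgroupP[z gz] := svalP g.
  case: z gz => n gz.
    exists n; left; apply: val_inj; apply: etrans gz _.
    by rewrite (homX (@sval_hom _ _)) SubK.
  exists n.+1; right; apply: val_inj; apply: etrans gz _.
  by rewrite (homV (@sval_hom _ _)) (homX (@sval_hom _ _)) SubK.
apply: (@sub_finite_set _ _ [set` [fset [set (r * h)%g | h in [set` sgroup P1 PM PV]] | r in l]%fset]).
  move=> C [g _ <-]; have [r rl [z gz]] := cl g.
  apply/imfsetP; exists r => //; apply/seteqP; split => _ [h /sgroupP[z' hz] <-].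
    rewrite gz hz -mulgA -zexpD; exists (zexp c (z + z')) => //.
    by apply/sgroupP; exists (z + z').
  exists (zexp c (z' - z)); first by apply/sgroupP; exists (z' - z).
  by rewrite gz hz -mulgA -zexpD addrC subrK.
exact: finite_fset.
Qed.

Section PushAction.
Variables (R : realType) (G : groupType) (V : choiceType) (X : {fset V} -> Prop).
Variable (a : G -> V -> V).
Hypotheses (cX : simplicial X) (aA : vact a).
Hypothesis aX : forall g S, X S -> X (push a g S).

Let a1 v : a 1%g v = v. Proof. by case: aA. Qed.
Let aM g h v : a (g * h)%g v = a g (a h v). Proof. by case: aA. Qed.

Lemma actK g : cancel (a g) (a g^-1%g).
Proof. by move=> v; rewrite -aM mulVg a1. Qed.

Lemma actVK g : cancel (a g^-1%g) (a g).
Proof. by move=> v; rewrite -aM mulgV a1. Qed.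

Lemma mem_push g (S : {fset V}) v : (v \in push a g S) = (a g^-1%g v \in S).
Proof.
apply/imfsetP/idP => [[u uS ->]|h]; first by rewrite actK.
by exists (a g^-1%g v) => //; rewrite actVK.
Qed.

Lemma real_push g (p : V -> R) : real X p -> real X (p \o a g^-1%g).
Proof.
move=> [[S XS pS] p1 [v pv]]; split; last by exists (a g v); rewrite /= actK.
- exists (push a g S); first exact: aX.
  by move=> u; rewrite mem_push; exact: pS.
- by move=> u; exact: p1.
Qed.

Definition rpt_act g (p : rpt R X) : rpt R X := exist _ _ (real_push g (svalP p)).

Lemma rpt_act1 p : rpt_act 1%g p = p.
Proof. by apply: rpt_inj; apply/funext => v; rewrite /= invg1 a1. Qed.

Lemma rpt_actM g h p : rpt_act (g * h)%g p = rpt_act g (rpt_act h p).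
Proof. by apply: rpt_inj; apply/funext => v; rewrite /= invgM aM. Qed.

Definition rpt_action : group_action G (rpt R X) := GroupAction rpt_act1 rpt_actM.

Lemma rpt_act_continuous g : continuous (rpt_act g).
Proof.
apply/continuousP => U oU; rewrite ropenE => S XS p /= Up pS.
have [|e e0 eU] := oU _ (aX g XS) _ Up.
  by move=> v; rewrite mem_push => /pS.
exists e => // q [qS pq]; apply: eU; split => [v|v]; last exact: pq.
by rewrite mem_push => /qS.
Qed.

Lemma push_sub g (S T : {fset V}) : fsubset (push a g S) (push a g T) = fsubset S T.
Proof.
apply/fsubsetP/idP => [ST|/fsubsetP ST v].
  apply/fsubsetP => v vS; have := ST (a g v).
  by rewrite !mem_push actK => /(_ vS).
by rewrite !mem_push => /ST.
Qed.

Definition flag_push (g : G) (e : flag X) : flag X.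
Proof.
refine (@Flag _ X (map (push a g) e) _ _ _).
- by rewrite -size_eq0 size_map size_eq0 chain_neq.
- rewrite (sorted_map); have := chain_sorted e.
  by apply: sub_sorted => S T; rewrite /= !fproperE !push_sub.
- by move=> S /mapP[T Te ->]; apply: aX; exact: chain_X Te.
Defined.

Lemma fdim_push g e : fdim (flag_push g e) = fdim e.
Proof. by rewrite /fdim size_map. Qed.

Lemma level_push g e (i : nat) : (i <= fdim e)%N ->
  level (flag_push g e) i = push a g (level e i).
Proof. by move=> ie; rewrite /level (nth_map fset0) // -fdimS. Qed.

Lemma rpt_act_open_cell g e :
  rpt_act g @` open_cell (barycentric R cX) e `<=`
  open_cell (barycentric R cX) (flag_push g e).
Proof.
move=> _ [p /open_cellP[w [w0 w1 pw]] <-]; apply/open_cellP.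
have de : (fdim (flag_push g e)).+1 = (fdim e).+1 by rewrite fdim_push.
exists (fun i => w (cast_ord de i)); split.
- by move=> i.
- rewrite -w1 (reindex (cast_ord de)) //.
  by exists (cast_ord (esym de)) => i _; rewrite ?cast_ordK ?cast_ordKV.
- apply/funext => v; rewrite /= pw /chain_pt (reindex (cast_ord de)) /=; last first.
    by exists (cast_ord (esym de)) => i _; rewrite ?cast_ordK ?cast_ordKV.
  apply: eq_bigr => i _; rewrite level_push ?mem_push //.
  by rewrite -ltnS -de.
Qed.

Lemma flag_pushK g e : flag_push g (flag_push g^-1%g e) = e.
Proof.
apply: flag_inj; rewrite /= -map_comp -[RHS]map_id; apply: eq_map => S /=.
by apply/fsetP => v; rewrite !mem_push invgK actVK.
Qed.

Lemma rpt_act_cell g e : rpt_act g @` open_cell (barycentric R cX) e =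
  open_cell (barycentric R cX) (flag_push g e).
Proof.
apply/seteqP; split; first exact: rpt_act_open_cell.
move=> p pe; exists (rpt_act g^-1%g p); last by rewrite -rpt_actM mulgV rpt_act1.
have := @rpt_act_open_cell g^-1%g (flag_push g e) (rpt_act g^-1%g p).
by have := flag_pushK g^-1%g e; rewrite invgK => ->; apply; exists p.
Qed.

Lemma rpt_admissible : admissible_cellular_action rpt_action (barycentric R cX).
Proof.
split; first split.
- exact: rpt_act_continuous.
- by move=> g e; exists (flag_push g e); [exact: fdim_push|exact: rpt_act_cell].
move=> g e ge p pe; have /open_cellP[w [w0 w1 pw]] := pe.
have e_e : flag_push g e = e.
  apply: (@char_disjoint R _ _ cX) => //; exists (rpt_act g p); split.
    by rewrite -[X in X _]/(open_cell (barycentric R cX) _) -rpt_act_cell; exists p.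
  by rewrite -[X in X _]/(open_cell (barycentric R cX) _) -ge; exists p.
apply: rpt_inj; apply/funext => v; rewrite /= pw; apply: eq_bigr => i _.
by rewrite -mem_push -level_push ?e_e // -ltnS.
Qed.

End PushAction.

Lemma fixed_by_closed (R : realType) (G H : groupType) (V : choiceType)
    (a : G -> V -> V) (f : H -> G) (p : V -> R) : ~ fixed_by a f p ->
  exists2 e : R, 0 < e & forall q, (forall v, `|p v - q v| < e) -> ~ fixed_by a f q.
Proof.
move=> /existsNP[h /existsNP[v /eqP pv]].
exists (`|p (a (f h) v) - p v| / 2).
  by rewrite divr_gt0 // normr_gt0 subr_eq0.
move=> q pq /(_ h v) e; have := pq (a (f h) v); have := pq v.
by rewrite e; have := ler_distD (q v) (p (a (f h) v)) (p v); rewrite (distrC (q v) (p v)); lra.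
Qed.

(** The isotropy group of a point preserves the support of its coordinates, which is a simplex, so
    that the stabiliser clause of [HP] covers all isotropy groups. *)
Lemma HP_HFF (R : realType) (G : groupType) : HP R G -> HFF R virtually_cyclic G.
Proof.
elim => {}G; first by move=> vG; apply: HFF_base; exact/virtually_cyclicP.
move=> V X a d cX Xd aA aX _ stab ctr.
refine (@HFF_step R virtually_cyclic G (rpt R X) (barycentric R cX) (rpt_action R aA aX) _ _ _ _).
- exact: barycentric_dim Xd.
- exact: rpt_admissible.
- move=> x; have [S XS xS] := real_belowP x.
  apply: (stab S XS _ (val : subgrp _ -> G)); [exact: sval_hom|exact: sval_inj|].
  move=> h; have /asboolP/(congr1 sval) hx := svalP h.
  apply: (carrier_uniq _ xS) => v; rewrite (mem_push aA) -[sval x]hx /=.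
  exact: xS.
- move=> H [K [/virtually_cyclicP vK [f [fM [g fK gK]]]]].
  have -> : fixed_points (rpt_action R aA aX) H =
      [set p : rpt R X | fixed_by a (val : subgrp H -> G) (sval p)].
    apply/seteqP; split => p /= Hp.
      move=> h v; have /(congr1 sval)/(congr1 (@^~ (a (val h) v))) := Hp _ (svalP h).
      by rewrite /= (actK aA) => ->.
    move=> h hH; apply: rpt_inj; apply/funext => v /=.
    by have := Hp (Sub h hH) (a h^-1%g v); rewrite SubK (actVK aA).
  apply: contr_contractible => //; first exact: fixed_by_closed.
  apply: ctr; first exact: sval_hom.
  have gM : is_hom g by move=> x y; rewrite -{1}(gK x) -{1}(gK y) -fM fK.
  apply: (@vcimg_inj _ _ _ (id \o g)); first by move=> x y /(can_inj gK) ->.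
  exact: vcimg_sub.
Qed.

(** * Joins and extensions *)

Section Join.
Variables (R : realType) (V : choiceType) (X : {fset V} -> Prop).
Variables (I : (V -> R) -> Prop) (V1 : pred V).
Hypotheses (cX : simplicial X) (sI : scale_closed I).

Definition restr1 (p : V -> R) : V -> R := fun v => if V1 v then p v else 0.
Definition restr2 (p : V -> R) : V -> R := fun v => if V1 v then 0 else p v.

Definition subcomplex1 (S : {fset V}) : Prop := X S /\ forall v, v \in S -> V1 v.

Hypothesis I1 : forall p, cone X p -> I p -> I (restr1 p).
Hypothesis join12 : forall p q c, 0 <= c -> cone X p -> I p ->
  cone subcomplex1 q -> I q ->
  cone X (fun v => c * restr2 p v + q v) /\ I (fun v => c * restr2 p v + q v).

Lemma nrm0 : nrm ((fun=> 0) : V -> R) = 0.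
Proof.
rewrite /nrm; have [[v _]|nV] := pselect (exists v : V, True).
  rewrite (_ : range _ = [set 0]) ?sup1 //.
  by apply/seteqP; split => [x [u _ <-]|x ->] //; exists v.
rewrite (_ : range _ = set0) ?sup0 //.
by apply/seteqP; split => [x [v _ _]|//]; case: nV; exists v.
Qed.

Lemma simplicial1 : simplicial subcomplex1.
Proof.
split=> [S [XS _]|S T [XS SV] TS T0]; first exact: (proj1 cX).
by split; [exact: (proj2 cX S)|move=> v /(fsubsetP TS)/SV].
Qed.

Lemma restr1_0 p : (forall v, 0 <= p v) -> ~ (exists v, 0 < restr1 p v) ->
  restr1 p = fun=> 0.
Proof.
move=> p0 no; apply/funext => v; apply/eqP/negPn/negP => h; apply: no; exists v.
by rewrite lt_def h /= /restr1; case: ifP => // _; exact: p0.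
Qed.

Lemma restr12 p : (fun v => restr1 p v + restr2 p v) = p.
Proof.
by apply/funext => v; rewrite /restr1 /restr2; case: ifP; rewrite ?addr0 ?add0r.
Qed.

Lemma cone_restr1 p : cone X p -> (exists v, 0 < restr1 p v) ->
  cone subcomplex1 (restr1 p).
Proof.
move=> [S XS pS] [v pv]; have p0 u := carrier_ge0 u pS.
have bS : below [fset u in S | V1 u]%fset (restr1 p).
  move=> u; rewrite !inE /restr1 /= negb_and; case: ifP => //= _.
  by rewrite orbF => /(carrier_below pS).
have vS : v \in [fset u in S | V1 u]%fset.
  by apply: contraLR pv => /bS ->; rewrite ltxx.
apply: (cone_below simplicial1 _ bS).
- split; last by move=> u; rewrite !inE => /andP[].
  apply: (proj2 cX S) => //.
    by apply/fsubsetP => u; rewrite !inE => /andP[].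
  by apply/fset0Pn; exists v.
- by move=> u; rewrite /restr1; case: ifP => // _; exact: p0.
- by exists v.
Qed.

(** As far as invariant points are concerned, [X] is the join of its part on [V1] with the rest. In
    the first half of the time the part on [V1] is contracted to [a] while its size [m p] is kept;
    in the second half everything slides straight to [a], which can be joined to any invariant
    point. *)
Lemma contr_join : contr subcomplex1 I -> contr X I.
Proof.
move=> [h [a [[Xa Ia] hX h0 h1 hc]]].
pose m p := nrm (restr1 p).
pose q1 p := fun v => (m p)^-1 * restr1 p v.
pose tau (t : R) := Num.min (2 * t) 1.
pose s (t : R) := Num.max (2 * t - 1) 0.
pose W t p := fun v => (1 - s t) * (m p * h (tau t) (q1 p) v + restr2 p v) + s t * a v.
have tau01 t : 0 <= t <= 1 -> 0 <= tau t <= 1.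
  by move=> /andP[t0 t1]; rewrite /tau ge_min lexx orbT andbT le_min ler01 andbT; lra.
have s01 t : 0 <= t <= 1 -> 0 <= s t <= 1.
  by move=> /andP[t0 t1]; rewrite /s le_max lexx orbT /= ge_max ler01 andbT; lra.
have tau_s t : 0 < s t -> tau t = 1.
  by rewrite /s /tau lt_max ltxx orbF => t1; apply: min_idPr; lra.
have mP p : cone X p -> I p ->
    (0 < m p /\ real subcomplex1 (q1 p) /\ I (q1 p)) \/ (m p = 0 /\ restr1 p = fun=> 0).
  move=> Xp Ip; have [ex|no] := pselect (exists v, 0 < restr1 p v).
    left; have c1 := cone_restr1 Xp ex.
    have [m0 _ _] := cone_nrm simplicial1 c1; split => //.
    split; first exact: cone_real simplicial1 c1.
    by apply: sI; [rewrite invr_gt0|exact: I1].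
  right; have e := restr1_0 (fun v => cone_ge0 v Xp) no; split=> //.
  by rewrite /m e nrm0.
have Xa' : cone X a by case: Xa => -[S [XS _] aS] _ _; exists S.
apply: (@contr_cone _ _ _ _ W a) => //.
- move=> t p t01 Xp Ip.
  have cp := real_cone Xp.
  have [/andP[st0 st1] tt] := (s01 t t01, tau01 t t01).
  have cs : 0 <= 1 - s t by rewrite subr_ge0.
  have key k y : 0 < k -> real subcomplex1 y -> I y ->
      W t p = (fun v => (1 - s t) * restr2 p v + k * y v) -> cone X (W t p) /\ I (W t p).
    move=> k0 Xy Iy ->; apply: join12 => //; first exact: cone_scale (real_cone Xy).
    exact: sI.
  have [[m0 [Xq Iq]]|[m0 r0]] := mP p cp Ip.
    have [s0|s0] := eqVneq (s t) 0.
      apply: (key (m p) (h (tau t) (q1 p))) => //.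
      + exact: (hX _ _ tt Xq Iq).1.
      + exact: (hX _ _ tt Xq Iq).2.
      + by apply/funext => v; rewrite /W s0 subr0 !mul1r mul0r addr0 addrC.
    have sp : 0 < s t by rewrite lt_def s0.
    apply: (key ((1 - s t) * m p + s t) a) => //.
      by rewrite ltr_wpDl // mulr_ge0 // ltW.
    apply/funext => v; rewrite /W tau_s // h1 //; ring.
  have [s0|s0] := eqVneq (s t) 0.
    have -> : W t p = p.
      rewrite -[RHS]restr12 r0; apply/funext => v; rewrite /W s0 m0; ring.
    by [].
  apply: (key (s t) a) => //; first by rewrite lt_def s0.
  by apply/funext => v; rewrite /W m0 mul0r add0r.
- move=> p Xp Ip; apply/funext => v.
  have -> : W 0 p v = m p * h 0 (q1 p) v + restr2 p v.
    rewrite /W /s /tau mulr0 sub0r (max_idPr _) ?lerN10 // subr0 mul0r addr0 mul1r.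
    by rewrite (min_idPl _) // ler01.
  have [[m0 [Xq Iq]]|[m0 r0]] := mP p (real_cone Xp) Ip.
    rewrite h0 // /q1 mulVKf ?gt_eqF //; exact: (congr1 (@^~ v) (restr12 p)).
  by rewrite m0 mul0r; rewrite -{2}[p]restr12 r0.
- move=> p Xp Ip; apply/funext => v.
  have sE : s 1 = 1 by rewrite /s max_l; lra.
  by rewrite /W sE subrr mul0r add0r mul1r.
move=> S XS; have [A XA aA] := Xa'.
pose S1 := [fset u in S | V1 u]%fset.
have bS1 p : below S p -> below S1 (restr1 p).
  move=> pS u; rewrite !inE /restr1 /= negb_and; case: ifP => //= _.
  by rewrite orbF => /pS.
have p0 t p : dom X I S t p -> forall v, 0 <= p v.
  by move=> [_ Xp _ _] v; apply: real_ge0 Xp.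
have mE t p : dom X I S t p -> m p = \big[Num.max/0]_(v <- S1) restr1 p v.
  move=> D; have [_ Xp Ip pS] := D.
  have r0 v : 0 <= restr1 p v by rewrite /restr1; case: ifP => // _; exact: p0 D v.
  have [ex|no] := pselect (exists v, 0 < restr1 p v).
    exact: nrmE (bS1 _ pS) r0 ex.
  rewrite /m (restr1_0 (p0 _ _ D) no) nrm0.
  by apply/esym/(big_ind (fun x => x = 0)) => // x y -> ->; rewrite maxxx.
have [T hT hcv] : exists2 T : {fset V},
    (forall t p, dom subcomplex1 I S1 t p -> below T (h t p)) &
    forall (F : set_system (R * (V -> R))), Filter F ->
    forall t0 p0, dom subcomplex1 I S1 t0 p0 -> F [set x | dom subcomplex1 I S1 x.1 x.2] ->
    fst @ F --> t0 -> (forall v, (fun x => x.2 v) @ F --> p0 v) ->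
    forall v, (fun x => h x.1 x.2 v) @ F --> h t0 p0 v.
  have [S10|S10] := eqVneq S1 fset0.
    have nD t p : ~ dom subcomplex1 I S1 t p.
      move=> [_ [_ _ [v pv]] _ bp]; have := bp v; rewrite S10 inE => /(_ isT)/eqP.
      by rewrite pv oner_eq0.
    by exists fset0 => [t p /nD //|F FF t0 q0 /nD].
  apply: hc; split; last by move=> v; rewrite !inE => /andP[].
  by apply: (proj2 cX S) => //; apply/fsubsetP => u; rewrite !inE => /andP[].
have domq t p : dom X I S t p -> 0 < m p -> dom subcomplex1 I S1 (tau t) (q1 p).
  move=> [t01 Xp Ip pS] m0.
  have [[_ [Xq Iq]]|[m00 _]] := mP p (real_cone Xp) Ip; last by move: m0; rewrite m00 ltxx.
  split => //; first exact: tau01.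
  by move=> v /(bS1 _ pS) e; rewrite /q1 e mulr0.
exists (T `|` S `|` A)%fset.
  move=> t p D v; rewrite !inE !negb_or => /andP[/andP[vT vS] vA].
  have [_ Xp Ip pS] := D.
  rewrite /W (carrier_below aA vA) mulr0 addr0 /restr2 (pS v vS) if_same addr0.
  have [[m0 [Xq Iq]]|[-> _]] := mP p (real_cone Xp) Ip; last by rewrite mul0r mulr0.
  by rewrite (hT _ _ (domq _ _ D m0)) // !mulr0.
move=> F FF t0 q0 D0 FD Ft Fp v.
have r1c u : (fun x => restr1 x.2 u) @ F --> restr1 q0 u.
  by rewrite /restr1; case: (V1 u) => //; exact: cvg_cst.
have r2c u : (fun x => restr2 x.2 u) @ F --> restr2 q0 u.
  by rewrite /restr2; case: (V1 u) => //; exact: cvg_cst.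
have tc : (fun x : R * (V -> R) => tau x.1) @ F --> tau t0.
  by apply: cvg_minr; [apply: cvgM; [exact: cvg_cst|exact: Ft]|exact: cvg_cst].
have sc : (fun x : R * (V -> R) => s x.1) @ F --> s t0.
  apply: cvg_maxr; last exact: cvg_cst.
  by apply: cvgB; [apply: cvgM; [exact: cvg_cst|exact: Ft]|exact: cvg_cst].
have mc : (fun x => m x.2) @ F --> m q0.
  rewrite (mE _ _ D0).
  have : (fun x => \big[Num.max/0]_(v <- S1) restr1 x.2 v) @ F -->
      \big[Num.max/0]_(v <- S1) restr1 q0 v by apply: cvg_bigmax => u _; exact: r1c.
  by apply: cvg_trans; apply: near_eq_cvg; near=> x; rewrite (mE x.1) //; near: x.
apply: cvgD; last by apply: cvgM => //; exact: cvg_cst.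
apply: cvgM; first by apply: cvgB => //; exact: cvg_cst.
apply: cvgD => //.
have [_ Xq0 Iq0 q0S] := D0.
have [[m0 _]|[m0 _]] := mP _ (real_cone Xq0) Iq0; last first.
  (* Where the part on [V1] vanishes, the normalised point [q1] need not converge; but the product
     is bounded by [m], which tends to 0. *)
  rewrite m0 mul0r; apply: norm_cvg0; rewrite m0 in mc.
  apply: (@squeeze_cvgr _ _ _ _ (fun=> 0) (fun x => m x.2)) => //; last exact: cvg_cst.
  near=> x; rewrite normr_ge0 /= normrM.
  have Dx : dom X I S x.1 x.2 by near: x.
  have [t01 Xx Ix xS] := Dx.
  have [[mx [Xq Iq]]|[-> _]] := mP _ (real_cone Xx) Ix; last by rewrite normr0 mul0r.
  have [Xh _] := hX _ _ (tau01 _ t01) Xq Iq.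
  rewrite (gtr0_norm mx) -[leRHS]mulr1 ler_pM2l //.
  by rewrite ger0_norm ?(real_ge0 _ Xh) ?(real_le1 _ Xh).
apply: cvgM => //.
pose phi (x : R * (V -> R)) := (tau x.1, q1 x.2).
have := hcv (phi @ F) _ (tau t0) (q1 q0) (domq _ _ D0 m0).
move=> /(_ _ _ _ _ v) H; apply: H.
- have mp : \forall x \near F, 0 < m x.2.
    have /cvgrPdist_lt/(_ _ m0) := mc; apply: filterS => x.
    by rewrite ltr_norml => /andP[]; lra.
  have : \forall x \near F, dom subcomplex1 I S1 (phi x).1 (phi x).2.
    by near=> x; apply: domq; near: x.
  by [].
- exact: tc.
- move=> u; apply: cvgM; last exact: r1c.
  by apply: cvgV => //; rewrite gt_eqF.
Unshelve. all: by end_near. Qed.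

End Join.

Section Stabiliser.
Variables (G : groupType) (V : choiceType) (a : G -> V -> V).
Hypothesis aA : vact a.

Lemma push1 S : push a 1%g S = S.
Proof. by apply/fsetP => v; rewrite mem_push // invg1 aA.1. Qed.

Lemma pushM g h S : push a (g * h)%g S = push a g (push a h S).
Proof. by apply/fsetP => v; rewrite !mem_push // invgM aA.2. Qed.

Lemma push_neq0 g S : S != fset0 -> push a g S != fset0.
Proof.
by move=> /fset0Pn[v vS]; apply/fset0Pn; exists (a g v); rewrite mem_push // actK.
Qed.

Lemma pushV g S : push a g S = S -> push a g^-1%g S = S.
Proof. by move=> {1}<-; rewrite -pushM mulVg push1. Qed.

End Stabiliser.

(** The complex of [Q] is pulled back along [f]. Its stabilisers in [G] map to stabilisers in [Q],
    where the induction hypothesis applies. The contraction clause passes unchanged, because it is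
    stated for homomorphisms with virtually cyclic image; what remains at the bottom are the
    subgroups whose image in [Q] is virtually cyclic. *)
Lemma HP_ext (R : realType) (Q : groupType) : HP R Q ->
  forall (G : groupType) (f : G -> Q), is_hom f ->
  (forall (H : groupType) (i : H -> G), is_hom i -> injective i ->
     vcimg (f \o i) -> HP R H) -> HP R G.
Proof.
elim=> {}Q.
  move=> vQ G f fM vc; apply: (vc G id) => //.
  by have := vcimg_sub fM (fun x y => erefl (x * y)%g) vQ.
move=> V X a d cX Xd aA aX _ stab ctr G f fM vc.
apply: (@HP_step R G V X (fun g => a (f g)) d) => //.
- by split => [v|g h v]; rewrite ?(hom1 fM) ?fM; [exact: aA.1|exact: aA.2].
- by move=> g S; exact: aX.
- move=> S XS H i iM ii Sfix.
  pose P q := push a q S = S.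
  have P1 : P 1%g by exact: push1.
  have PM x y : P x -> P y -> P (x * y)%g by move=> Px Py; rewrite /P pushM // Py.
  have PV x : P x -> P x^-1%g by exact: pushV.
  have fH h : (f \o i) h \in sgroup P1 PM PV by apply/sgroupP; exact: Sfix.
  apply: (stab S XS (subgrp (sgroup P1 PM PV)) val _ _ _ H (sub_hom fH)).
  + exact: sval_hom.
  + exact: sval_inj.
  + by move=> h; have /sgroupP := svalP h.
  + by apply: sub_hom_hom; exact: hom_comp.
  + move=> K k kM ki vk; apply: (vc K (i \o k)); [exact: hom_comp|exact: inj_comp|].
    by apply: vcimg_inj vk => x y /(congr1 val); rewrite /comp !sub_homE.
- by move=> H i iM vi; apply: (ctr H (f \o i)); [exact: hom_comp|exact: vcimg_comp].
Qed.

(** * Overgroups of finite index *)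

Section Induction.
Variables (R : realType) (G N : groupType) (j : N -> G).
Hypotheses (jM : is_hom j) (ji : injective j).
Variable l : seq G.
Hypothesis lP : forall g, exists2 r, r \in l & exists n, g = (r * j n)%g.

(** [xget] depends only on the set it chooses from, so that the representative is constant on the
    cosets of the image of [j]. *)
Definition rep (g : G) : G :=
  xget 1%g [set r | r \in l /\ exists n, g = (r * j n)%g].

Definition cocycle (g : G) : N := xget 1%g [set n | g = (rep g * j n)%g].

Lemma repP g : rep g \in l /\ exists n, g = (rep g * j n)%g.
Proof.
have [r rl nr] := lP g.
by apply: (@xgetPex _ 1%g [set r | r \in l /\ exists n, g = (r * j n)%g]); exists r.
Qed.

Lemma cocycleE g : g = (rep g * j (cocycle g))%g.
Proof.
have [_ nP] := repP g.
exact: (@xgetPex _ 1%g [set n | g = (rep g * j n)%g] nP).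
Qed.

Lemma rep_mulr g n : rep (g * j n)%g = rep g.
Proof.
congr (xget _ _); apply/seteqP; split => r [rl [m e]]; split => //.
  by exists (m * n^-1)%g; rewrite jM mulgA -e (homV jM) mulgK.
by exists (m * n)%g; rewrite jM mulgA -e.
Qed.

Lemma rep_id g : rep (rep g) = rep g.
Proof. by rewrite {2}[g]cocycleE rep_mulr. Qed.

Lemma cocycle_mulr g n : cocycle (g * j n)%g = (cocycle g * n)%g.
Proof.
apply: ji; apply: (@mulgI _ (rep g)); rewrite jM mulgA -cocycleE.
by rewrite -{1}(rep_mulr g n) -cocycleE.
Qed.

Lemma cocycle_rep r : rep r = r -> cocycle r = 1%g.
Proof.
move=> rr; apply: ji; apply: (@mulgI _ (rep r)).
by rewrite -cocycleE rr (hom1 jM) mulg1.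
Qed.

Lemma rep_mull g h : rep (g * rep h)%g = rep (g * h)%g.
Proof. by rewrite {2}[h]cocycleE mulgA rep_mulr. Qed.

Lemma cocycle_mull g h :
  cocycle (g * h)%g = (cocycle (g * rep h) * cocycle h)%g.
Proof. by rewrite {1}[h]cocycleE mulgA cocycle_mulr. Qed.

Definition cosets : Type := {r : G | rep r == r}.
HB.instance Definition _ := Choice.on cosets.

Definition coset_rep (g : G) : cosets := exist _ (rep g) (introT eqP (rep_id g)).

Lemma coset_repE (r : cosets) : rep (sval r) = sval r.
Proof. by apply/eqP; case: r. Qed.

Lemma cosets_inj (r s : cosets) : sval r = sval s -> r = s.
Proof. by move=> e; apply: val_inj. Qed.

Lemma coset_rep_sval (r : cosets) : coset_rep (sval r) = r.
Proof. by apply: cosets_inj; rewrite /= coset_repE. Qed.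

Definition coset_list : seq cosets := map coset_rep l.

Lemma coset_listP r : r \in coset_list.
Proof.
rewrite -(coset_rep_sval r) -(coset_repE r); apply/mapP.
exists (rep (sval r)); first by case: (repP (sval r)).
by rewrite coset_repE coset_rep_sval.
Qed.

Section Action.
Variables (V : choiceType) (X : {fset V} -> Prop) (a : N -> V -> V).
Hypotheses (cX : simplicial X) (aA : vact a).
Hypothesis aX : forall n S, X S -> X (push a n S).

(** The action of [G] on the set induced from the [N]-set [V], written in the coordinates given by
    coset representatives. *)
Definition ind_act (g : G) (x : cosets * V) : cosets * V :=
  (coset_rep (g * sval x.1)%g, a (cocycle (g * sval x.1)%g) x.2).

Lemma ind_vact : vact ind_act.
Proof.
split=> [[r v]|g h [r v]]; rewrite /ind_act /=.
  by rewrite mul1g coset_rep_sval cocycle_rep ?coset_repE // aA.1.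
rewrite -aA.2 -mulgA; congr (_, a _ _); last by rewrite -cocycle_mull.
by apply: cosets_inj; rewrite /= rep_mull.
Qed.

Definition slice (r : cosets) (S : {fset cosets * V}) : {fset V} :=
  [fset x.2 | x in S & x.1 == r]%fset.

Lemma mem_slice r S v : (v \in slice r S) = ((r, v) \in S).
Proof.
apply/imfsetP/idP => [[[r' v'] /= /andP[xS /eqP <-] ->]|rS] //.
by exists (r, v) => //=; rewrite inE /= rS eqxx.
Qed.

Definition ind_complex (S : {fset cosets * V}) : Prop :=
  S != fset0 /\ forall r, slice r S != fset0 -> X (slice r S).

Lemma ind_simplicial : simplicial ind_complex.
Proof.
split=> [S []//|S T [S0 XS] TS T0]; split=> // r rT.
have sTS : fsubset (slice r T) (slice r S).
  by apply/fsubsetP => v; rewrite !mem_slice => /(fsubsetP TS).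
apply: (proj2 cX (slice r S)) => //; apply: XS; exact: fsubset_neq0 sTS rT.
Qed.

Lemma ind_dim d : (forall S, X S -> (#|` S| <= d)%N) ->
  forall S, ind_complex S -> (#|` S| <= size l * d)%N.
Proof.
move=> Xd S [_ XS].
pose s := [seq [seq (r, v) | v <- slice r S] | r <- coset_list].
apply: (@leq_trans (size (flatten s))).
  apply: uniq_leq_size; first exact: fset_uniq.
  move=> [r v] rS; apply/flattenP; exists [seq (r, v) | v <- slice r S].
    by apply: map_f; exact: coset_listP.
  by apply: map_f; rewrite /= mem_slice.
rewrite -(size_map coset_rep l) -/coset_list /s; elim: coset_list => //= r t IH.
rewrite size_cat size_map mulSn leq_add //.
have [->|r0] := eqVneq (slice r S) fset0; first by rewrite cardfs0.
exact/Xd/XS.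
Qed.

Lemma slice_push g r S : slice r (push ind_act g S) =
  push a (cocycle (g^-1 * sval r))^-1%g (slice (coset_rep (g^-1 * sval r)%g) S).
Proof.
apply/fsetP => v; rewrite mem_slice (mem_push ind_vact) (mem_push aA).
by rewrite invgK mem_slice.
Qed.

Lemma ind_push g S : ind_complex S -> ind_complex (push ind_act g S).
Proof.
move=> [S0 XS]; split; first exact: (push_neq0 ind_vact).
move=> r; rewrite slice_push => h; apply: aX; apply: XS.
by apply: contra_neq h => ->; apply/fsetP => v; rewrite (mem_push aA).
Qed.

(* the part of the contraction of the induced complex supported on the orbit of
   the trivial coset is the transport of a contraction of [X] *)
Section Contr.
Variables (H : groupType) (f : H -> G) (fM : is_hom f).
Let r0 := coset_rep 1%g.

Definition fix_coset (r : cosets) (h : H) : Prop := coset_rep (f h * sval r)%g = r.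

Lemma fix_coset1 r : fix_coset r 1%g.
Proof. by rewrite /fix_coset (hom1 fM) mul1g coset_rep_sval. Qed.

Lemma coset_rep_mull g h : coset_rep (g * sval (coset_rep h))%g = coset_rep (g * h)%g.
Proof. by apply: cosets_inj; rewrite /= rep_mull. Qed.

Lemma fix_cosetM r x y : fix_coset r x -> fix_coset r y -> fix_coset r (x * y)%g.
Proof. by move=> rx ry; rewrite /fix_coset fM -mulgA -coset_rep_mull ry rx. Qed.

Lemma fix_cosetV r x : fix_coset r x -> fix_coset r x^-1%g.
Proof.
move=> rx; rewrite /fix_coset -{1}rx coset_rep_mull mulgA -fM mulVg (hom1 fM).
by rewrite mul1g coset_rep_sval.
Qed.

Definition coset_stab r := sgroup (@fix_coset1 r) (@fix_cosetM r) (@fix_cosetV r).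

Definition stab_hom r (h : subgrp (coset_stab r)) : N :=
  cocycle (f (val h) * sval r)%g.

Lemma stab_homP r (h : subgrp (coset_stab r)) :
  (f (val h) * sval r)%g = (sval r * j (stab_hom h))%g.
Proof.
have /sgroupP/(congr1 sval) /= e := svalP h.
by rewrite {1}[LHS]cocycleE e.
Qed.

Lemma stab_hom_hom r : is_hom (@stab_hom r).
Proof.
move=> x y; apply: ji; apply: (@mulgI _ (sval r)); rewrite -stab_homP jM mulgA.
by rewrite -stab_homP -mulgA -stab_homP mulgA -fM valM.
Qed.

Lemma stab_hom_eq r (x y : subgrp (coset_stab r)) : f (val x) = f (val y) -> @stab_hom r x = @stab_hom r y.
Proof. by move=> e; rewrite /stab_hom e. Qed.

Lemma stab_hom_inj r : injective f -> injective (@stab_hom r).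
Proof.
move=> fi x y e; apply: val_inj; apply: fi; apply: (@mulIg _ (sval r)).
by rewrite !stab_homP e.
Qed.

Lemma coset_stab_finite r : exists l' : seq H, forall h, exists2 s, s \in l' &
  exists k : subgrp (coset_stab r), h = (s * val k)%g.
Proof.
pose c t := xget 1%g [set h | coset_rep (f h * sval r)%g = t].
exists (map c coset_list) => h; set t := coset_rep (f h * sval r)%g.
have ct : coset_rep (f (c t) * sval r)%g = t.
  by apply: (@xgetPex _ 1%g [set h | coset_rep (f h * sval r)%g = t]); exists h.
exists (c t); first by apply: map_f; exact: coset_listP.
have k : ((c t)^-1 * h)%g \in coset_stab r.
  apply/sgroupP; rewrite /fix_coset fM -mulgA -coset_rep_mull -/t -[X in sval X]ct.
  by rewrite coset_rep_mull mulgA -fM mulVg (hom1 fM) mul1g coset_rep_sval.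
by exists (Sub ((c t)^-1 * h)%g k : subgrp (coset_stab r)); rewrite SubK mulVKg.
Qed.

Hypothesis vf : vcimg f.

Let I0 : (V -> R) -> Prop := fixed_by a (@stab_hom r0).
Let I : (cosets * V -> R) -> Prop := fixed_by ind_act f.

Definition orbit0 : pred (cosets * V) :=
  fun x => `[< exists h, coset_rep (f h * sval r0)%g = x.1 >].

Definition mover (r : cosets) : H :=
  xget 1%g [set h | coset_rep (f h * sval r0)%g = r].

Definition back (x : cosets * V) : V :=
  a (cocycle (f (mover x.1) * sval r0))^-1%g x.2.

Definition spread (p : V -> R) : cosets * V -> R :=
  fun x => if orbit0 x then p (back x) else 0.

Definition restr0 (P : cosets * V -> R) : V -> R := fun v => P (r0, v).

Lemma moverP x : orbit0 x -> coset_rep (f (mover x.1) * sval r0)%g = x.1.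
Proof.
move=> /asboolP[h hx].
by apply: (@xgetPex _ 1%g [set h | coset_rep (f h * sval r0)%g = x.1]); exists h.
Qed.

Lemma backP x : orbit0 x -> ind_act (f (mover x.1)) (r0, back x) = x.
Proof.
move=> xo; rewrite /ind_act /= (moverP xo) /back -aA.2 mulgV aA.1.
by case: x xo.
Qed.

Lemma orbit0_act h x : orbit0 (ind_act (f h) x) = orbit0 x.
Proof.
apply/asboolP/asboolP => -[k kx].
  exists (h^-1 * k)%g; rewrite fM -mulgA -coset_rep_mull kx coset_rep_mull mulgA.
  by rewrite -fM mulVg (hom1 fM) mul1g coset_rep_sval.
by exists (h * k)%g; rewrite fM -mulgA -coset_rep_mull kx.
Qed.

Lemma orbit0_r0 v : orbit0 (r0, v).
Proof. by apply/asboolP; exists 1%g; rewrite (hom1 fM) mul1g coset_rep_sval. Qed.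

Lemma ind_act_r0 (h : H) u u' : ind_act (f h) (r0, u) = (r0, u') ->
  exists k : subgrp (coset_stab r0), u' = a (stab_hom k) u.
Proof.
move=> [] e <-; have hk : h \in coset_stab r0.
  by apply/sgroupP; apply: cosets_inj; exact: e.
by exists (Sub h hk); rewrite /stab_hom SubK.
Qed.

Lemma spread_inv p : I0 p -> I (spread p).
Proof.
move=> pI h x; rewrite /spread orbit0_act; case: ifP => // xo.
set y := ind_act (f h) x; have yo : orbit0 y by rewrite orbit0_act.
have e : ind_act (f ((mover y.1)^-1 * h * mover x.1)%g) (r0, back x) = (r0, back y).
  rewrite fM ind_vact.2 (backP xo) fM ind_vact.2 -/y.
  transitivity (ind_act (f (mover y.1)^-1%g) (ind_act (f (mover y.1)) (r0, back y))).
    by rewrite (backP yo).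
  by rewrite -ind_vact.2 -fM mulVg (hom1 fM) ind_vact.1.
by have [k ->] := ind_act_r0 e; rewrite pI.
Qed.

Lemma restr0_inv P : I P -> I0 (restr0 P).
Proof.
move=> PI k v; rewrite /restr0 -(PI (val k) (r0, v)); congr P.
rewrite /ind_act /=; congr (_, _); have /sgroupP := svalP k.
by move=> ->.
Qed.

Lemma spreadK P : I P -> (forall x, ~~ orbit0 x -> P x = 0) ->
  spread (restr0 P) = P.
Proof.
move=> PI P0; apply/funext => x; rewrite /spread; case: ifPn => xo; last by rewrite P0.
by rewrite /restr0 -(PI (mover x.1)) (backP xo).
Qed.

Lemma real_restr0 P : real (subcomplex1 ind_complex orbit0) P -> I P ->
  real X (restr0 P).
Proof.
move=> [[S [[S0 XS] So] PS] P1 [x Px]] PI.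
have xo : orbit0 x.
  by apply: So; have [_ ->] := PS x; rewrite Px.
have bx : restr0 P (back x) = 1 by rewrite /restr0 -(PI (mover x.1)) (backP xo).
split; [|by move=> v; exact: P1|by exists (back x)].
exists (slice r0 S); last by move=> v; rewrite mem_slice; exact: PS.
apply: XS; apply/fset0Pn; exists (back x); rewrite mem_slice.
by have [_ ->] := PS (r0, back x); rewrite -/(restr0 P _) bx.
Qed.

Lemma real_spread p : real X p -> real (subcomplex1 ind_complex orbit0) (spread p).
Proof.
move=> [[S XS pS] p1 [v pv]].
pose F := [fset (r, a (cocycle (f (mover r) * sval r0)) u) |
  r in coset_list, u in S]%fset.
have bF : below F (spread p).
  move=> x; rewrite /spread; case: ifP => // xo; apply: contraNeq => px.
  have xS : back x \in S.
    by have [p0 ->] := pS (back x); rewrite lt_def px.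
  apply/imfset2P; exists x.1; first exact: coset_listP.
  exists (back x) => //.
  by rewrite /back -aA.2 mulgV aA.1; case: (x).
have sp0 x : 0 <= spread p x.
  by rewrite /spread; case: ifP => // _; exact: carrier_ge0 pS.
have cF := below_carrier bF sp0.
have rv : spread p (ind_act (f (mover r0)) (r0, v)) = 1.
  rewrite /spread orbit0_act orbit0_r0; set x := ind_act _ _.
  have e : back x = v.
    rewrite /back /x /= (moverP (orbit0_r0 v)) -aA.2.
    by rewrite mulVg aA.1.
  by rewrite e.
split; last by exists (ind_act (f (mover r0)) (r0, v)).
- eexists; last exact: cF.
  split; last by move=> x; have [_ ->] := cF x; rewrite /spread; case: ifP => //; rewrite ltxx.
  split.
    apply/fset0Pn; exists (ind_act (f (mover r0)) (r0, v)).
    by have [_ ->] := cF (ind_act (f (mover r0)) (r0, v)); rewrite rv.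
  move=> r /fset0Pn[u]; rewrite mem_slice; have [_ ->] := cF (r, u).
  rewrite {1}/spread; case: ifP; last by rewrite ltxx.
  move=> ro _; rewrite (_ : slice _ _ = push a (cocycle (f (mover r) * sval r0)%g) S).
    exact: aX.
  apply/fsetP => w; rewrite mem_slice (mem_push aA); have [_ ->] := cF (r, w).
  rewrite /spread (_ : orbit0 (r, w) = true) //.
  by rewrite /back /=; have [_ ->] := pS (a (cocycle (f (mover r) * sval r0))^-1%g w).
- by move=> x; rewrite /spread; case: ifP.
Qed.

(** An invariant point over the orbit of the trivial coset is determined by its slice there, which
    only has to be invariant under the stabiliser of that coset. The other orbits enter through
    [contr_join]: one contractible factor of a join suffices. *)
Lemma contr_ind : contr X I0 -> contr ind_complex I.
Proof.
move=> [h [b [[Xb Ib] hX h0 h1 hc]]].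
have sc : scale_closed I by move=> k p k0 pI x y; rewrite pI.
apply: (contr_join (V1 := orbit0) ind_simplicial) => //.
- move=> p _ pI k x; rewrite /restr1 orbit0_act; case: ifP => // _; exact: pI.
- move=> p q c c0 [S XS pS] pI [T [XT To] qT] qI; split; last first.
    by move=> k x; rewrite /restr2 orbit0_act pI qI.
  have st x : (0 < c * restr2 orbit0 p x + q x) = 
      if orbit0 x then x \in T else (0 < c) && (x \in S).
    rewrite /restr2; case: ifP => xo.
      by rewrite mulr0 add0r; have [_ ->] := qT x.
    have -> : q x = 0 by apply: (carrier_below qT); apply: contraFN xo; exact: To.
    have [p0 ->] := pS x; rewrite addr0.
    have [->|c00] := eqVneq c 0; first by rewrite mul0r ltxx.
    have cp : 0 < c by rewrite lt_def c00.
    by rewrite cp pmulr_rgt0.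
  have cU : carrier (fun x => c * restr2 orbit0 p x + q x)
     [fset x in (S `|` T)%fset | (0 < c * restr2 orbit0 p x + q x)%R]%fset.
    apply: below_carrier.
      move=> x; rewrite inE negb_or => /andP[xS xT].
      by rewrite /restr2 (carrier_below pS xS) (carrier_below qT xT) if_same mulr0 addr0.
    move=> x; rewrite addr_ge0 ?(carrier_ge0 _ qT) // mulr_ge0 //.
    by rewrite /restr2; case: ifP => // _; rewrite (carrier_ge0 _ pS).
  eexists; last exact: cU; set U := [fset x in _ | _]%fset.
  have UE x : (x \in U) = if orbit0 x then x \in T else (0 < c) && (x \in S).
    by have [_ ->] := cU x; rewrite st.
  split.
    have /fset0Pn[x xT] := XT.1.
    by apply/fset0Pn; exists x; rewrite UE To.
  move=> r /fset0Pn[v]; rewrite mem_slice UE; case: ifP => ro.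
    move=> rT; rewrite (_ : slice r U = slice r T).
      by apply: XT.2; apply/fset0Pn; exists v; rewrite mem_slice.
    by apply/fsetP => w; rewrite !mem_slice UE (_ : orbit0 (r, w) = true).
  move=> /andP[cp rS]; rewrite (_ : slice r U = slice r S).
    by apply: XS.2; apply/fset0Pn; exists v; rewrite mem_slice.
  by apply/fsetP => w; rewrite !mem_slice UE (_ : orbit0 (r, w) = false) // cp.
have P0 P : real (subcomplex1 ind_complex orbit0) P -> forall x, ~~ orbit0 x -> P x = 0.
  move=> [[S [_ So] PS] _ _] x xo; apply: (carrier_below PS).
  by apply: contra xo; exact: So.
exists (fun t P => spread (h t (restr0 P))), (spread b); split.
- by split; [exact: real_spread|exact: spread_inv].
- move=> t P t01 XP PI; have XP' := real_restr0 XP PI.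
  have [Xh Ih] := hX t _ t01 XP' (restr0_inv PI).
  by split; [exact: real_spread|exact: spread_inv].
- move=> P XP PI; rewrite h0 ?spreadK //; [exact: P0|exact: real_restr0|exact: restr0_inv].
- by move=> P XP PI; rewrite h1 //; [exact: real_restr0|exact: restr0_inv].
move=> S [[S0 XS] So].
have dom0 t P : dom (subcomplex1 ind_complex orbit0) I S t P ->
    dom X I0 (slice r0 S) t (restr0 P).
  move=> [t01 XP PI PS]; split => //; [exact: real_restr0|exact: restr0_inv|].
  by move=> v; rewrite mem_slice => /PS.
have [S00|S00] := eqVneq (slice r0 S) fset0.
  have nD t P : ~ dom (subcomplex1 ind_complex orbit0) I S t P.
    move=> /dom0[_ [_ _ [v pv]] _ bp]; have := bp v; rewrite S00 inE => /(_ isT)/eqP.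
    by rewrite pv oner_eq0.
  by exists fset0 => [t p /nD //|F FF t0 q0 /nD].
have [T hT hcv] := hc _ (XS _ S00).
exists [fset (r, a (cocycle (f (mover r) * sval r0)) u) | r in coset_list, u in T]%fset.
  move=> t P /dom0 D x; rewrite /spread; case: ifP => // xo; apply: contraNeq => px.
  apply/imfset2P; exists x.1; first exact: coset_listP.
  exists (back x); last by rewrite /back -aA.2 mulgV aA.1; case: (x).
  by apply: contraNT px => /(hT _ _ D) ->.
move=> F FF t0 q0 D0 FD Ft Fp x.
rewrite /spread; case: ifP => xo; last exact: cvg_cst.
apply: (hcv ((fun x => (x.1, restr0 x.2)) @ F) _ t0 (restr0 q0) (dom0 _ _ D0)).
- by apply: (@filterS _ F _ _ _ _ FD) => y; exact: dom0.
- exact: Ft.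
- by move=> v; exact: Fp.
Qed.

End Contr.

End Action.
End Induction.

(* The complex for the overgroup is the join of the translates of the given one
   over the cosets, that is, an induced complex. *)
Lemma HP_finite_index (R : realType) (N : groupType) : HP R N ->
  forall (G : groupType) (j : N -> G), is_hom j -> injective j ->
  (exists l : seq G, forall g, exists2 r, r \in l & exists n, g = (r * j n)%g) ->
  HP R G.
Proof.
elim=> {}N.
  move=> [c [l' cl]] G j jM ji [l lP]; apply: HP_vc.
  exists (j c), [seq (r * j s)%g | r <- l, s <- l'] => g.
  have [r rl [n ->]] := lP g; have [s sl [z ->]] := cl n.
  exists (r * j s)%g; first exact: allpairs_f.
  by exists z; rewrite /= jM (hom_zexp _ _ jM) mulgA.
move=> V X a d cX Xd aA aX _ stab ctr G j jM ji [l lP].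
apply: (@HP_step R G _ (ind_complex (l := l) (j := j) X) (ind_act jM lP a) (size l * d)%N).
- exact: ind_simplicial.
- exact: ind_dim.
- exact: ind_vact.
- by move=> g S; exact: ind_push.
- move=> S [/fset0Pn[[r v] rS] XS] H f fM fi Sfix.
  have Xr : X (slice r S).
    by apply: XS; apply/fset0Pn; exists v; rewrite mem_slice.
  (* [H] permutes the finitely many cosets, so the stabiliser of [r] has finite index in it; that
     stabiliser embeds into [N] and preserves the slice over [r]. The induction hypothesis covers
     its overgroups of finite index, in particular [H]. *)
  apply: (stab _ Xr _ (stab_hom (fM := fM) (r := r)) _ _ _ H val).
  + exact: stab_hom_hom.
  + exact: stab_hom_inj.
  + move=> k; have := slice_push jM ji lP aA (f (val k))^-1%g r S.
    rewrite invgK -(homV fM) Sfix; have /sgroupP -> := svalP k.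
    rewrite -/(stab_hom k) => e; rewrite [in LHS]e -(pushM aA) mulgV.
    exact: (push1 aA).
  + exact: sval_hom.
  + exact: sval_inj.
  + exact: coset_stab_finite.
- move=> H f fM vf; apply: contr_ind => //; apply: ctr; first exact: stab_hom_hom.
  apply: (@vcimg_inj _ _ _ (f \o val)).
    by move=> x y; exact: stab_hom_eq.
  apply: (vcimg_sub _ fM vf); exact: sval_hom.
Qed.

(** * Trees and lines *)

Lemma intr_nat (R : realType) (n : nat) : (n%:Z)%:~R = n%:R :> R.
Proof. by []. Qed.

(* A forest in which every vertex [v] has one upper neighbour [up v], and all upward
   paths run into the ray [ray]: points first flow up into the ray, then down to
   its origin. *)
Section Ray.
Variables (R : realType) (V : choiceType) (X : {fset V} -> Prop).
Variables (I : (V -> R) -> Prop) (good : V -> Prop).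
Variables (up : V -> V) (lev : V -> int) (ray : nat -> V).
Hypotheses (cX : simplicial X) (sI : scale_closed I).
Hypothesis lev_up : forall v, lev (up v) = lev v + 1.
Hypothesis good_up : forall v, good v -> good (up v).
Hypotheses (lev_ray : forall k : nat, lev (ray k) = k%:Z).
Hypothesis up_ray : forall k, up (ray k) = ray k.+1.
Hypothesis good_ray : good (ray 0%N).
Hypothesis merge : forall v, good v -> exists k : nat,
  lev v <= k%:Z /\ iter (absz (k%:Z - lev v)%R) up v = ray k.
Hypothesis X_edge : forall S, X S -> exists v, fsubset S [fset v; up v]%fset.
Hypothesis I_base : forall p, real X p -> I p -> exists v,
  [/\ good v, 0 < p v & below [fset v; up v]%fset p].
Hypothesis edge_XI : forall v p, good v -> below [fset v; up v]%fset p ->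
  (forall w, 0 <= p w) -> (exists w, 0 < p w) -> cone X p /\ I p.

Let good_iter n v : good v -> good (iter n up v).
Proof. by elim: n => //= n IH /IH; exact: good_up. Qed.

Let lev_iter n v : lev (iter n up v) = lev v + n%:Z.
Proof. by elim: n => [|n IH]; rewrite /= ?addr0 // lev_up IH; lia. Qed.

Let up_neq v : up v != v.
Proof. by apply/eqP => /(congr1 lev); rewrite lev_up; lia. Qed.

Let iter_ray n k : iter n up (ray k) = ray (n + k)%N.
Proof. by elim: n => //= n ->; rewrite up_ray. Qed.

(** The coordinate at a vertex of a point at distance [x] from it, on a line whose edges have length
    1. In coordinates normalised by their maximum, the point [(1, b)] of an edge is placed at
    [b / 2] above the lower end and [(a, 1)] at [a / 2] below the upper end; hence the plateau up to
    distance [1 / 2]. *)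
Definition tent (x : R) : R := Num.max 0 (Num.min 1 (2 - 2 * `|x|)).

Lemma tent_ge0 x : 0 <= tent x. Proof. by rewrite le_max lexx. Qed.

Lemma tent_far x : 1 <= `|x| -> tent x = 0.
Proof. by move=> x1; rewrite /tent max_l // ge_min; apply/orP; right; lra. Qed.

Lemma tent_near x : `|x| < 1 -> 0 < tent x.
Proof. by move=> x1; rewrite /tent lt_max ltxx lt_min ltr01 /=; lra. Qed.

Lemma tent_left a b : a <= 1 -> b <= 1 -> a = 1 \/ b = 1 -> 0 <= a -> 0 <= b ->
  tent ((1 + b - a) / 2) = a.
Proof.
move=> a1 b1 ab a0 b0; rewrite /tent ger0_norm; last by lra.
case: ab => e; subst.
  by rewrite min_l; [rewrite max_r|lra].
by rewrite min_r; [rewrite max_r; lra|lra].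
Qed.

Lemma tentN x : tent (- x) = tent x. Proof. by rewrite /tent normrN. Qed.

Lemma tent_right a b : a <= 1 -> b <= 1 -> a = 1 \/ b = 1 -> 0 <= a -> 0 <= b ->
  tent ((1 + b - a) / 2 - 1) = b.
Proof.
move=> a1 b1 ab a0 b0; rewrite -tentN (_ : - ((1 + b - a) / 2 - 1) = (1 + a - b) / 2); last by lra.
by apply: tent_left => //; case: ab; [right|left].
Qed.

Lemma cvg_tent (T : Type) (F : set_system T) (FF : Filter F) (f : T -> R) (l : R) :
  f @ F --> l -> (fun x => tent (f x)) @ F --> tent l.
Proof.
move=> fl; apply: cvg_maxr; first exact: cvg_cst.
apply: cvg_minr; first exact: cvg_cst.
apply: cvgB; first exact: cvg_cst.
by apply: cvgM; [exact: cvg_cst|exact: cvg_norm].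
Qed.

(* the point at height [y] above [v], and on the ray *)
Definition above (v : V) (y : R) (w : V) : R :=
  if (lev v <= lev w) && (iter (absz (lev w - lev v)%R) up v == w)
  then tent (y - (lev w)%:~R) else 0.

Definition on_ray (y : R) (w : V) : R :=
  if (0 <= lev w) && (ray (absz (lev w)%R) == w) then tent (y - (lev w)%:~R) else 0.

Lemma above_edge v (y : R) : good v -> (lev v)%:~R <= y ->
  exists u, [/\ good u, below [fset u; up u]%fset (above v y) & exists w, 0 < above v y w].
Proof.
move=> gv vy; have y0 : 0 <= y - (lev v)%:~R by rewrite subr_ge0.
set n := Num.truncn (y - (lev v)%:~R).
have /andP[n1 n2] := truncn_itv y0; rewrite -/n in n1 n2.
rewrite -natr1 in n2.
exists (iter n up v); split; first exact: good_iter.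
  move=> w; rewrite !inE negb_or => /andP[w1 w2]; rewrite /above.
  case: ifP => // /andP[lw /eqP e]; apply: tent_far.
  set k := absz (lev w - lev v)%R in e.
  have kE : (lev w)%:~R = (lev v)%:~R + k%:R :> R.
    by rewrite -intr_nat -intrD /k; congr (_%:~R); lia.
  have kn : k != n by apply: contra_neq w1 => <-.
  have kn1 : k != n.+1 by apply: contra_neq w2 => kn1; rewrite -e kn1.
  rewrite kE; have [kn'|kn'] : (k.+1 <= n)%N \/ (n.+2 <= k)%N by lia.
    have : k.+1%:R <= n%:R :> R by rewrite ler_nat.
    by rewrite -natr1 => h; rewrite ger0_norm; lra.
  have : n.+2%:R <= k%:R :> R by rewrite ler_nat.
  by rewrite -!natr1 => h; rewrite ler0_norm; lra.
exists (iter n up v); rewrite /above lev_iter.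
have -> : absz (lev v + n%:Z - lev v)%R = n by lia.
rewrite eqxx andbT (_ : lev v <= lev v + n%:Z); [apply: tent_near|lia].
by rewrite intrD intr_nat ger0_norm; lra.
Qed.

Lemma above_ge0 v y w : 0 <= above v y w.
Proof. by rewrite /above; case: ifP => // _; exact: tent_ge0. Qed.

Lemma on_rayE y : 0 <= y -> on_ray y = above (ray 0%N) y.
Proof.
move=> y0; apply/funext => w; rewrite /on_ray /above lev_ray.
case: (leP 0 (lev w)) => //= lw.
by rewrite subr0 iter_ray addn0.
Qed.

Lemma above_up v y : (lev v)%:~R + 1 <= y -> above v y = above (up v) y.
Proof.
move=> vy; apply/funext => w; rewrite /above lev_up.
have [lw|lw|lw] := ltgtP (lev v) (lev w) => /=.
- rewrite (_ : lev v + 1 <= lev w) /=; last by lia.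
  have -> : absz (lev w - lev v)%R = (absz (lev w - (lev v + 1))%R).+1 by lia.
  by rewrite iterSr.
- by rewrite (_ : lev v + 1 <= lev w = false) //; lia.
- rewrite -lw (_ : lev v + 1 <= lev v = false) /=; last by lia.
  rewrite subrr /=; case: ifP => // _; apply: tent_far.
  by rewrite ger0_norm; lra.
Qed.

Definition merge_at (v : V) (k : nat) : bool :=
  (lev v <= k%:Z) && (iter (absz (k%:Z - lev v)%R) up v == ray k).

Lemma merge_ex v : good v -> exists k, merge_at v k.
Proof. by move=> /merge[k [vk e]]; exists k; rewrite /merge_at vk e eqxx. Qed.

Definition height (v : V) : nat :=
  if pselect (exists k, merge_at v k) is left H then ex_minn H else 0%N.

Lemma heightP v : good v -> merge_at v (height v) /\
  forall k, merge_at v k -> (height v <= k)%N.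
Proof.
move=> /merge_ex H; rewrite /height; case: pselect => // H'.
by case: ex_minnP => m.
Qed.

Lemma merge_at_up v k : lev v < k%:Z -> merge_at (up v) k = merge_at v k.
Proof.
move=> vk; rewrite /merge_at lev_up (ltW vk) (_ : lev v + 1 <= k%:Z) /=; last by lia.
have -> : absz (k%:Z - lev v)%R = (absz (k%:Z - (lev v + 1))%R).+1 by lia.
by rewrite iterSr.
Qed.

(** Below the meeting point with the ray, going up does not change that point; a vertex of the ray
    meets it at itself. *)
Lemma height_up v : good v ->
  (height (up v) = height v /\ lev v < (height v)%:Z) \/
  (v = ray (height v) /\ height (up v) = (height v).+1).
Proof.
move=> gv; have [mv minv] := heightP gv; have [mu minu] := heightP (good_up gv).
have [lv|lv] := ltP (lev v) (height v)%:Z.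
  left; split => //; apply/eqP; rewrite eqn_leq; apply/andP; split.
    by apply: minu; rewrite merge_at_up.
  apply: minv; rewrite -merge_at_up //.
  by move: mu; rewrite /merge_at lev_up => /andP[]; lia.
right; have vE : v = ray (height v).
  move: mv => /andP[l1 /eqP <-].
  by have -> : absz ((height v)%:Z - lev v)%R = 0%N by lia.
split => //.
have lE : lev v = (height v)%:Z by rewrite {1}vE lev_ray.
apply/eqP; rewrite eqn_leq; apply/andP; split.
  apply: minu; rewrite /merge_at lev_up lE (_ : _ + 1 <= _) /=; last by lia.
  have -> : absz ((height v).+1%:Z - ((height v)%:Z + 1))%R = 0%N by lia.
  by rewrite /= {1}vE up_ray.
by move: mu; rewrite /merge_at lev_up lE => /andP[]; lia.
Qed.

Section Formula.
Variable v : V.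

Definition pos (p : V -> R) : R := (1 + p (up v) - p v) / 2.
Definition elev (p : V -> R) : R := (lev v)%:~R + pos p.
(** The interpolation makes the target constant on an edge that lies below the meeting point, and
    equal to the elevation itself on an edge of the ray. *)
Definition target (p : V -> R) : R :=
  (1 - pos p) * (height v)%:R + pos p * (height (up v))%:R.
Definition flow1 (t : R) (p : V -> R) : R :=
  elev p + Num.min (2 * t) 1 * (target p - elev p).
Definition flow2 (t : R) (p : V -> R) : R :=
  target p - Num.max (2 * t - 1) 0 * target p.
(** One formula for both halves of the motion, so that continuity needs no gluing. Up to time
    [1 / 2] the two terms on the ray cancel, since [flow2] is still the target; afterwards the first
    and the last cancel, since [flow1] has reached the target, where going up from [v] and moving
    along the ray give the same point. *)
Definition flow (t : R) (p : V -> R) (w : V) : R :=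
  above v (flow1 t p) w + on_ray (flow2 t p) w - on_ray (target p) w.

Hypothesis gv : good v.
Variable p : V -> R.
Hypotheses (Xp : real X p) (pv : below [fset v; up v]%fset p).

Lemma edge_max : p v = 1 \/ p (up v) = 1.
Proof.
case: Xp => _ _ [w pw]; have : w \in [fset v; up v]%fset.
  by apply: contraTT isT => /pv e; move: pw; rewrite e => /eqP; rewrite eq_sym oner_eq0.
by rewrite !inE => /orP[/eqP <-|/eqP <-]; [left|right].
Qed.

Lemma pos01 : 0 <= pos p <= 1.
Proof.
have [a0 b0] := (real_ge0 v Xp, real_ge0 (up v) Xp).
have [a1 b1] := (real_le1 v Xp, real_le1 (up v) Xp).
by rewrite /pos; apply/andP; split; lra.
Qed.

Lemma elevE : above v (elev p) = p.
Proof.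
have [a0 b0] := (real_ge0 v Xp, real_ge0 (up v) Xp).
have [a1 b1] := (real_le1 v Xp, real_le1 (up v) Xp).
have ab := edge_max; have /andP[s0 s1] := pos01.
apply/funext => w; rewrite /above.
have [->|wv] := eqVneq w v.
  by rewrite lexx subrr eqxx /= /elev addrAC subrr add0r; exact: tent_left.
have [->|wu] := eqVneq w (up v).
  rewrite lev_up lerDl ler01 (_ : absz _ = 1%N) /=; last by lia.
  rewrite eqxx /elev intrD (_ : _ - _ = (1 + p (up v) - p v) / 2 - 1); last by rewrite /pos; ring.
  exact: tent_right.
rewrite (pv _); last by rewrite !inE negb_or wv wu.
case: ifP => // /andP[lw /eqP e]; apply: tent_far.
set k := absz (lev w - lev v)%R in e.
have k2 : (2 <= k)%N.
  case: k e => [|[|k]] //= e; first by rewrite e eqxx in wv.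
  by rewrite e eqxx in wu.
have kE : (lev w)%:~R = (lev v)%:~R + k%:R :> R.
  by rewrite -intr_nat -intrD /k; congr (_%:~R); lia.
have : 2 <= k%:R :> R by rewrite ler_nat.
by rewrite kE /elev => h; rewrite ler0_norm; lra.
Qed.

Lemma target_ge : elev p <= target p /\ 0 <= target p.
Proof.
have /andP[s0 s1] := pos01; have [mv _] := heightP gv.
have lh : (lev v)%:~R <= (height v)%:R :> R.
  by rewrite -intr_nat ler_int; case/andP: mv.
rewrite /elev /target; case: (height_up gv) => [[-> lv]|[vE ->]].
  have : (lev v)%:~R + 1 <= (height v)%:R :> R.
    by rewrite -intr_nat -[1]/(1%:~R) -intrD ler_int; lia.
  have := ler0n R (height v); nra.
rewrite -natr1; have := ler0n R (height v); nra.
Qed.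

Lemma above_target : above v (target p) = on_ray (target p).
Proof.
have /andP[s0 s1] := pos01; have [mv _] := heightP gv; have [_ t0] := target_ge.
case: (height_up gv) => [[hE lv]|[vE hE]].
  have tE : target p = (height v)%:R by rewrite /target hE; ring.
  rewrite tE; apply/funext => w; rewrite /above /on_ray.
  have [lw|lw] := eqVneq (lev w) (height v)%:Z; last first.
    have far : tent ((height v)%:R - (lev w)%:~R) = 0 :> R.
      apply: tent_far; rewrite -intr_nat -intrB -intr_norm -[1]/(1%:~R) ler_int; lia.
    by rewrite far !if_same.
  case/andP: mv => l1 /eqP e.
  by rewrite lw l1 lez_nat leq0n /= e.
have lE : lev v = (height v)%:Z by rewrite {1}vE lev_ray.
have tE : target p = (height v)%:R + pos p by rewrite /target hE -natr1; ring.
apply/funext => w; rewrite /above /on_ray lE.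
case: (ltP (lev w) (height v)%:Z) => lw /=.
  case: ifP => // _; apply/esym/tent_far; rewrite tE ger0_norm.
    have : (lev w)%:~R + 1 <= (height v)%:R :> R.
      by rewrite -intr_nat -[1]/(1%:~R) -intrD ler_int; lia.
    by lra.
  have : (lev w)%:~R <= (height v)%:R :> R by rewrite -intr_nat ler_int ltW.
  by lra.
rewrite (_ : 0 <= lev w) /=; last by lia.
have -> n : iter n up v = ray (n + height v) by rewrite {1}vE iter_ray.
by have -> : (absz (lev w - (height v)%:Z)%R + height v)%N = absz (lev w)%R by lia.
Qed.

Lemma flow_first t : 0 <= t <= 1 / 2 -> flow t p = above v (flow1 t p) /\
  (lev v)%:~R <= flow1 t p.
Proof.
move=> /andP[t0 t1]; have [te t00] := target_ge; have /andP[s0 s1] := pos01.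
split.
  apply/funext => w; rewrite /flow /flow2 (_ : Num.max (2 * t - 1) 0 = 0); last first.
    by rewrite max_r //; lra.
  by rewrite mul0r subr0 addrK.
rewrite /flow1 min_l; last by lra.
have : 0 <= 2 * t * (target p - elev p) by apply: mulr_ge0; lra.
have : (lev v)%:~R <= elev p by rewrite /elev lerDl.
lra.
Qed.

Lemma flow_second t : 1 / 2 <= t <= 1 -> flow t p = above (ray 0%N) (flow2 t p) /\
  0 <= flow2 t p.
Proof.
move=> /andP[t0 t1]; have [te t00] := target_ge.
have f2 : 0 <= flow2 t p.
  rewrite /flow2 max_l; last by lra.
  have : 0 <= (1 - t) * target p by apply: mulr_ge0; lra.
  by lra.
split => //; apply/funext => w; rewrite /flow /flow1 min_r; last by lra.
rewrite (_ : elev p + 1 * (target p - elev p) = target p); last by ring.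
by rewrite above_target -(on_rayE f2) addrAC subrr add0r.
Qed.

End Formula.

(** A vertex belongs to the edge below it and to the edge above it; the two formulas agree there, so
    that the motion does not depend on the edge chosen. *)
Lemma flow_up v t p : good v -> real X p -> p v = 0 -> p (up v) = 1 ->
  below [fset v; up v]%fset p -> 0 <= t <= 1 -> flow v t p = flow (up v) t p.
Proof.
move=> gv Xp pv pu pb t01.
have pb' : below [fset up v; up (up v)]%fset p.
  move=> w; rewrite !inE negb_or => /andP[w1 w2].
  have [->//|wv] := eqVneq w v.
  by apply: pb; rewrite !inE negb_or wv w1.
have puu : p (up (up v)) = 0.
  apply: pb; rewrite !inE negb_or up_neq andbT; apply/eqP => /(congr1 lev).
  by rewrite !lev_up; lia.
have posv : pos v p = 1 by rewrite /pos pv pu; lra.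
have posu : pos (up v) p = 0 by rewrite /pos puu pu; lra.
have eE : elev v p = elev (up v) p by rewrite /elev posv posu lev_up intrD addr0.
have tE : target v p = target (up v) p by rewrite /target posv posu; ring.
apply/funext => w; rewrite /flow /flow2 /flow1 eE tE.
have [te _] := target_ge (good_up gv) Xp; rewrite above_up //.
have -> : (lev v)%:~R + 1 = elev (up v) p by rewrite /elev posu lev_up intrD addr0.
by rewrite lerDl mulr_ge0 ?subr_ge0 // le_min ler01 andbT; case/andP: t01 => *; lra.
Qed.

Definition base (p : V -> R) : V :=
  xget (ray 0%N) [set v | [/\ good v, 0 < p v & below [fset v; up v]%fset p]].

Lemma baseP p : real X p -> I p -> [/\ good (base p), 0 < p (base p) &
  below [fset base p; up (base p)]%fset p].
Proof.
move=> Xp Ip; have [v Hv] := I_base Xp Ip.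
apply: (@xgetPex _ (ray 0%N) [set v | [/\ good v, 0 < p v & below [fset v; up v]%fset p]]).
by exists v.
Qed.

Lemma flow_base v t p : good v -> real X p -> I p -> below [fset v; up v]%fset p ->
  0 <= t <= 1 -> flow (base p) t p = flow v t p.
Proof.
move=> gv Xp Ip pv t01; have [gb pb bb] := baseP Xp Ip.
have [->//|bv] := eqVneq (base p) v.
have bE : base p = up v.
  apply/eqP; have : base p \in [fset v; up v]%fset.
    by apply: contraLR pb => /pv ->; rewrite ltxx.
  by rewrite !inE (negbTE bv).
have p0 : p v = 0.
  apply: bb; rewrite bE !inE negb_or; apply/andP; split; apply/eqP => /(congr1 lev);
    rewrite !lev_up; lia.
rewrite bE; apply/esym/flow_up => //.
by case: (edge_max Xp pv) => // e; move: p0; rewrite e => /eqP; rewrite oner_eq0.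
Qed.

Lemma contr_ray : contr X I.
Proof.
have cr0 : cone X (on_ray 0) /\ I (on_ray 0).
  rewrite on_rayE //; have [|u [gu bu [w w0]]] := @above_edge (ray 0%N) 0 good_ray.
    by rewrite lev_ray.
  apply: (edge_XI gu bu); last by exists w.
  by move=> x; exact: above_ge0.
apply: (@contr_cone _ _ _ _ (fun t p => flow (base p) t p) (on_ray 0)) => //.
- exact: cr0.1.
- exact: cr0.2.
- move=> t p /andP[t0 t1] Xp Ip; have [gb pb bb] := baseP Xp Ip.
  have [th|th] := leP t (1 / 2).
    have [|-> f1] := flow_first gb Xp (t := t); first by rewrite t0 th.
    have [u [gu bu [w w0]]] := above_edge gb f1.
    apply: (edge_XI gu bu); last by exists w.
    by move=> x; exact: above_ge0.
  have [|-> f2] := flow_second gb Xp (t := t); first by rewrite t1 ltW.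
  have [|u [gu bu [w w0]]] := @above_edge (ray 0%N) (flow2 (base p) t p) good_ray.
    by rewrite lev_ray.
  apply: (edge_XI gu bu); last by exists w.
  by move=> x; exact: above_ge0.
- move=> p Xp Ip; have [gb pb bb] := baseP Xp Ip.
  have [|-> f1] := flow_first gb Xp (t := 0); first by apply/andP; split; lra.
  by rewrite /flow1 mulr0 min_l ?ler01 // mul0r addr0 elevE.
- move=> p Xp Ip; have [gb pb bb] := baseP Xp Ip.
  have [|-> f1] := flow_second gb Xp (t := 1); first by apply/andP; split; lra.
  rewrite on_rayE //; congr (above _ _).
  by rewrite /flow2 max_l; [ring|lra].
move=> S XS.
have alt : (exists v, good v /\ forall t p, dom X I S t p ->
    below [fset v; up v]%fset p) \/ (forall t p, ~ dom X I S t p).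
  have [v Sv] := X_edge XS.
  have below' t p : dom X I S t p -> below [fset v; up v]%fset p.
    by move=> [_ _ _ pS] w wS; apply: pS; apply: contra wS; exact: (fsubsetP Sv).
  have [gv|ngv] := pselect (good v); first by left; exists v.
  have [[t [p D]]|nD] := pselect (exists t p, dom X I S t p); last first.
    by right=> t p D; apply: nD; exists t, p.
  (* If the lower end [v] is not good, the invariant points of this edge sit at its upper end, and
     the next edge can serve instead. *)
  have key t' p' : dom X I S t' p' -> good (up v) /\ below [fset up v; up (up v)]%fset p'.
    move=> D'; have [_ Xp' Ip' _] := D'; have [gb pb bb] := baseP Xp' Ip'.
    have : base p' \in [fset v; up v]%fset.
      by apply: contraLR pb => /(below' _ _ D') ->; rewrite ltxx.
    by rewrite !inE => /orP[/eqP e|/eqP e]; move: gb bb; rewrite e.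
  by left; exists (up v); split; [exact: (key _ _ D).1|move=> t' p' D'; exact: (key _ _ D').2].
case: alt => [[v [gv vS]]|nD]; last by exists fset0 => [t p /nD //|F FF t0 p0 /nD].
have fE t p : dom X I S t p -> flow (base p) t p = flow v t p.
  by move=> D; have [t01 Xp Ip _] := D; apply: flow_base => //; exact: vS D.
pose K := (absz (lev v)%R + maxn (height v) (height (up v))).+3.
have targetK p : real X p -> below [fset v; up v]%fset p ->
    target v p <= (maxn (height v) (height (up v)))%:R.
  move=> Xp pb; have /andP[s0 s1] := pos01 v Xp.
  have h1 : (height v)%:R <= (maxn (height v) (height (up v)))%:R :> R.
    by rewrite ler_nat leq_maxl.
  have h2 : (height (up v))%:R <= (maxn (height v) (height (up v)))%:R :> R.
    by rewrite ler_nat leq_maxr.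
  by rewrite /target; nra.
exists ([fset iter (k : 'I_K) up v | k in 'I_K] `|` [fset ray (k : 'I_K) | k in 'I_K])%fset.
  move=> t p D w; rewrite (fE _ _ D) inE negb_or => /andP[wv wr].
  have [t01 Xp Ip _] := D; have pb := vS _ _ D.
  have tK := targetK p Xp pb; have [te te0] := target_ge gv Xp.
  have f1K : flow1 v t p <= target v p.
    rewrite /flow1; have : 0 <= target v p - elev v p by lra.
    have : Num.min (2 * t) 1 <= 1 by rewrite ge_min lexx orbT.
    by nra.
  have f2K : flow2 v t p <= target v p.
    rewrite /flow2; have : 0 <= Num.max (2 * t - 1) 0 by rewrite le_max lexx orbT.
    by nra.
  have rayK y : y <= target v p -> on_ray y w = 0.
    move=> yK; rewrite /on_ray; case: ifP => // /andP[lw /eqP e].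
    have kK : (K <= absz (lev w)%R)%N.
      rewrite leqNgt; apply: contra wr => kK.
      by apply/imfsetP; exists (Ordinal kK).
    apply: tent_far; have : (maxn (height v) (height (up v)))%:R + 1 <= (lev w)%:~R :> R.
      rewrite -intr_nat -[1]/(1%:~R) -intrD ler_int.
      by move: kK; rewrite /K; lia.
    by move=> H; rewrite ler0_norm; lra.
  have aK : above v (flow1 v t p) w = 0.
    rewrite /above; case: ifP => // /andP[lw /eqP e].
    have kK : (K <= absz (lev w - lev v)%R)%N.
      rewrite leqNgt; apply: contra wv => kK.
      by apply/imfsetP; exists (Ordinal kK).
    apply: tent_far; have : (maxn (height v) (height (up v)))%:R + 1 <= (lev w)%:~R :> R.
      rewrite -intr_nat -[1]/(1%:~R) -intrD ler_int.
      by move: kK; rewrite /K; lia.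
    by move=> H; rewrite ler0_norm; lra.
  by rewrite /flow aK !rayK // add0r subrr.
move=> F FF t0 p0 D0 FD Ft Fp w; rewrite (fE _ _ D0).
suff : (fun x => flow v x.1 x.2 w) @ F --> flow v t0 p0 w.
  apply: cvg_trans; apply: near_eq_cvg; near=> x; rewrite (fE x.1 x.2) //.
  by near: x.
have posc : (fun x : R * (V -> R) => pos v x.2) @ F --> pos v p0.
  apply: cvgM; last exact: cvg_cst.
  by apply: cvgB; [apply: cvgD; [exact: cvg_cst|exact: Fp]|exact: Fp].
have elevc : (fun x : R * (V -> R) => elev v x.2) @ F --> elev v p0.
  by apply: cvgD; [exact: cvg_cst|].
have targetc : (fun x : R * (V -> R) => target v x.2) @ F --> target v p0.
  apply: cvgD; (apply: cvgM; last exact: cvg_cst) => //.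
  by apply: cvgB => //; exact: cvg_cst.
have t2c : (fun x : R * (V -> R) => 2 * x.1) @ F --> 2 * t0.
  by apply: cvgM; [exact: cvg_cst|exact: Ft].
have f1c : (fun x : R * (V -> R) => flow1 v x.1 x.2) @ F --> flow1 v t0 p0.
  apply: cvgD => //; apply: cvgM; last exact: cvgB.
  by apply: cvg_minr => //; exact: cvg_cst.
have f2c : (fun x : R * (V -> R) => flow2 v x.1 x.2) @ F --> flow2 v t0 p0.
  apply: cvgB => //; apply: cvgM => //.
  by apply: cvg_maxr; [apply: cvgB => //; exact: cvg_cst|exact: cvg_cst].
have ray_c (y : R * (V -> R) -> R) y0 : y @ F --> y0 ->
    (fun x => on_ray (y x) w) @ F --> on_ray y0 w.
  move=> yc; rewrite /on_ray; case: (_ && _); last exact: cvg_cst.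
  by apply: cvg_tent; apply: cvgB => //; exact: cvg_cst.
apply: cvgB; last exact: ray_c.
apply: cvgD; last exact: ray_c.
rewrite /above; case: (_ && _); last exact: cvg_cst.
by apply: cvg_tent; apply: cvgB => //; exact: cvg_cst.
Unshelve. all: by end_near. Qed.

End Ray.

(** * Increasing unions and the tree of cosets *)

Section Union.
Variables (R : realType) (G : groupType) (P : nat -> G -> Prop).
Hypotheses (P1 : forall n, P n 1%g).
Hypothesis PM : forall n x y, P n x -> P n y -> P n (x * y)%g.
Hypothesis PV : forall n x, P n x -> P n x^-1%g.
Hypothesis PS : forall m n x, (m <= n)%N -> P m x -> P n x.
Hypothesis PT : forall x, exists n, P n x.
Hypothesis HPn : forall n (H : groupType) (i : H -> G), is_hom i -> injective i ->
  (forall h, P n (i h)) -> HP R H.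

(** The level is recorded along with the subset, since one subset can be a coset for several
    [P n]. *)
Let V : choiceType := (nat * set G)%type.

Definition tree_act (g : G) (v : V) : V := (v.1, [set y | v.2 (g^-1 * y)%g]).

Definition tree_up (v : V) : V :=
  (v.1.+1, [set y | exists x, v.2 x /\ P v.1.+1 (x^-1 * y)%g]).

Definition left_coset n g : set G := [set x | P n (g^-1 * x)%g].

Definition is_coset (v : V) : Prop := exists g, v.2 = left_coset v.1 g.

Definition tree (S : {fset V}) : Prop :=
  S != fset0 /\ exists v, is_coset v /\ fsubset S [fset v; tree_up v]%fset.

Lemma tree_up_coset n g : tree_up (n, left_coset n g) = (n.+1, left_coset n.+1 g).
Proof.
congr pair; apply/seteqP; split => y /=.
  move=> [x [Px Pxy]]; rewrite /left_coset /=.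
  have -> : (g^-1 * y = (g^-1 * x) * (x^-1 * y))%g by rewrite mulgA mulgK.
  by apply: PM => //; apply: PS Px.
by move=> Py; exists g; split => //; rewrite /left_coset /= mulVg.
Qed.

Lemma is_coset_up v : is_coset v -> is_coset (tree_up v).
Proof.
case: v => n A [g /= ->]; exists g.
by rewrite tree_up_coset.
Qed.

Lemma tree_vact : vact tree_act.
Proof.
split=> [[n A]|g h [n A]]; congr pair; apply/seteqP; split => y /=;
  by rewrite ?invg1 ?mul1g // invgM mulgA.
Qed.

Lemma tree_act_up g v : tree_act g (tree_up v) = tree_up (tree_act g v).
Proof.
case: v => n A; congr pair; apply/seteqP; split => y /= [x [Ax Pxy]].
  exists (g * x)%g; split; first by rewrite mulKg.
  by rewrite invgM -mulgA.
by exists (g^-1 * x)%g; split => //; rewrite invgM invgK -mulgA mulVKg.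
Qed.

Lemma is_coset_act g v : is_coset v -> is_coset (tree_act g v).
Proof.
case: v => n A [x /= ->]; exists (g * x)%g => /=.
by apply/seteqP; split => y; rewrite /left_coset /= invgM mulgA.
Qed.

Lemma tree_simplicial : simplicial tree.
Proof.
split=> [S []//|S T [S0 [v [cv Sv]]] TS T0].
by split => //; exists v; split => //; exact: fsubset_trans TS Sv.
Qed.

Lemma tree_level v w : w \in [fset v; tree_up v]%fset ->
  forall w', w' \in [fset v; tree_up v]%fset -> w.1 = w'.1 -> w = w'.
Proof.
rewrite !inE => /orP[/eqP ->|/eqP ->] w'; rewrite !inE => /orP[/eqP ->|/eqP ->] //= e;
  by exfalso; lia.
Qed.

Lemma tree_stab v h : tree_act h v = v -> forall g, v.2 = left_coset v.1 g ->
  P v.1 (g^-1 * h * g)%g.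
Proof.
move=> hv g vg; have : v.2 (h * g)%g.
  by rewrite -{1}hv /= mulKg vg /left_coset /= mulVg.
by rewrite vg /left_coset /= mulgA.
Qed.

(** Vertex stabilisers are conjugate into the [P n]. A virtually cyclic image is finitely generated,
    so it lies in some [P n0] and fixes the ray of trivial cosets from that level on. Every coset is
    carried into this ray by going up, as its representative lies in some [P n]. *)
Lemma HP_union : HP R G.
Proof.
apply: (@HP_step R G V tree tree_act 2).
- exact: tree_simplicial.
- move=> S [_ [v [_ Sv]]]; apply: leq_trans (fsubset_leq_card Sv) _.
  by rewrite cardfs2; case: (_ == _).
- exact: tree_vact.
- move=> g S [S0 [v [cv Sv]]]; split; first exact: (push_neq0 tree_vact).
  exists (tree_act g v); split; first exact: is_coset_act.
  apply/fsubsetP => w /imfsetP[u /= uS ->].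
  have := fsubsetP Sv _ uS; rewrite !inE => /orP[/eqP ->|/eqP ->].
    by rewrite eqxx.
  by rewrite tree_act_up eqxx orbT.
- move=> S [/fset0Pn[w wS] [v [cv Sv]]] H f fM fi Sfix.
  have [g wg] : is_coset w.
    by have := fsubsetP Sv _ wS; rewrite !inE => /orP[/eqP ->|/eqP ->] //; exact: is_coset_up.
  have wfix h : tree_act (f h) w = w.
    apply: (tree_level (v := v)) => //; last exact: (fsubsetP Sv).
    by apply: (fsubsetP Sv); rewrite -(Sfix h) (mem_push tree_vact) (actK tree_vact).
  apply: (@HPn w.1 H (fun h => g^-1 * f h * g)%g).
  + by move=> x y; rewrite fM !mulgA mulgK.
  + by move=> x y /mulIg/mulgI/fi.
  + by move=> h; exact: tree_stab.
move=> H f fM [c [l cl]].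
have [n0 Pn0] : exists n0, forall h, P n0 (f h).
  have [nc Pc] := PT (f c).
  have [nl Pl] : exists n, forall r, r \in l -> P n (f r).
    elim: l {cl} => [|r l [n Pn]]; first by exists 0%N.
    have [m Pm] := PT (f r); exists (maxn m n) => s; rewrite inE => /orP[/eqP ->|/Pn].
      by apply: PS Pm; exact: leq_maxl.
    by apply: PS; exact: leq_maxr.
  exists (maxn nc nl) => h; have [r /Pl Pr [z ->]] := cl h.
  rewrite fM (hom_zexp _ _ fM); apply: PM; first by apply: PS Pr; exact: leq_maxr.
  have Pcn : P (maxn nc nl) (f c) by apply: PS Pc; exact: leq_maxl.
  have PX n : P (maxn nc nl) (f c ^+ n)%g.
    by elim: n => [|n IH]; rewrite ?expg0 // expgS; apply: PM.
  by case: z => n /=; [exact: PX|apply: PV; exact: PX].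
pose good v := is_coset v /\ forall h, tree_act (f h) v = v.
have lcE n x y : left_coset n x y = P n (x^-1 * y)%g by [].
have lc n y : left_coset n 1%g y = P n y by rewrite /left_coset /= invg1 mul1g.
pose ray k : V := ((n0 + k)%N, left_coset (n0 + k) 1%g).
have iter_up n m g : iter n tree_up (m, left_coset m g) = ((m + n)%N, left_coset (m + n) g).
  by elim: n => [|n IH]; rewrite ?addn0 //= IH tree_up_coset addnS.
apply: (@contr_ray R V tree (fixed_by tree_act f) good tree_up
  (fun v => v.1%:Z - n0%:Z) ray).
- exact: tree_simplicial.
- by move=> k p _ pI h v; rewrite pI.
- by move=> v /=; lia.
- move=> v [cv fv]; split; first exact: is_coset_up.
  by move=> h; rewrite tree_act_up fv.
- by move=> k; rewrite /ray /=; lia.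
- by move=> k; rewrite /ray tree_up_coset addnS.
- split; first by exists 1%g.
  move=> h; congr pair; apply/seteqP; split => y; rewrite /= !lc addn0 => Py.
    by rewrite -[y](mulVKg (f h)); apply: PM.
  by apply: PM => //; exact: PV.
- move=> [n A] [[g /= ->] _]; have [N PN] := PT g.
  exists (n + N)%N; split; first by lia.
  rewrite iter_up /ray; have -> : (n + absz ((n + N)%N%:Z - (n%:Z - n0%:Z))%R)%N = (n0 + (n + N))%N by lia.
  congr pair; apply/seteqP; split => y; rewrite lc lcE => Py.
    by rewrite -[y](mulVKg g); apply: PM => //; apply: PS PN; lia.
  by apply: PM => //; apply: PV; apply: PS PN; lia.
- by move=> S [_ [v [_ Sv]]]; exists v.
- move=> p [[S [/fset0Pn[w0 w0S] [v [cv Sv]]] pS] _ _] pI.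
  have fixS w : w \in S -> forall h, tree_act (f h) w = w.
    move=> wS h; apply: (tree_level (v := v)) => //; last exact: (fsubsetP Sv).
    by apply: (fsubsetP Sv); have [_ ->] := pS (tree_act (f h) w); rewrite pI; have [_ <-] := pS w.
  have [vS|vS] := boolP (v \in S).
    exists v; split; first by split => //; exact: fixS.
      by have [_ <-] := pS v.
    by move=> w wv; apply: (carrier_below pS); apply: contra wv; exact: (fsubsetP Sv).
  have uS w : w \in S -> w = tree_up v.
    move=> wS; have := fsubsetP Sv _ wS; rewrite !inE => /orP[/eqP e|/eqP //].
    by move: vS; rewrite -e wS.
  have w0E := uS _ w0S; exists (tree_up v); split.
  + split; first exact: is_coset_up.
    by rewrite -w0E; exact: fixS.
  + by rewrite -w0E; have [_ <-] := pS w0.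
  + move=> w; rewrite !inE negb_or => /andP[wu _]; apply: (carrier_below pS).
    by apply: contra wu => /uS ->.
- move=> v p [cv fv] pb p0 [w pw]; split.
    exists [fset x in [fset v; tree_up v] | (0 < p x)%R]%fset; last exact: below_carrier.
    have cF := below_carrier pb p0; split.
      by apply/fset0Pn; exists w; have [_ ->] := cF w.
    by exists v; split => //; apply/fsubsetP => x; rewrite !inE => /andP[].
  have fix2 x : x \in [fset v; tree_up v]%fset -> forall h, tree_act (f h) x = x.
    by rewrite !inE => /orP[/eqP ->|/eqP ->] // h; rewrite tree_act_up fv.
  move=> h x; have [/fix2 -> //|xv] := boolP (x \in [fset v; tree_up v]%fset).
  rewrite (pb x xv); apply: pb; apply: contra xv => xv.
  by rewrite -(actK tree_vact (f h) x) -(homV fM) fix2.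
Qed.

End Union.

(* A cyclic subgroup of Z^2 fixes a line among the lines attached to the slopes;
   the extra line, attached to the vertical direction, is joined to them. *)
Section Plane.
Variables (R : realType) (G : groupType) (al be : G -> int).
Hypotheses (alM : forall x y, al (x * y)%g = al x + al y).
Hypotheses (beM : forall x y, be (x * y)%g = be x + be y).
Hypothesis HPd : forall (H : groupType) (i : H -> G), is_hom i -> injective i ->
  (exists m1 m2 : int, (m1 != 0) || (m2 != 0) /\
     forall h, m1 * al (i h) = m2 * be (i h)) -> HP R H.

Let V : choiceType := (option rat * int)%type.

Definition shift (o : option rat) (g : G) : int :=
  if o is Some y then numq y * al g - denq y * be g else al g.

Definition lines_act (g : G) (v : V) : V := (v.1, v.2 + shift v.1 g).

Definition line_next (v : V) : V := (v.1, v.2 + 1).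

(** The lines of the rational slopes are pairwise disjoint; joining all of them with the line [None]
    makes the set fixed by the trivial group contractible. If [al] vanishes on a virtually cyclic
    image, the line [None] is fixed pointwise; otherwise invariant points exist over one slope
    only. *)
Definition lines (S : {fset V}) : Prop := S != fset0 /\
  exists i j y, fsubset S ([fset (None, i); line_next (None, i)] `|`
    [fset (Some y, j); line_next (Some y, j)])%fset.

Lemma shiftM o x y : shift o (x * y)%g = shift o x + shift o y.
Proof. by case: o => [y0|] /=; rewrite alM ?beM; ring. Qed.

Lemma shift1 o : shift o 1%g = 0.
Proof. by have := shiftM o 1%g 1%g; rewrite mul1g; lia. Qed.

Lemma lines_vact : vact lines_act.
Proof.
split=> [[w i]|g h [w i]]; congr pair; rewrite /= ?shift1 ?addr0 // shiftM; ring.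
Qed.

Lemma lines_act_next g v : lines_act g (line_next v) = line_next (lines_act g v).
Proof. by congr pair; rewrite /=; ring. Qed.

Lemma lines_simplicial : simplicial lines.
Proof.
split=> [S []//|S T [S0 [i [j [y Sv]]]] TS T0].
by split => //; exists i, j, y; exact: fsubset_trans TS Sv.
Qed.

Lemma lines_push g S : lines S -> lines (push lines_act g S).
Proof.
move=> [S0 [i [j [y Sv]]]]; split; first exact: (push_neq0 lines_vact).
exists (i + shift None g), (j + shift (Some y) g), y.
apply/fsubsetP => w /imfsetP[u /= uS ->].
have := fsubsetP Sv _ uS; rewrite !inE => /orP[/orP[/eqP ->|/eqP ->]|/orP[/eqP ->|/eqP ->]];
  by rewrite ?lines_act_next /lines_act /= !eqxx ?orbT.
Qed.

Lemma finite_shift (S : {fset V}) v k : v \in S ->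
  (forall w, w \in S -> w.1 = v.1 -> (w.1, w.2 + k) \in S) -> k = 0.
Proof.
move=> vS kS; apply/eqP/negPn/negP => k0.
have H (n : nat) : (v.1, v.2 + n%:Z * k) \in S.
  elim: n => [|n IH]; first by rewrite mul0r addr0; case: (v) vS.
  by have := kS _ IH erefl; rewrite /= -addrA -addn1 PoszD mulrDl mul1r.
pose orbit := [seq (v.1, v.2 + n%:Z * k) | n <- iota 0 (size S).+1].
have : (size orbit <= size S)%N.
  apply: uniq_leq_size; last by move=> w /mapP[n _ ->].
  rewrite map_inj_uniq ?iota_uniq // => m n [] /addrI/(mulIf k0) [].
  by [].
by rewrite size_map size_iota ltnn.
Qed.

Lemma shift_dep (H : groupType) (i : H -> G) o :
  (forall h, shift o (i h) = 0) -> exists m1 m2 : int, (m1 != 0) || (m2 != 0) /\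
     forall h, m1 * al (i h) = m2 * be (i h).
Proof.
case: o => [y|] io.
  exists (numq y), (denq y); split; first by rewrite denq_neq0 orbT.
  by move=> h; apply/eqP; rewrite -subr_eq0; apply/eqP; exact: io.
by exists 1, 0; split => // h; rewrite mul1r mul0r; exact: io.
Qed.

Section Fixed.
Variables (H : groupType) (f : H -> G) (fM : is_hom f) (o : option rat).
Hypothesis fo : forall h, shift o (f h) = 0.
Hypothesis fo' : forall y, o = Some y -> forall y', y' != y ->
  exists h, shift (Some y') (f h) != 0.

Let I : (V -> R) -> Prop := fixed_by lines_act f.
Let V1 : pred V := fun v => v.1 == o.

Lemma act_V1 h v : V1 (lines_act h v) = V1 v. Proof. by []. Qed.

Lemma act_o h v : V1 v -> lines_act (f h) v = v.
Proof. by case: v => o' i /eqP /= ->; rewrite /lines_act /= fo addr0. Qed.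

Lemma line_edge S : subcomplex1 lines V1 S ->
  exists v, V1 v /\ fsubset S [fset v; line_next v]%fset.
Proof.
move=> [[/fset0Pn[w0 w0S] [i [j [y Sv]]]] So]; case oE : o => [y'|].
  exists (Some y, j); split.
    have := fsubsetP Sv _ w0S; have := So _ w0S; rewrite /V1 oE !inE => w0o.
    by move=> /orP[/orP[/eqP e|/eqP e]|/orP[/eqP e|/eqP e]]; move: w0o; rewrite e.
  apply/fsubsetP => v vS; have := fsubsetP Sv _ vS; have := So _ vS.
  rewrite /V1 oE !inE => vo /orP[/orP[/eqP e|/eqP e]|//]; by move: vo; rewrite e.
exists (None, i); split; first by rewrite /V1 oE.
apply/fsubsetP => v vS; have := fsubsetP Sv _ vS; have := So _ vS.
rewrite /V1 oE !inE => vo /orP[//|/orP[/eqP e|/eqP e]]; by move: vo; rewrite e.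
Qed.

Lemma contr_line : contr (subcomplex1 lines V1) I.
Proof.
pose good (v : V) : Prop := V1 v.
apply: (@contr_ray R V _ I good line_next (fun v => v.2) (fun k : nat => (o, k%:Z))).
- exact: simplicial1 lines_simplicial.
- by move=> k p _ pI h v; rewrite pI.
- by [].
- by [].
- by [].
- by move=> k; congr pair; rewrite /= -addn1 PoszD.
- by rewrite /good /V1 /= eqxx.
- move=> [w i] /eqP /= ->; exists (absz i); split; first by lia.
  have it n j : iter n line_next (o, j) = (o, j + n%:Z).
    elim: n => [|n IH]; rewrite ?addr0 //= IH /line_next /=; congr pair; lia.
  rewrite it; congr pair; lia.
- by move=> S /line_edge[v [_ Sv]]; exists v.
- move=> p [[S XS pS] _ _] _; have /fset0Pn[w0 w0S] := XS.1.1.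
  have [v [vo Sv']] := line_edge XS.
  have [vS|vS] := boolP (v \in S).
    exists v; split => //; first by have [_ <-] := pS v.
    by move=> w wv; apply: (carrier_below pS); apply: contra wv; exact: (fsubsetP Sv').
  exists (line_next v).
  have uS w : w \in S -> w = line_next v.
    move=> wS; have := fsubsetP Sv' _ wS; rewrite !inE => /orP[/eqP e|/eqP //].
    by move: vS; rewrite -e wS.
  split => //; first by rewrite -(uS _ w0S); have [_ <-] := pS w0.
  move=> w; rewrite !inE negb_or => /andP[wu _]; apply: (carrier_below pS).
  by apply: contra wu => /uS ->.
- move=> v p vo pb p0 [w pw]; split.
    exists [fset x in [fset v; line_next v] | (0 < p x)%R]%fset; last exact: below_carrier.
    have cF := below_carrier pb p0; split; last first.
      by move=> x; rewrite !inE => /andP[/orP[/eqP ->|/eqP ->]].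
    split; first by apply/fset0Pn; exists w; have [_ ->] := cF w.
    case: v vo pb cF => w' i /= /eqP /= -> _ _; case oE : o => [y|].
      exists 0, i, y; apply/fsubsetP => x; rewrite !inE => /andP[xv _].
      by rewrite xv orbT.
    exists i, 0, 0; apply/fsubsetP => x; rewrite !inE => /andP[xv _].
    by rewrite xv.
  have fix2 x : x \in [fset v; line_next v]%fset -> V1 x.
    by rewrite !inE => /orP[/eqP ->|/eqP ->].
  move=> h x; have [/fix2 xo|xv] := boolP (x \in [fset v; line_next v]%fset).
    by rewrite act_o.
  rewrite (pb x xv); apply: pb; apply: contra xv => xv.
  have xo := fix2 _ xv; by rewrite act_o // in xv.
Qed.

Lemma contr_lines : contr lines I.
Proof.
have sI : scale_closed I by move=> k p _ pI h v; rewrite pI.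
apply: (contr_join (V1 := V1) lines_simplicial sI); last exact: contr_line.
  by move=> p _ pI h v; rewrite /restr1 act_V1; case: ifP => // _; exact: pI.
move=> p q c c0 [S [S0 [i [j [y Sv]]]] pS] pI [T [[T0 [i' [j' [y' Tv]]]] To] qT] qI.
split; last by move=> h v; rewrite /restr2 act_V1 pI qI.
set r := fun v => _.
have r0 v : 0 <= r v.
  rewrite addr_ge0 ?(carrier_ge0 _ qT) // mulr_ge0 // /restr2; case: ifP => // _.
  exact: carrier_ge0 pS.
have rE v : v \notin T -> (v \notin S) || V1 v -> r v = 0.
  move=> vT vS; rewrite /r (carrier_below qT vT) addr0 /restr2.
  by case: ifP vS => [|_]; rewrite ?mulr0 // orbF => /(carrier_below pS) ->; rewrite mulr0.
have rb : below (S `|` T)%fset r.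
  by move=> v; rewrite inE negb_or => /andP[vS vT]; apply: rE; rewrite ?vS.
exists [fset v in (S `|` T)%fset | (0 < r v)%R]%fset; last exact: below_carrier.
have cF := below_carrier rb r0; split.
  have /fset0Pn[v vT] := T0; apply/fset0Pn; exists v; have [_ ->] := cF v.
  rewrite /r /restr2 -/(V1 v) To // mulr0 add0r; exact: (carrier_gt0 qT).
have rv v : v \in [fset v in (S `|` T)%fset | (0 < r v)%R]%fset -> v \in T \/ (v \in S /\ ~~ V1 v).
  have [_ ->] := cF v => rv; have [vT|vT] := boolP (v \in T); first by left.
  right; apply/andP; rewrite -[v \in S]negbK -negb_or; apply: contraL rv => h.
  by rewrite rE ?ltxx.
case oE : o => [y0|]; last first.
  exists i', j, y; apply/fsubsetP => v /rv[vT|[vS vo]].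
    have := fsubsetP Tv _ vT; have := To _ vT; rewrite /V1 oE !inE.
    by move=> vo /orP[->//|/orP[/eqP e|/eqP e]]; move: vo; rewrite e.
  have := fsubsetP Sv _ vS; move: vo; rewrite /V1 oE !inE.
  by move=> vo /orP[/orP[/eqP e|/eqP e]|->]; rewrite ?orbT //; move: vo; rewrite e.
exists i, j', y'; apply/fsubsetP => v /rv[vT|[vS vo]].
  have := fsubsetP Tv _ vT; have := To _ vT; rewrite /V1 oE !inE.
  by move=> vo /orP[/orP[/eqP e|/eqP e]|->]; rewrite ?orbT //; move: vo; rewrite e.
have := fsubsetP Sv _ vS; rewrite !inE => /orP[->//|vy]; exfalso.
have [w1 w1S] : exists w, w \in S /\ w.1 = Some y.
  by exists v; split => //; move: vy => /orP[/eqP ->|/eqP ->].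
have yy0 : y != y0.
  by apply: contra vo => /eqP e; rewrite /V1 oE -e; move: vy => /orP[/eqP ->|/eqP ->].
(* Over any other slope some element translates by a nonzero amount, whereas the support of an
   invariant point is finite and stable. *)
have [h /negP] := fo' oE yy0; apply.
apply/eqP; apply: (@finite_shift S w1); first exact: w1S.1.
move=> w wS; rewrite w1S.2 => wy.
have -> : (w.1, w.2 + shift (Some y) (f h)) = lines_act (f h) w by rewrite /lines_act wy.
by have [_ ->] := pS (lines_act (f h) w); rewrite pI; have [_ <-] := pS w.
Qed.

End Fixed.

Lemma HP_plane : HP R G.
Proof.
apply: (@HP_step R G V lines lines_act 4).
- exact: lines_simplicial.
- move=> S [_ [i [j [y Sv]]]]; apply: leq_trans (fsubset_leq_card Sv) _.
  apply: leq_trans (leq_card_fsetU _ _) _.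
  by rewrite !cardfs2; do 2 case: (_ == _).
- exact: lines_vact.
- by move=> g S; exact: lines_push.
- move=> S [/fset0Pn[v vS] _] H f fM fi Sfix; apply: (HPd fM fi).
  apply: (shift_dep (o := v.1)) => h; apply: (finite_shift vS) => w wS wv.
  have -> : (w.1, w.2 + shift v.1 (f h)) = lines_act (f h) w by rewrite /lines_act wv.
  by rewrite -(Sfix h) (mem_push lines_vact) (actK lines_vact).
move=> H f fM vf.
have [al0|/existsNP[h0 /eqP h00]] := pselect (forall h, al (f h) = 0).
  by apply: (contr_lines (o := None)).
have [c [l cl]] := vf.
(* By pigeonhole two powers of [h] have the same representative modulo powers of [c]. Both
   characters then take at [h] the same rational multiple of their values at [c], and this
   determines the slope. *)
have prop_c h : exists N M : int, [/\ N != 0, N * al (f h) = M * al (f c) &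
    N * be (f h) = M * be (f c)].
  have [r [m [n [z [z' [mn rl hm hn]]]]]] : exists (r : H) (m n : nat) (z z' : int),
      [/\ (m < n)%N, r \in l, f (h ^+ m)%g = f (r * zexp c z)%g & f (h ^+ n)%g = f (r * zexp c z')%g].
    pose idx n := xget 0%N [set k | (k < size l)%N /\ exists z, f (h ^+ n)%g = f (nth 1%g l k * zexp c z)%g].
    have idxP n : (idx n < size l)%N /\ exists z, f (h ^+ n)%g = f (nth 1%g l (idx n) * zexp c z)%g.
      have [r rl [z e]] := cl (h ^+ n)%g.
      apply: (@xgetPex _ 0%N [set k | (k < size l)%N /\ exists z, f (h ^+ n)%g = f (nth 1%g l k * zexp c z)%g]).
      by exists (index r l); split; [rewrite index_mem|exists z; rewrite nth_index].
    have /injectivePn[m [n mn e]] : ~~ injectiveb (fun n : 'I_(size l).+1 => Ordinal (idxP n).1).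
      apply/negP => /injectiveP/leq_card; by rewrite !card_ord ltnn.
    have e' : idx m = idx n by case: e.
    have [_ [z hz]] := idxP m; have [_ [z' hz']] := idxP n.
    have [lt|lt|eq] := ltngtP m n.
    - exists (nth 1%g l (idx m)), m, n, z, z'; split => //; first exact: mem_nth (idxP m).1.
      by rewrite hz' e'.
    - exists (nth 1%g l (idx m)), n, m, z', z; split => //; first exact: mem_nth (idxP m).1.
      by rewrite hz' e'.
    - by move: mn; rewrite (val_inj eq) eqxx.
  have lin (u : G -> int) : (forall x y, u (x * y)%g = u x + u y) ->
      (n%:Z - m%:Z) * u (f h) = (z' - z) * u (f c).
    move=> uM; have u1 : u 1%g = 0 by have := uM 1%g 1%g; rewrite mul1g; lia.
    have uV x : u x^-1%g = - u x by have := uM x x^-1%g; rewrite mulgV u1; lia.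
    have uX x k : u (x ^+ k)%g = k%:Z * u x.
      elim: k => [|k IH]; first by rewrite mul0r.
      by rewrite expgS uM IH -addn1 PoszD; ring.
    have uZ x k : u (zexp x k) = k * u x.
      by case: k => k; rewrite /= ?uV uX // NegzE mulNr.
    have := congr1 u hm; have := congr1 u hn.
    rewrite !fM !uM !(homX fM) !uX !(hom_zexp _ _ fM) !uZ => e1 e2.
    have : n%:Z * u (f h) - m%:Z * u (f h) = z' * u (f c) - z * u (f c) by rewrite e1 e2; ring.
    by move=> e; rewrite !mulrBl.
  by exists (n%:Z - m%:Z), (z' - z); split; [lia|exact: lin|exact: lin].
have ac0 : al (f c) != 0.
  have [N [M [N0 e _]]] := prop_c h0.
  by apply: contra_neq h00 => ac; apply: (mulfI N0); rewrite e ac !mulr0.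
have prop h : al (f c) * be (f h) = be (f c) * al (f h).
  have [N [M [N0 e1 e2]]] := prop_c h; apply: (mulfI N0).
  by rewrite mulrCA e2 [RHS]mulrCA e1; ring.
have aQ : (al (f c))%:~R != 0 :> rat by rewrite intr_eq0.
pose y : rat := (be (f c))%:~R / (al (f c))%:~R.
have yE (y' : rat) : (numq y' * al (f c) == denq y' * be (f c)) = (y' == y).
  rewrite -(inj_eq (@intr_inj rat)) !rmorphM /= [X in _ == X]mulrC.
  by rewrite -eqr_div ?divq_num_den // intr_eq0 denq_neq0.
apply: (contr_lines (o := Some y)).
- move=> h; have := eqxx y; rewrite -yE => /eqP e.
  apply: (mulfI ac0); rewrite mulr0 /=.
  transitivity ((numq y * al (f c)) * al (f h) - denq y * (al (f c) * be (f h))).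
    by ring.
  by rewrite e prop; ring.
- move=> _ [<-] y' yy'; exists c; rewrite /= subr_eq0 yE.
  exact: yy'.
Qed.

End Plane.

(** * Norms on a lattice *)

Section LatticeNorm.
Variables (R : realType) (M : zmodType).

(** Subtraction in the second clause gives symmetry together with the triangle inequality.
    Homogeneity is stated for the factor of the congruence, and finiteness of balls makes minima
    exist without an ambient real vector space. *)
Definition lnorm (q : M -> R) : Prop := [/\ forall x, x != 0 -> 0 < q x,
  forall x y, q (x - y) <= q x + q y, forall x, q (x *+ 3) = 3 * q x &
  forall B, exists s : seq M, forall x, q x <= B -> x \in s].

Lemma lnorm_0 q : lnorm q -> q 0 = 0.
Proof. by case=> _ _ q3 _; have := q3 0; rewrite mul0rn; lra. Qed.

Lemma lnorm_ge0 q x : lnorm q -> 0 <= q x.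
Proof.
move=> nq; have [->|x0] := eqVneq x 0; first by rewrite (lnorm_0 nq).
by case: nq => qp _ _ _; exact/ltW/qp.
Qed.

Lemma lnorm_scale q k : 0 < k -> lnorm q -> lnorm (fun x => k * q x).
Proof.
move=> k0 [qp qB q3 qf]; split.
- by move=> x /qp; exact: mulr_gt0.
- by move=> x y; rewrite -mulrDr ler_pM2l.
- by move=> x; rewrite q3 mulrCA.
- move=> B; have [s sP] := qf (k^-1 * B); exists s => x xB; apply: sP.
  by rewrite ler_pdivlMl.
Qed.

Lemma lnorm_add q r : lnorm q -> (forall x, 0 <= r x) ->
  (forall x y, r (x - y) <= r x + r y) -> (forall x, r (x *+ 3) = 3 * r x) ->
  lnorm (fun x => q x + r x).
Proof.
move=> [qp qB q3 qf] r0 rB r3; split.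
- by move=> x /qp qx; rewrite ltr_wpDr.
- by move=> x y; rewrite addrACA lerD.
- by move=> x; rewrite q3 r3 mulrDr.
- move=> B; have [s sP] := qf B; exists s => x xB; apply: sP.
  by apply: le_trans xB; rewrite lerDl.
Qed.

Lemma lnormD q r : lnorm q -> lnorm r -> lnorm (fun x => q x + r x).
Proof.
move=> nq nr; apply: lnorm_add => //; first by move=> x; exact: lnorm_ge0.
- by case: nr.
- by case: nr.
Qed.

Lemma lnorm_delta q : lnorm q -> exists2 d, 0 < d & forall x, x != 0 -> d <= q x.
Proof.
move=> [qp _ _ qf]; have [s sP] := qf 1.
exists (\big[Num.min/1]_(x <- s | x != 0) q x).
  by apply: lt_bigmin => // x; exact: qp.
move=> x x0; have [qx|qx] := leP (q x) 1.
  by apply: ge_bigmin_seq => //; exact: sP.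
by apply: le_trans (bigmin_le_id _ _ _ _) (ltW qx).
Qed.

Lemma lnorm_argmin q (P : M -> Prop) : lnorm q -> (exists x, P x) ->
  exists x, P x /\ forall y, P y -> q x <= q y.
Proof.
move=> [_ _ _ qf] [x0 Px0]; have [s sP] := qf (q x0).
suff [x [Px xm]] : exists x, P x /\ forall y, y \in x0 :: s -> P y -> q x <= q y.
  exists x; split => // y Py; have [yx|yx] := leP (q y) (q x0).
    by apply: xm => //; rewrite inE sP // orbT.
  by apply: le_trans (ltW yx); apply: xm => //; rewrite inE eqxx.
elim: s {sP} => [|z s [x [Px xm]]].
  by exists x0; split => // y; rewrite inE => /eqP ->.
have [[Pz zx]|nz] := pselect (P z /\ q z <= q x).
  exists z; split => // y; rewrite !inE => /orP[/eqP e|/orP[/eqP -> //|ys]] Py.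
    by apply: le_trans zx _; apply: xm => //; rewrite e inE eqxx.
  by apply: le_trans zx _; apply: xm => //; rewrite inE ys orbT.
exists x; split => // y; rewrite !inE => /orP[/eqP e|/orP[/eqP e|ys]] Py.
- by apply: xm => //; rewrite e inE eqxx.
- by rewrite leNgt; apply/negP => yx; apply: nz; rewrite -e; split => //; exact: ltW.
- by apply: xm => //; rewrite inE ys orbT.
Qed.

(** Convex cones are closed under combinations with nonnegative coefficients. Terms of coefficient 0
    are dropped rather than bounded, because nothing is assumed of their [q i]. *)
Lemma comb_closed (I : eqType) (K : (M -> R) -> Prop) (s : seq I) (t : I -> R)
    (q : I -> M -> R) :
  (forall f g, K f -> K g -> K (fun x => f x + g x)) ->
  (forall k f, 0 < k -> K f -> K (fun x => k * f x)) ->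
  (forall i, i \in s -> 0 <= t i) -> (forall i, i \in s -> 0 < t i -> K (q i)) ->
  (exists2 i, i \in s & 0 < t i) -> K (fun x => \sum_(i <- s) t i * q i x).
Proof.
move=> KD KZ; elim: s => [|i s IH] t0 tK [j]; first by rewrite in_nil.
rewrite inE => js tj.
have E : (fun x => \sum_(i <- i :: s) t i * q i x) =
    (fun x => t i * q i x + \sum_(i <- s) t i * q i x).
  by apply/funext => x; rewrite big_cons.
have t0' k : k \in s -> 0 <= t k by move=> ks; apply: t0; rewrite inE ks orbT.
have tK' k : k \in s -> 0 < t k -> K (q k).
  by move=> ks; apply: tK; rewrite inE ks orbT.
have ti0 : 0 <= t i by apply: t0; rewrite inE eqxx.
have [[k ks tk]|no] := pselect (exists2 k, k \in s & 0 < t k).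
  have Ks := IH t0' tK' (ex_intro2 _ _ k ks tk).
  have [ti|ti] := eqVneq (t i) 0.
    by rewrite E ti; under eq_fun do rewrite mul0r add0r.
  have tp : 0 < t i by rewrite lt_def ti.
  by rewrite E; apply: KD => //; apply: KZ => //; apply: tK; rewrite ?inE ?eqxx.
have tz k : k \in s -> t k = 0.
  move=> ks; apply/eqP; rewrite eq_le t0' // andbT leNgt; apply/negP => tk.
  by apply: no; exists k.
have ti : 0 < t i.
  by case/orP: js => [/eqP <- //|js]; move: tj; rewrite (tz _ js) ltxx.
have tz0 x : \sum_(k <- s) t k * q k x = 0.
  by rewrite big_seq big1 // => k ks; rewrite tz // mul0r.
rewrite E; under eq_fun do rewrite tz0 addr0.
by apply: KZ => //; apply: tK; rewrite ?inE ?eqxx.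
Qed.

End LatticeNorm.

Lemma cvg_bigmin (R : realType) (T : Type) (F : set_system T) (FF : Filter F)
    (I : eqType) (s : seq I) (f : I -> T -> R) (a : I -> R) (c : T -> R) (c0 : R) :
  c @ F --> c0 -> (forall i, i \in s -> f i @ F --> a i) ->
  (fun x => \big[Num.min/c x]_(i <- s) f i x) @ F --> \big[Num.min/c0]_(i <- s) a i.
Proof.
move=> cc; elim: s => [|i s IH] fa.
  by under eq_fun do rewrite big_nil; rewrite big_nil.
under eq_fun do rewrite big_cons; rewrite big_cons.
apply: cvg_minr; first by apply: fa; rewrite inE eqxx.
by apply: IH => j js; apply: fa; rewrite inE js orbT.
Qed.

(* Sets of lattice vectors that are almost shortest for some norm form a complex:
   the nerve of a cover of the convex cone of norms by convex sets. Vectors of such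
   a set are pairwise incongruent modulo 3. *)
Section Lattice.
Variables (R : realType) (G : groupType) (M : zmodType) (a : G -> M -> M).
Hypotheses (aA : vact a) (aB : forall g x y, a g (x - y) = a g x - a g y).
Hypothesis isolated : forall g x n, (0 < n)%N -> iter n (a g) x = x -> a g x = x.
Variables (N : nat) (col : M -> 'I_N) (q0 : M -> R).
Hypothesis colP : forall x y, col x = col y -> exists z, x - y = z *+ 3.
Hypothesis nq0 : lnorm q0.
Hypothesis fixv : forall g, exists2 v, v != 0 & a g v = v.
Hypothesis stab : forall v, v != 0 -> forall (H : groupType) (i : H -> G),
  is_hom i -> injective i -> (forall h, a (i h) v = v) -> HP R H.

Let a0 g : a g 0 = 0.
Proof. by rewrite -{1}(subrr 0) aB subrr. Qed.

Let aMn g x n : a g (x *+ n) = a g x *+ n.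
Proof.
have aN y : a g (- y) = - a g y by rewrite -[- y]sub0r aB a0 sub0r.
elim: n => [|n IH]; first by rewrite !mulr0n a0.
by rewrite !mulrS -IH -{1}[x *+ n]opprK aB aN opprK.
Qed.

(** The factor [3 / 2] is matched to the modulus: if [x] and [y] are short for [q] and differ by
    [z *+ 3] with [z] nonzero, then [3 * q z <= q x + q y < 3 * q z]. Hence the number of residues
    bounds the size of a simplex. *)
Definition short_on (q : M -> R) (S : {fset M}) : Prop :=
  lnorm q /\ forall v, v \in S -> forall x, x != 0 -> q v < 3 / 2 * q x.

Definition short (S : {fset M}) : Prop :=
  [/\ S != fset0, 0 \notin S & exists q, short_on q S].

Lemma short_simplicial : simplicial short.
Proof.
split=> [S []//|S T [S0 zS [q [nq qS]]] TS T0]; split => //.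
  by apply: contra zS; exact: (fsubsetP TS).
by exists q; split => // v /(fsubsetP TS); exact: qS.
Qed.

Lemma short_dim S : short S -> (#|` S| <= N)%N.
Proof.
move=> [_ _ [q [nq qS]]].
have ci : {in S &, injective col}.
  move=> x y xS yS /colP[z xy]; apply/eqP; rewrite -subr_eq0 xy.
  have [->|z0] := eqVneq z 0; first by rewrite mul0rn.
  have := qS x xS z z0; have := qS y yS z z0.
  have [_ qB q3 _] := nq; have := qB x y; rewrite xy q3; lra.
have : uniq (map col S) by rewrite map_inj_in_uniq ?fset_uniq.
by move=> /card_uniqP; rewrite size_map => <-; rewrite -[X in (_ <= X)%N]card_ord max_card.
Qed.

Lemma lnorm_act (q : M -> R) g : lnorm q -> lnorm (q \o a g).
Proof.
move=> [qp qB q3 qf]; split => /=.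
- move=> x x0; apply: qp; apply: contra_neq x0 => e.
  by rewrite -(actK aA g x) e a0.
- by move=> x y; rewrite aB.
- by move=> x; rewrite aMn.
- move=> B; have [s sP] := qf B; exists (map (a g^-1%g) s) => x xB.
  by rewrite -(actK aA g x); apply: map_f; exact: sP.
Qed.

Lemma short_push g S : short S -> short (push a g S).
Proof.
move=> [S0 zS [q [nq qS]]]; split; first exact: (push_neq0 aA).
  by rewrite (mem_push aA) a0.
exists (q \o a g^-1%g); split; first exact: lnorm_act.
move=> v; rewrite (mem_push aA) => vS x x0; apply: qS => //.
by apply: contra_neq x0 => e; rewrite -(actVK aA g x) e a0.
Qed.

(** In a finite stable set some positive power of [g] fixes [v], and isolation removes the power. So
    a stabiliser of a simplex fixes each of its vertices. *)
Lemma finite_orbit_fixed (S : {fset M}) g v : v \in S ->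
  (forall w, w \in S -> a g w \in S) -> a g v = v.
Proof.
move=> vS gS; have it n : iter n (a g) v \in S by elim: n => //= n; exact: gS.
have : ~~ injectiveb (fun n : 'I_(size S).+1 => [` it n]%fset).
  by apply/negP => /injectiveP/leq_card; rewrite card_ord -cardfE ltnn.
move=> /injectivePn[m [n mn /(congr1 val) /= e]].
wlog lt : m n mn e / (m < n)%N.
  move=> H; have [lt|lt|eq] := ltngtP m n; first exact: (H m n).
    by apply: (H n m) => //; rewrite eq_sym.
  by move: mn; rewrite (val_inj eq) eqxx.
have ai k : injective (iter k (a g)).
  by elim: k => // k IH x y /= /(can_inj (actK aA g))/IH.
apply: (isolated (n := n - m)); first by rewrite subn_gt0.
by apply: (ai m); rewrite -iterD subnKC ?(ltnW lt).
Qed.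

Section Fixed.
Variables (H : groupType) (f : H -> G) (fM : is_hom f) (c : H) (l : seq H).
Hypothesis cl : forall x, exists2 r, r \in l & exists z, f x = f (r * zexp c z)%g.

Definition fixvec v : Prop := v != 0 /\ a (f c) v = v.

(** Finitely many representatives modulo the powers of [c] give a vector fixed by [f c] a finite
    orbit, and finite orbits are trivial. *)
Lemma fixvec_all v h : fixvec v -> a (f h) v = v.
Proof.
move=> [v0 cv]; pose S := [fset a (f r) v | r in l]%fset.
have cX n : a (f c ^+ n)%g v = v.
  by elim: n => [|n IH]; rewrite ?expg0 ?aA.1 // expgS aA.2 IH.
have cz z : a (zexp (f c) z) v = v.
  case: z => n /=; first exact: cX.
  by rewrite -{1}(cX n.+1) (actK aA).
have inS k : a (f k) v \in S.
  have [r rl [z ->]] := cl k; apply/imfsetP; exists r => //.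
  by rewrite fM (hom_zexp _ _ fM) aA.2 cz.
apply: (@finite_orbit_fixed S).
  by have := inS 1%g; rewrite (hom1 fM) aA.1.
by move=> w /imfsetP[r _ ->]; rewrite -aA.2 -fM.
Qed.

Lemma fixvec_act v h : fixvec (a (f h) v) -> fixvec v.
Proof.
move=> vf; have := fixvec_all h^-1%g vf.
by rewrite (homV fM) (actK aA) => {1}->.
Qed.

Let I : (M -> R) -> Prop := fixed_by a f.

Lemma fixvec_inv p : (forall v, ~ fixvec v -> p v = 0) -> I p.
Proof.
move=> p0 h v; have [vf|nv] := pselect (fixvec v); first by rewrite fixvec_all.
by rewrite !p0 // => /fixvec_act.
Qed.

Lemma inv_fixvec p v : cone short p -> I p -> 0 < p v -> fixvec v.
Proof.
move=> [S [S0 zS _] pS] pI pv.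
have vS : v \in S by have [_ ->] := pS v.
split; first by apply/eqP => v0; rewrite -v0 vS in zS.
apply: (finite_orbit_fixed vS) => w wS.
by have [_ ->] := pS (a (f c) w); rewrite pI; have [_ <-] := pS w.
Qed.

Lemma fixvec_ex : exists v, fixvec v.
Proof. by have [v v0 vc] := fixv (f c); exists v. Qed.

Definition almost (q : M -> R) v : Prop :=
  fixvec v /\ forall x, fixvec x -> q v < 3 / 2 * q x.

(** A norm that is under control on fixed vectors only is corrected by a multiple of the [q0]-size
    of [a (f c) x - x]. This correction vanishes on fixed vectors and is at least [d] before scaling
    elsewhere; the factor [B / d] lifts all other vectors above the bound [B] of [q] on [S]. *)
Lemma almost_short q (S : {fset M}) : lnorm q -> S != fset0 ->
  (forall v, v \in S -> almost q v) -> short S.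
Proof.
move=> nq S0 aS; split => //.
  by apply/negP => /aS[[]]; rewrite eqxx.
have [d d0 dP] := lnorm_delta nq0.
pose psi x := q0 (a (f c) x - x).
pose B := \sum_(v <- S) q v.
have B0 : 0 <= B by apply: sumr_ge0 => v _; exact: lnorm_ge0.
have qB v : v \in S -> q v <= B.
  move=> vS; rewrite /B (big_fsetD1 v) //= lerDl; apply: sumr_ge0 => w _.
  exact: lnorm_ge0.
have k0 : 0 <= B / d by rewrite divr_ge0 // ltW.
exists (fun x => q x + (B / d) * psi x); split.
  apply: lnorm_add => //=.
  - by move=> x; rewrite mulr_ge0 // /psi lnorm_ge0.
  - move=> x y; rewrite -mulrDr ler_wpM2l // /psi aB.
    have -> : a (f c) x - a (f c) y - (x - y) = (a (f c) x - x) - (a (f c) y - y).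
      by rewrite !opprD !opprK addrACA.
    by case: nq0.
  - by move=> x; rewrite /psi aMn -mulrnBl; case: nq0 => _ _ -> _; rewrite mulrCA.
move=> v vS x x0; have [vf va] := aS v vS.
rewrite {1}/psi vf.2 subrr (lnorm_0 nq0) mulr0 addr0.
have [xc|xc] := eqVneq (a (f c) x) x.
  by rewrite /psi xc subrr (lnorm_0 nq0) mulr0 addr0; apply: va.
have px : d <= psi x by apply: dP; rewrite subr_eq0.
have : B <= B / d * psi x.
  by rewrite -[leLHS](divfK (lt0r_neq0 d0)) ler_wpM2l.
have qx : 0 < q x by case: nq => ->.
have := qB v vS; lra.
Qed.

Definition argmin (q : M -> R) : M := xget (sval (cid fixvec_ex))
  [set x | fixvec x /\ forall y, fixvec y -> q x <= q y].

Definition mu (q : M -> R) : R := q (argmin q).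

Lemma argminP q : lnorm q -> fixvec (argmin q) /\ forall y, fixvec y -> mu q <= q y.
Proof.
move=> nq; have [x Hx] := lnorm_argmin nq fixvec_ex.
apply: (@xgetPex _ (sval (cid fixvec_ex))
  [set x | fixvec x /\ forall y, fixvec y -> q x <= q y]).
by exists x.
Qed.

Lemma mu_gt0 q : lnorm q -> 0 < mu q.
Proof. by move=> nq; have [[x0 _] _] := argminP nq; case: nq => ->. Qed.

(** The point of the fixed set attached to a norm, up to scaling: its support consists of the almost
    shortest fixed vectors, and it varies continuously with the norm. *)
Definition weight (q : M -> R) (v : M) : R :=
  if pselect (fixvec v) then Num.max 0 (3 / 2 * mu q - q v) else 0.

Lemma weight_ge0 q v : 0 <= weight q v.
Proof. by rewrite /weight; case: pselect => //= _; rewrite le_max lexx. Qed.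

Lemma weight_almost q v : lnorm q -> 0 < weight q v -> almost q v.
Proof.
move=> nq; rewrite /weight; case: pselect => /= [vf|_]; last by rewrite ltxx.
rewrite lt_max ltxx subr_gt0 => qv; split => // x xf; apply: (lt_le_trans qv).
by rewrite ler_pM2l ?divr_gt0 //; exact: (argminP nq).2.
Qed.

Lemma weight_argmin q : lnorm q -> 0 < weight q (argmin q).
Proof.
move=> nq; have [xf _] := argminP nq; rewrite /weight; case: pselect => //= _.
rewrite lt_max ltxx /= -/(mu q); have := mu_gt0 nq; lra.
Qed.

Lemma weight_finite q : lnorm q -> exists T : {fset M}, below T (weight q).
Proof.
move=> nq; have [_ _ _ qf] := nq; have [s sP] := qf (3 / 2 * mu q).
exists [fset x in s]%fset => v; rewrite inE /= /weight => vs.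
case: pselect => //= _; rewrite max_l // subr_le0 leNgt; apply/negP => h.
by move: vs; rewrite sP // ltW.
Qed.

Definition witness (S : {fset M}) : M -> R := xget q0 [set q | short_on q S].

Lemma witnessP S : short S -> short_on (witness S) S.
Proof.
by move=> [_ _ [q qS]]; apply: (@xgetPex _ q0 [set q | short_on q S]); exists q.
Qed.

(* [share s p S] is positive only if [S] contains all the vertices of weight at
   least 1/2, so that [centre s p] is then almost shortest at these vertices *)
Definition share (s : {fset M}) (p : M -> R) (S : {fset M}) : R :=
  (\prod_(v <- s) if v \in S then p v else Num.max 0 (1 - 2 * p v)) *
  (if `[< short S >] then 1 else 0).

Definition share_sum s p : R := \sum_(S <- fpowerset s) share s p S.

Definition centre s p (x : M) : R :=
  (share_sum s p)^-1 * \sum_(S <- fpowerset s) share s p S * witness S x.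

Section Centre.
Variables (s : {fset M}) (p : M -> R).
Hypotheses (p0 : forall v, 0 <= p v) (ps : below s p).

Lemma share_ge0 S : 0 <= share s p S.
Proof.
rewrite mulr_ge0 //; last by case: asboolP.
by apply: prodr_ge0 => v _; case: ifP => // _; rewrite le_max lexx.
Qed.

Lemma share_gt0 S : 0 < share s p S -> short S /\
  forall v, v \in s -> 1 / 2 <= p v -> v \in S.
Proof.
rewrite /share; case: asboolP => [Ss|_]; last by rewrite mulr0 ltxx.
rewrite mulr1 => h; split => // v vs pv; apply/negPn/negP => vS.
move: h; rewrite (big_fsetD1 v) //= (negbTE vS) max_l ?mul0r ?ltxx //; lra.
Qed.

(** A vertex outside the support of [p] contributes the factor 0 if it lies in [S] and 1 if not.
    Hence the averaged norm does not depend on the finite set used to compute it, and one formula is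
    valid on a whole closed simplex. *)
Lemma share_extend S t : fsubset s t -> fsubset S t ->
  share t p S = if fsubset S s then share s p S else 0.
Proof.
move=> st St; rewrite /share; have [Ss|/fsubsetPn[v vS vs]] := boolP (fsubset S s); last first.
  rewrite (big_fsetD1 v) ?(fsubsetP St) //= vS (ps vs) !mul0r //.
congr (_ * _); rewrite (big_fsetID _ (mem s)) /= [X in _ * X]big_seq [X in _ * X]big1.
  rewrite mulr1; apply: perm_big; apply: uniq_perm; rewrite ?fset_uniq //.
  by move=> v; rewrite !inE /=; have [vs|//] := boolP (v \in s); rewrite ?andbF ?andbT //; exact: (fsubsetP st).
move=> v; rewrite !inE /= => /andP[vt vs].
rewrite ifN; last by apply: contra vs; exact: (fsubsetP Ss).
by rewrite (ps vs) mulr0 subr0 max_r.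
Qed.

Lemma centre_extend t : fsubset s t -> centre t p = centre s p.
Proof.
move=> st; have key (F : {fset M} -> R) : \sum_(S <- fpowerset t) share t p S * F S =
    \sum_(S <- fpowerset s) share s p S * F S.
  rewrite (big_fsetID _ (fun S => fsubset S s)) /= [X in _ + X]big_seq [X in _ + X]big1; last first.
    move=> S; rewrite !inE /= fpowersetE => /andP[St Ss].
    by rewrite share_extend // (negbTE Ss) mul0r.
  rewrite addr0 big_seq [RHS]big_seq.
  have e : [fset x in fpowerset t | fsubset x s]%fset = fpowerset s.
    apply/fsetP => S; rewrite !inE /= !fpowersetE; apply/andP/idP => [[]//|Ss].
    by split => //; exact: fsubset_trans Ss st.
  rewrite e; apply: eq_bigr => S; rewrite fpowersetE => Ss.
  by rewrite share_extend ?Ss //; exact: fsubset_trans Ss st.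
apply/funext => x; rewrite /centre key; congr (_^-1 * _).
by have := key (fun=> 1); under eq_bigr do rewrite mulr1; under [RHS]eq_bigr do rewrite mulr1.
Qed.

Hypothesis cp : cone short p.

Lemma share_sum_gt0 : 0 < share_sum s p /\ exists2 S, S \in fpowerset s & 0 < share s p S.
Proof.
have [S XS pS] := cp; have Ss := carrier_sub pS ps.
have sS : 0 < share s p S.
  rewrite /share asboolT // mulr1; apply: prodr_gt0 => v _; have [vS|vS] := ifP.
    exact: carrier_gt0 pS vS.
  by rewrite (carrier_below pS) ?vS // mulr0 subr0 max_r.
have Sm : S \in fpowerset s by rewrite fpowersetE.
split; last by exists S.
rewrite /share_sum (big_fsetD1 S) //=; apply: ltr_wpDr => //.
by apply: sumr_ge0 => T _; exact: share_ge0.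
Qed.

Lemma centre_lnorm : lnorm (centre s p).
Proof.
have [t0 [S Sm sS]] := share_sum_gt0.
apply: lnorm_scale; first by rewrite invr_gt0.
apply: (comb_closed (K := @lnorm R M)).
- by move=> g h; exact: lnormD.
- by move=> k g; exact: lnorm_scale.
- by move=> T _; exact: share_ge0.
- by move=> T _ /share_gt0[/witnessP[]].
- by exists S.
Qed.

Lemma centre_almost v : fixvec v -> v \in s -> 1 / 2 <= p v -> almost (centre s p) v.
Proof.
move=> vf vs pv; split => // x xf.
have [t0 [S Sm sS]] := share_sum_gt0.
rewrite /centre mulrCA ltr_pM2l ?invr_gt0 //.
apply: (comb_closed (K := fun q => q v < 3 / 2 * q x)).
- by move=> g h; lra.
- by move=> k g k0 h; rewrite [ltRHS]mulrCA ltr_pM2l.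
- by move=> T _; exact: share_ge0.
- move=> T _ /share_gt0[Tsh vT]; have [_ sh] := witnessP Tsh.
  by apply: sh; [exact: vT|case: xf].
- by exists S.
Qed.

Lemma centre_ge x m : (forall S, S \in fpowerset s -> short S -> m <= witness S x) ->
  m <= centre s p x.
Proof.
move=> mS; have [t0 _] := share_sum_gt0.
rewrite /centre ler_pdivlMl // mulrC /share_sum mulr_sumr !big_seq; apply: ler_sum => S Sm.
rewrite mulrC; have [s0|s0] := eqVneq (share s p S) 0; first by rewrite s0 !mul0r.
apply: ler_wpM2l; first exact: share_ge0.
by apply: mS => //; case: (@share_gt0 S) => //; rewrite lt_def s0 share_ge0.
Qed.

Lemma centre_le x m : (forall S, S \in fpowerset s -> short S -> witness S x <= m) ->
  centre s p x <= m.
Proof.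
move=> mS; have [t0 _] := share_sum_gt0.
rewrite /centre ler_pdivrMl // mulrC /share_sum mulr_sumr !big_seq; apply: ler_sum => S Sm.
rewrite [leRHS]mulrC; have [s0|s0] := eqVneq (share s p S) 0; first by rewrite s0 !mul0r.
apply: ler_wpM2l; first exact: share_ge0.
by apply: mS => //; case: (@share_gt0 S) => //; rewrite lt_def s0 share_ge0.
Qed.

End Centre.

(** The time schedule. Up to [1 / 3] the point moves towards its coordinates above [1 / 2]; from
    there to [2 / 3] it moves to the weights of the norm [centre], and finally this norm moves to
    [q0]. The coefficients need not add up to 1, since the homotopy lives in the cone. *)
Definition c1 (t : R) : R := Num.max 0 (1 - 3 * t).
Definition c2 (t : R) : R := Num.max 0 (Num.min (3 * t) (2 - 3 * t)).
Definition c3 (t : R) : R := Num.max 0 (3 * t - 1).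
Definition c4 (t : R) : R := Num.max 0 (3 * t - 2).

Definition path_norm (s : {fset M}) (t : R) (p : M -> R) (x : M) : R :=
  (1 - c4 t) * centre s p x + c4 t * q0 x.

Definition walk (s : {fset M}) (t : R) (p : M -> R) (v : M) : R :=
  c1 t * p v + c2 t * Num.max 0 (2 * p v - 1) + c3 t * weight (path_norm s t p) v.

Lemma path_norm_lnorm s t p : (forall v, 0 <= p v) -> below s p -> cone short p ->
  0 <= t <= 1 -> lnorm (path_norm s t p).
Proof.
move=> p0 ps cp /andP[t0 t1].
have c40 : 0 <= c4 t by rewrite le_max lexx.
have c41 : c4 t <= 1 by rewrite ge_max ler01 /=; lra.
have nc := centre_lnorm p0 ps cp; rewrite /path_norm.
have [->|c4n] := eqVneq (c4 t) 0.
  by under eq_fun do rewrite subr0 mul1r mul0r addr0.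
have [->|c4m] := eqVneq (c4 t) 1.
  by under eq_fun do rewrite subrr mul0r add0r mul1r.
apply: lnormD; apply: lnorm_scale => //.
  by rewrite subr_gt0 lt_def eq_sym c4m.
by rewrite lt_def c4n.
Qed.

Definition supp (p : M -> R) : {fset M} := xget fset0 [set S | carrier p S].

Lemma suppE p S : carrier p S -> supp p = S.
Proof.
move=> pS; apply: (carrier_uniq (p := p)) => //.
by apply: (@xgetPex _ fset0 [set S | carrier p S]); exists S.
Qed.

Lemma walk_extend p s t : cone short p -> below s p ->
  walk (supp p) t p = walk s t p.
Proof.
move=> [S XS pS] ps; rewrite (suppE pS); apply/funext => v; rewrite /walk /path_norm.
by rewrite (centre_extend (carrier_below pS) (carrier_sub pS ps)).
Qed.

Lemma walk_ge0 s t p v : (forall v, 0 <= p v) -> 0 <= walk s t p v.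
Proof.
move=> p0; rewrite /walk !addr_ge0 // mulr_ge0 ?weight_ge0 // /c1 /c2 /c3 le_max lexx //.
Qed.

(** Before time [1 / 3] the support is that of [p]. Afterwards all vertices are almost shortest for
    the single norm [path_norm]: those of positive weight by the choice of the weight, the others
    because they have coordinate above [1 / 2] and are present only while the norm is still
    [centre]. *)
Lemma walk_cone s t p : below s p -> 0 <= t <= 1 -> real short p -> I p ->
  cone short (walk s t p) /\ I (walk s t p).
Proof.
move=> ps t01 Xp Ip; have cp := real_cone Xp.
have p0 v : 0 <= p v by exact: real_ge0 Xp.
have nQ := path_norm_lnorm p0 ps cp t01; have /andP[t0 t1] := t01.
have pf v : 0 < p v -> fixvec v by exact: inv_fixvec.
have W0 v : 0 <= walk s t p v by exact: walk_ge0.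
have pz v : ~ fixvec v -> p v = 0.
  move=> nv; apply/eqP; rewrite eq_le p0 andbT leNgt; apply/negP => pv; apply: nv; exact: pf.
split; last first.
  apply: fixvec_inv => v nv; rewrite /walk pz // !mulr0 sub0r max_l ?mulr0 ?lerN10 //.
  by rewrite /weight; case: pselect => //= _; rewrite mulr0 !add0r.
have [v1 pv1] : exists v, p v = 1 by case: Xp.
have [th|th] := ltP t (1 / 3).
  have c30 : c3 t = 0 by rewrite /c3 max_l //; lra.
  have c1p : 0 < c1 t by rewrite /c1 lt_max; apply/orP; right; lra.
  have c2p : 0 <= c2 t by rewrite /c2 le_max lexx.
  have [S XS pS] := cp; exists S => // v; split => //.
  rewrite /walk c30 mul0r addr0; have [_ ->] := pS v.
  have [pv|pv] := ltP 0 (p v).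
    by apply/esym/ltr_wpDr; [rewrite mulr_ge0 // le_max lexx|exact: mulr_gt0].
  have -> : p v = 0 by apply/le_anti; rewrite pv p0.
  by rewrite !mulr0 sub0r max_l ?lerN10 // mulr0 addr0 ltxx.
have c10 : c1 t = 0 by rewrite /c1 max_l //; lra.
have c30 : 0 <= c3 t by rewrite le_max lexx.
have al v : 0 < walk s t p v -> almost (path_norm s t p) v.
  have [w0|w0] := ltP 0 (weight (path_norm s t p) v).
    by move=> _; exact: weight_almost.
  have wE : weight (path_norm s t p) v = 0 by apply/le_anti; rewrite w0 weight_ge0.
  rewrite /walk c10 wE mul0r mulr0 add0r addr0 => h.
  have c2p : 0 < c2 t.
    by rewrite lt_def le_max lexx andbT; apply: contraTneq h => ->; rewrite mul0r ltxx.
  have pv : 1 / 2 < p v.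
    rewrite ltNge; apply/negP => h2; move: h; rewrite max_l ?mulr0 ?ltxx //; lra.
  have c40 : c4 t = 0.
    by move: c2p; rewrite /c2 /c4 lt_max ltxx lt_min /= => /andP[_ ?]; rewrite max_l //; lra.
  have -> : path_norm s t p = centre s p.
    by apply/funext => x; rewrite /path_norm c40 subr0 mul1r mul0r addr0.
  have pv0 : 0 < p v by lra.
  apply: (centre_almost p0 ps cp (pf _ pv0)); last exact: ltW.
  by apply: contraLR pv0 => /ps ->; rewrite ltxx.
have [T Tb] : exists T : {fset M}, below T (walk s t p).
  have [T Tb] := weight_finite nQ; exists (T `|` s)%fset => v; rewrite inE negb_or => /andP[vT vs].
  by rewrite /walk (Tb v vT) (ps v vs) !mulr0 sub0r max_l ?lerN10 // mulr0 !addr0.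
have cW := below_carrier Tb W0.
eexists; last exact: cW.
apply: (almost_short nQ); last by move=> v; have [_ ->] := cW v; exact: al.
(* At time [1 / 3] exactly both [c1] and [c3] vanish, and the support is nonempty thanks to a vertex
   of coordinate 1. *)
apply/fset0Pn; have [t3|t3] := eqVneq t (1 / 3).
  exists v1; have [_ ->] := cW v1; rewrite /walk pv1 t3.
  have -> : c2 (1 / 3) = 1 by rewrite /c2 max_r; [rewrite min_l; lra|rewrite le_min; apply/andP; split; lra].
  have -> : c3 (1 / 3) = 0 by rewrite /c3 max_l //; lra.
  have -> : c1 (1 / 3) = 0 by rewrite /c1 max_l //; lra.
  by rewrite mul0r mul0r add0r addr0 mul1r lt_max; apply/orP; right; lra.
exists (argmin (path_norm s t p)); have [_ ->] := cW (argmin (path_norm s t p)).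
have th' : 1 / 3 < t by rewrite lt_def t3.
rewrite /walk; apply: ltr_wpDl.
  by rewrite addr_ge0 // mulr_ge0 // /c1 /c2 le_max lexx.
apply: mulr_gt0; last exact: weight_argmin.
by rewrite /c3 lt_max; apply/orP; right; lra.
Qed.

Lemma contr_short : contr short I.
Proof.
have c0E : [/\ c1 0 = 1, c2 0 = 0 & c3 0 = 0].
  by split; rewrite /c1 /c2 /c3 mulr0 ?subr0 ?sub0r; [rewrite max_r| rewrite min_l ?maxxx|rewrite max_l ?lerN10].
have c1E : [/\ c1 1 = 0, c2 1 = 0, c3 1 = 2 & c4 1 = 1].
  split.
  - by rewrite /c1 max_l //; lra.
  - by rewrite /c2 max_l // ge_min; apply/orP; right; lra.
  - by rewrite /c3 max_r; lra.
  - by rewrite /c4 max_r; lra.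
have wq0 : cone short (fun v => 2 * weight q0 v) /\ I (fun v => 2 * weight q0 v).
  split; last first.
    by apply: fixvec_inv => v nv; rewrite /weight; case: pselect => //= _; rewrite mulr0.
  apply: cone_scale => //.
  have [T Tb] := weight_finite nq0; have cW := below_carrier Tb (weight_ge0 q0).
  eexists; last exact: cW.
  apply: (almost_short nq0).
    by apply/fset0Pn; exists (argmin q0); have [_ ->] := cW (argmin q0); exact: weight_argmin.
  by move=> v; have [_ ->] := cW v; exact: weight_almost.
apply: (@contr_cone _ _ _ _ (fun t p => walk (supp p) t p) (fun v => 2 * weight q0 v)).
- exact: short_simplicial.
- by move=> k p _ pI h v; rewrite pI.
- exact: wq0.1.
- exact: wq0.2.
- move=> t p t01 Xp Ip; apply: walk_cone => //.
  by have [S _ pS] := real_cone Xp; rewrite (suppE pS); exact: carrier_below.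
- move=> p Xp Ip; have [e1 e2 e3] := c0E; apply/funext => v.
  by rewrite /walk e1 e2 e3 !mul0r !addr0 mul1r.
- move=> p Xp Ip; have [e1 e2 e3 e4] := c1E; apply/funext => v.
  rewrite /walk e1 e2 e3 !mul0r !add0r; congr (_ * weight _ _).
  by apply/funext => x; rewrite /path_norm e4 subrr mul0r add0r mul1r.
move=> s Xs.
(* All norms met over the simplex [s] are averages of the finite list [Q]. At the fixed vector [vx]
   they are at most [B], outside [T] at least [3 / 2 * B]. So no vector outside [T] has positive
   weight, and the minimum [mu] is a minimum over a finite set, hence continuous. *)
pose Q := q0 :: [seq witness U | U <- [seq U <- fpowerset s | `[< short U >]]].
have Qn q : q \in Q -> lnorm q.
  rewrite inE => /orP[/eqP -> //|/mapP[S]].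
  by rewrite mem_filter => /andP[/asboolP/witnessP[nS _] _] ->.
have QS S : S \in fpowerset s -> short S -> witness S \in Q.
  move=> Sm XS; rewrite inE; apply/orP; right; apply: map_f.
  by rewrite mem_filter Sm andbT; apply/asboolP.
have [vx vxf] := fixvec_ex.
pose B := \sum_(q <- Q) q vx.
have Bq q : q \in Q -> q vx <= B.
  move=> qQ; rewrite /B (big_rem q qQ) lerDl big_seq; apply: sumr_ge0 => r rQ.
  exact/lnorm_ge0/Qn/(mem_rem rQ).
have q0Q : q0 \in Q by rewrite inE eqxx.
have Bp : 0 < B.
  by apply: lt_le_trans (Bq _ q0Q); case: nq0 => h _ _ _; apply: h; case: vxf.
have [T TP] : exists T : seq M, forall q x, q \in Q -> q x <= 3 / 2 * B -> x \in T.
  elim: (Q) Qn => [_|q r IH nr]; first by exists [::].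
  have [|T TP] := IH; first by move=> q' q'r; apply: nr; rewrite inE q'r orbT.
  have [_ _ _ qf] := nr q (mem_head _ _); have [T' T'P] := qf (3 / 2 * B).
  exists (T' ++ T) => q' x; rewrite inE mem_cat => /orP[/eqP ->|q'r] h.
    by rewrite T'P.
  by rewrite (TP q' x) ?orbT.
have QT t p x : dom short I s t p -> x \notin T -> 3 / 2 * B <= path_norm s t p x.
  move=> [/andP[t0 t1] Xp Ip ps] xT.
  have far q : q \in Q -> 3 / 2 * B <= q x.
    by move=> qQ; rewrite leNgt; apply: contra xT => /ltW; exact: TP.
  have c40 : 0 <= c4 t by rewrite le_max lexx.
  have c41 : c4 t <= 1 by rewrite ge_max ler01 /=; lra.
  have h1 : 3 / 2 * B <= centre s p x.
    apply: (centre_ge _ ps (real_cone Xp)) => [v|S Sm XS]; first exact: real_ge0 Xp.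
    by apply: far; exact: QS.
  have h2 := far _ q0Q; rewrite /path_norm; nra.
have Qv t p : dom short I s t p -> path_norm s t p vx <= B.
  move=> [/andP[t0 t1] Xp Ip ps].
  have c40 : 0 <= c4 t by rewrite le_max lexx.
  have c41 : c4 t <= 1 by rewrite ge_max ler01 /=; lra.
  have h1 : centre s p vx <= B.
    apply: (centre_le _ ps (real_cone Xp)) => [v|S Sm XS]; first exact: real_ge0 Xp.
    by apply: Bq; exact: QS.
  have h2 := Bq _ q0Q; rewrite /path_norm; nra.
have lnQ t p : dom short I s t p -> lnorm (path_norm s t p).
  move=> [t01 Xp Ip ps]; apply: path_norm_lnorm => //; last exact: real_cone.
  by move=> v; exact: real_ge0 Xp.
have muE t p : dom short I s t p -> mu (path_norm s t p) =
    \big[Num.min/path_norm s t p vx]_(x <- [seq x <- T | `[< fixvec x >]]) path_norm s t p x.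
  move=> D; have nQ := lnQ _ _ D; have [af am] := argminP nQ.
  have mv : mu (path_norm s t p) <= B by apply: le_trans (Qv _ _ D); exact: am.
  have aT : argmin (path_norm s t p) \in T.
    apply: contraTT mv => /(QT _ _ _ D); rewrite -/(mu (path_norm s t p)) -ltNge => h.
    by apply: lt_le_trans h; lra.
  rewrite big_filter; apply/le_anti/andP; split.
    by apply: le_bigmin => [|x /asboolP]; exact: am.
  by apply: ge_bigmin_seq => //; apply/asboolP.
exists ([fset x in T] `|` s)%fset => [t p D v|].
  have [t01 Xp Ip ps] := D; rewrite !inE negb_or => /andP[vT vs].
  rewrite (walk_extend _ (real_cone Xp) ps) /walk ps // !mulr0 sub0r max_l ?lerN10 // mulr0 !add0r.
  rewrite /weight; case: pselect => /= _; last by rewrite mulr0.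
  have h1 := QT _ _ _ D vT; have [_ am] := argminP (lnQ _ _ D).
  have h2 := le_trans (am _ vxf) (Qv _ _ D).
  by rewrite max_l ?mulr0 // subr_le0 (le_trans _ h1) // ler_pM2l // divr_gt0.
move=> F FF t0 p0 D0 FD Ft Fp v.
have E t p : dom short I s t p -> walk (supp p) t p = walk s t p.
  by move=> [_ Xp _ ps]; apply: walk_extend => //; exact: real_cone.
rewrite E //; suff : (fun x => walk s x.1 x.2 v) @ F --> walk s t0 p0 v.
  apply: cvg_trans; apply: near_eq_cvg; apply: filterS FD => x Dx.
  by rewrite /= E.
have cst (k : R) : (fun=> k) @ F --> k by exact: cvg_cst.
have F3 : (fun x : R * (M -> R) => 3 * x.1) @ F --> 3 * t0 by exact: cvgM.
have Fc1 : (fun x : R * (M -> R) => c1 x.1) @ F --> c1 t0.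
  by apply: cvg_maxr => //; exact: cvgB.
have Fc2 : (fun x : R * (M -> R) => c2 x.1) @ F --> c2 t0.
  by apply: cvg_maxr => //; apply: cvg_minr => //; exact: cvgB.
have Fc3 : (fun x : R * (M -> R) => c3 x.1) @ F --> c3 t0.
  by apply: cvg_maxr => //; exact: cvgB.
have Fc4 : (fun x : R * (M -> R) => c4 x.1) @ F --> c4 t0.
  by apply: cvg_maxr => //; exact: cvgB.
have Fshare S : (fun x : R * (M -> R) => share s x.2 S) @ F --> share s p0 S.
  apply: cvgM => //; apply: cvg_bigprod => w _; case: ifP => // _.
  by apply: cvg_maxr => //; apply: cvgB => //; exact: cvgM.
have Fcentre w : (fun x : R * (M -> R) => centre s x.2 w) @ F --> centre s p0 w.
  apply: cvgM.
    apply: cvgV; last by apply: cvg_bigsum => S _; exact: Fshare.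
    have [_ Xp _ ps] := D0; have [|h _] := share_sum_gt0 _ ps (real_cone Xp).
      by move=> u; exact: real_ge0 Xp.
    by rewrite gt_eqF.
  by apply: cvg_bigsum => S _; apply: cvgM.
have Fpath w : (fun x => path_norm s x.1 x.2 w) @ F --> path_norm s t0 p0 w.
  by apply: cvgD; apply: cvgM => //; exact: cvgB.
apply: cvgD; first apply: cvgD; apply: cvgM => //.
  by apply: cvg_maxr => //; apply: cvgB => //; exact: cvgM.
rewrite /weight; case: pselect => //= _; apply: cvg_maxr => //; apply: cvgB => //.
apply: cvgM => //; rewrite muE //.
suff : (fun x => \big[Num.min/path_norm s x.1 x.2 vx]_(w <- [seq x <- T | `[< fixvec x >]])
    path_norm s x.1 x.2 w) @ F --> 
    \big[Num.min/path_norm s t0 p0 vx]_(w <- [seq x <- T | `[< fixvec x >]]) path_norm s t0 p0 w.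
  apply: cvg_trans; apply: near_eq_cvg; apply: filterS FD => x Dx.
  by rewrite /= muE.
by apply: cvg_bigmin => // w _; exact: Fpath.
Qed.

End Fixed.

Lemma HP_lattice : HP R G.
Proof.
apply: (@HP_step R G M short a N).
- exact: short_simplicial.
- exact: short_dim.
- exact: aA.
- exact: short_push.
- move=> S [/fset0Pn[v vS] zS _] H f fM fI fS.
  apply: (stab (v := v)) fM fI _; first by apply: contraNneq zS => <-.
  move=> h; apply: (finite_orbit_fixed vS) => w wS.
  by rewrite -(fS h) (mem_push aA) (actK aA).
- move=> H f fM [c [l cl]]; exact: (contr_short fM cl).
Qed.

End Lattice.

(** * Subgroups of lattices *)

Lemma mxMz (T : zmodType) m n (u : 'M[T]_(m, n)) (k : int) i j :
  (u *~ k) i j = u i j *~ k.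
Proof.
have E l : (u *+ l) i j = u i j *+ l.
  by elim: l => [|l IH]; rewrite ?mulr0n ?mxE // !mulrS mxE IH.
by case: k => l /=; rewrite ?NegzE ?mulrNz ?mxE -?pmulrn E.
Qed.

Lemma row0E (T : Type) k (u : 'rV[T]_(1 + k)) : u 0 0 = lsubmx u 0 0.
Proof. by rewrite mxE; congr (u _ _); apply/val_inj. Qed.

Lemma additive_ex (U V : zmodType) (f : U -> V) :
  (forall x y, f (x - y) = f x - f y) -> exists e : {additive U -> V}, e =1 f.
Proof.
move=> fB; pose m := GRing.isZmodMorphism.Build U V f fB.
by exists (HB.pack f m : {additive U -> V}).
Qed.

Section Span.
Variable V : zmodType.
Implicit Types (A : V -> Prop) (w : seq V).

Fixpoint zspan w (x : V) : Prop :=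
  if w is y :: w' then exists k s, zspan w' s /\ x = y *~ k + s else x = 0.

Definition subzmod A : Prop := A 0 /\ forall x y, A x -> A y -> A (x - y).

Lemma subzmodN A x : subzmod A -> A x -> A (- x).
Proof. by move=> [A0 AB] Ax; rewrite -sub0r; exact: AB. Qed.

Lemma subzmodD A x y : subzmod A -> A x -> A y -> A (x + y).
Proof. by move=> sA Ax Ay; rewrite -[y]opprK; apply: sA.2 => //; exact: subzmodN. Qed.

Lemma subzmodMz A x k : subzmod A -> A x -> A (x *~ k).
Proof.
move=> sA Ax; have An n : A (x *+ n).
  by elim: n => [|n IH]; [exact: sA.1|rewrite mulrS; exact: subzmodD].
by case: k => n; [exact: An|exact: (subzmodN sA (An n.+1))].
Qed.

Lemma zspan_subzmod w : subzmod (zspan w).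
Proof.
elim: w => [|y w [w0 wB]]; first by split => [//|x y -> ->]; rewrite subr0.
split; first by exists 0, 0; rewrite mulr0z addr0.
move=> _ _ [k [s [ws ->]]] [l [t [wt ->]]]; exists (k - l), (s - t).
by split; [exact: wB|rewrite mulrzBr opprD addrACA].
Qed.

Lemma zspan_mem w x : x \in w -> zspan w x.
Proof.
elim: w => // y w IH; rewrite inE => /orP[/eqP ->|/IH wx].
  by exists 1, 0; split; [exact: (zspan_subzmod w).1|rewrite addr0].
by exists 0, x; rewrite mulr0z add0r.
Qed.

Lemma zspan_sub w A x : subzmod A -> (forall y, y \in w -> A y) -> zspan w x -> A x.
Proof.
move=> sA; elim: w x => [x _ ->|y w IH x Aw [k [s [ws ->]]]]; first by case: sA.
apply: subzmodD => //; first by apply: subzmodMz => //; apply: Aw; rewrite mem_head.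
by apply: IH => // z zw; apply: Aw; rewrite inE zw orbT.
Qed.

Definition parametrised A k : Prop := exists e : {additive 'rV[int]_k -> V},
  injective e /\ forall x, A x <-> exists u, x = e u.

Lemma add_coord k (e : {additive 'rV[int]_k -> V}) (t : V) :
  injective e -> (forall m u, t *~ m = e u -> m = 0) ->
  exists2 e' : {additive 'rV[int]_(1 + k) -> V}, injective e' &
    forall u, e' u = t *~ u 0 0 + e (rsubmx u).
Proof.
move=> ei et; pose f (u : 'rV[int]_(1 + k)) : V := t *~ u 0 0 + e (rsubmx u).
have fB u v : f (u - v) = f u - f v.
  rewrite /f !mxE mulrzBr opprD addrACA; congr (_ + _).
  by rewrite -raddfB; congr (e _); apply/rowP => i; rewrite !mxE.
have [e' e'E] := additive_ex fB; exists e' => //.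
apply: raddf_inj => u; rewrite e'E /f => /eqP; rewrite addr_eq0 -raddfN => /eqP h.
have u0 := et _ _ h; have := h; rewrite u0 mulr0z => /esym/eqP.
rewrite raddfN oppr_eq0 => /eqP eu.
have ru : rsubmx u = 0 by apply: ei; rewrite eu raddf0.
apply/rowP => i; rewrite mxE; case: (split_ordP i) => j ->.
  by rewrite (ord1 j) -[RHS]u0 row0E mxE.
by have /rowP/(_ j) := ru; rewrite !mxE.
Qed.

(** Subgroups of a free abelian group of finite rank are free: intersect with the kernel of the
    first coordinate, and adjoin an element [t] whose first coordinate has the least nonzero
    absolute value. *)
Lemma parametrised_sub K : forall (e : {additive 'rV[int]_K -> V}) A, injective e ->
  subzmod A -> (forall x, A x -> exists u, x = e u) ->
  exists2 k, (k <= K)%N & parametrised A k.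
Proof.
elim: K => [|K IH]; [|rewrite -[K.+1]/(1 + K)%N]; move=> e A ei sA Ae.
  exists 0%N => //; exists e; split => // x; split=> [/Ae//|[u ->]].
  by rewrite [u](_ : _ = 0) ?raddf0; [exact: sA.1|exact: thinmx0].
pose f0 (u : 'rV[int]_K) := e (row_mx (0 : 'rV_1) u).
have f0B u v : f0 (u - v) = f0 u - f0 v.
  by rewrite /f0 -[RHS]raddfB opp_row_mx add_row_mx subrr.
have [f fE] := additive_ex f0B.
have fi : injective f.
  by move=> u v; rewrite !fE => /ei/eq_row_mx[].
pose A' x := A x /\ exists u, x = f u.
have [|x []//|k kK [g [gi gA]]] := IH f A' fi.
  split; first by split; [exact: sA.1|exists 0; rewrite raddf0].
  move=> x y [Ax xu] [Ay yv]; split; first exact: sA.2.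
  by have [[u ->] [v ->]] := (xu, yv); exists (u - v); rewrite raddfB.
have e0 (u : 'rV[int]_(1 + K)) : u 0 0 = 0 -> e u = f (rsubmx u).
  move=> u0; rewrite fE /f0 -{1}[u]hsubmxK; congr (e (row_mx _ _)).
  by apply/rowP => i; rewrite (ord1 i) -row0E u0 mxE.
have [Az|/existsNP[x1 /not_implyP[Ax1 n1]]] := pselect (forall x, A x -> A' x).
  exists k; first exact: leqW.
  by exists g; split => // x; rewrite -gA; split => [/Az//|[]].
pose Q n := `[< exists u : 'rV[int]_(1 + K), A (e u) /\ absz (u 0 0) = n.+1 >].
have exQ : exists n, Q n.
  have [u xu] := Ae x1 Ax1; exists (absz (u 0 0)).-1; apply/asboolP; exists u.
  have un : u 0 0 != 0.
    by apply/eqP => u0; apply: n1; split => //; exists (rsubmx u); rewrite xu e0.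
  by rewrite -xu prednK ?absz_gt0.
case: (ex_minnP exQ) => n /asboolP[t [At tn]] nmin.
have t0 : t 0 0 != 0 by rewrite -absz_eq0 tn.
have fl u : exists2 z : 'rV[int]_(1 + K), f u = e z & z 0 0 = 0.
  by exists (row_mx 0 u); [exact: fE|rewrite row0E row_mxKl mxE].
have gl u : exists2 z : 'rV[int]_(1 + K), g u = e z & z 0 0 = 0.
  have [_ [v ->]] : A' (g u) by apply/gA; exists u.
  exact: fl.
have [|g' g'i g'E] := @add_coord k g (e t) gi.
  move=> m u; have [z -> z0] := gl u; rewrite -raddfMz => /ei/rowP/(_ 0).
  rewrite z0 mxMz.
  by move=> /eqP; rewrite mulrz_eq0 (negbTE t0) orbF => /eqP.
have tA : A (e t) by [].
exists (1 + k)%N; first exact: kK.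
exists g'; split => // x; split => [Ax|[u ->]]; last first.
  rewrite g'E; apply: subzmodD => //; first exact: subzmodMz.
  by have [] : A' (g (rsubmx u)) by apply/gA; exists (rsubmx u).
have [z xz] := Ae x Ax.
pose q := divz (z 0 0) (t 0 0).
have Ay : A (x - e t *~ q) by apply: sA.2 => //; exact: subzmodMz.
have xE : x - e t *~ q = e (z - t *~ q) by rewrite xz raddfB raddfMz.
have z0 : (z - t *~ q) 0 0 = modz (z 0 0) (t 0 0).
  by rewrite /modz mxE [X in _ + X]mxE mxMz mulrzz /q mulrC.
have [r0|r0] := eqVneq (modz (z 0 0) (t 0 0)) 0.
  have [v gv] : exists v, x - e t *~ q = g v.
    by apply/gA; split => //; exists (rsubmx (z - t *~ q)); rewrite xE e0 // z0.
  exists (row_mx q%:M v); rewrite g'E row_mxKr row0E row_mxKl mxE eqxx mulr1n -gv.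
  by rewrite addrC subrK.
pose y := (z - t *~ q) 0 0.
have : (n <= (absz y).-1)%N.
  apply: nmin; apply/asboolP; exists (z - t *~ q); rewrite -xE prednK ?absz_gt0 //.
  by rewrite -/y /y z0.
rewrite /y z0; have := ltz_mod (z 0 0) t0; have := modz_ge0 (z 0 0) t0.
move: r0 tn; lia.
Qed.

Hypothesis tf : forall (x : V) n, (0 < n)%N -> x *+ n = 0 -> x = 0.

(** Some multiple [N] of the span lies in a free group: a generator with a multiple in the free
    group built so far enlarges [N], any other generator enlarges the rank. Without torsion,
    multiplication by [N] identifies [A] with a subgroup of that free group. *)
Lemma parametrised_fg w A : subzmod A -> (forall x, A x -> zspan w x) ->
  exists k, parametrised A k.
Proof.
move=> sA Aw.
have [K [e [N [ei N0 we]]]] : exists K (e : {additive 'rV[int]_K -> V}) N,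
    [/\ injective e, (0 < N)%N & forall x, zspan w x -> exists u, x *+ N = e u].
  elim: (w) => [|y w' [K [e [N [ei N0 we]]]]].
    have [e eE] := @additive_ex 'rV[int]_0 V (fun=> 0) (fun _ _ => esym (subrr 0)).
    exists 0%N, e, 1%N; split => // [u v _|x ->]; first exact: (etrans (thinmx0 u) (esym (thinmx0 v))).
    by exists 0; rewrite eE.
  have [[m [u [m0 yu]]]|no] := pselect (exists m u, (0 < m)%N /\ y *+ m = e u).
    exists K, e, (N * m)%N; split => //; first by rewrite muln_gt0 N0.
    move=> _ [k [s [/we[v sv] ->]]]; exists (u *~ (k * N%:Z) + v *+ m).
    rewrite raddfD raddfMz raddfMn -yu -sv mulrnDl -mulrnA; congr (_ + _).
    by rewrite !pmulrn -!mulrzA; congr (_ *~ _); rewrite PoszM; ring.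
  have [|e' e'i e'E] := @add_coord K e y ei.
    move=> m u h; apply: contrapT => /eqP m0; apply: no.
    exists `|m|%N, (u *~ Num.sg m); rewrite absz_gt0 raddfMz -h -mulrzA; split => //.
    by rewrite (pmulrn y) abszE normrEsg mulrC.
  exists (1 + K)%N, e', N; split => // _ [k [s [/we[v sv] ->]]].
  exists (row_mx (k * N%:Z)%:M v); rewrite e'E row_mxKr row0E row_mxKl mxE eqxx mulr1n.
  by rewrite mulrnDl sv mulrzA.
have tfB (x y : V) : x *+ N = y *+ N -> x = y.
  move=> h; apply/eqP; rewrite -subr_eq0; apply/eqP; apply: (tf N0).
  by rewrite mulrnBl h subrr.
pose B z := exists2 x, A x & z = x *+ N.
have sB : subzmod B.
  split; first by exists 0; [exact: sA.1|rewrite mul0rn].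
  by move=> _ _ [x Ax ->] [y Ay ->]; exists (x - y); [exact: sA.2|rewrite mulrnBl].
have [|k _ [f [fi fB]]] := parametrised_sub ei sB.
  by move=> _ [x /Aw/we[u xu] ->]; exists u.
have fx u : exists x, A x /\ f u = x *+ N.
  by have [x Ax xE] : B (f u); [apply/fB; exists u|exists x].
pose g0 u := sval (cid (fx u)).
have g0P u : A (g0 u) /\ f u = g0 u *+ N by exact: svalP (cid (fx u)).
have [|g gE] := @additive_ex 'rV[int]_k V g0.
  by move=> u v; apply: tfB; rewrite mulrnBl -!(g0P _).2 raddfB.
exists k, g; split => [u v /(congr1 (fun x => x *+ N))|x].
  by rewrite !gE -!(g0P _).2 => /fi.
split=> [Ax|[u ->]]; last by rewrite gE; exact: (g0P u).1.
have [u xu] : exists u, x *+ N = f u by apply/fB; exists x.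
by exists u; apply: tfB; rewrite xu gE (g0P u).2.
Qed.

End Span.

(** * Automorphisms congruent to 1 modulo 3 *)

Section IntRow.
Variables (R : realType) (k : nat).

Definition l1 (x : 'rV[int]_k) : R := \sum_i `|x 0 i|%:~R.

Lemma lnorm_l1 : lnorm l1.
Proof.
split.
- move=> x x0; have [i xi] : exists i, x 0 i != 0.
    apply: contrapT => no; move/eqP: x0; apply; apply/rowP => i; rewrite mxE.
    by apply: contrapT => /eqP xi; apply: no; exists i.
  rewrite /l1 (bigD1 i) //=; apply: ltr_wpDr.
    by apply: sumr_ge0 => j _; rewrite ler0z.
  by rewrite ltr0z normr_gt0.
- move=> x y; rewrite /l1 -big_split; apply: ler_sum => i _ /=.
  by rewrite -intrD ler_int !mxE ler_normB.
- move=> x; rewrite /l1 mulr_sumr; apply: eq_bigr => i _.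
  by rewrite mulmxnE normrMn -[_ *+ 3]mulr_natl intrM.
- move=> B; have [n Bn] : exists n : nat, B < n%:R.
    by exists (Num.truncn B).+1; exact: truncnS_gt.
  pose s := [seq \row_i ((f i : nat)%:Z - n%:Z) | f : {ffun 'I_k -> 'I_(n + n).+1}].
  exists s => x xB.
  have xi i : (absz (x 0%R i) <= n)%N.
    have : `|x 0 i|%:~R < n%:R :> R.
      apply: le_lt_trans Bn; apply: le_trans xB; rewrite /l1 (bigD1 i) //= lerDl.
      by apply: sumr_ge0 => j _; rewrite ler0z.
    by rewrite -[n%:R]/((n : int)%:~R) ltr_int; lia.
  have fP i : (absz (x 0 i + n%:Z)%R < (n + n).+1)%N by have := xi i; lia.
  apply/mapP; exists [ffun i => Ordinal (fP i)]; first by rewrite mem_enum.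
  apply/rowP => i; rewrite mxE ffunE /=; have := xi i.
  by move: (x 0 i : int) => c cn; rewrite abszE ger0_norm; lia.
Qed.

Definition residue (x : 'rV[int]_k) : 'I_#|{ffun 'I_k -> 'I_3}| :=
  enum_rank [ffun i => inord (absz (modz (x 0 i) 3)) : 'I_3].

Lemma residueP x y : residue x = residue y -> exists z, x - y = z *+ 3.
Proof.
move=> /enum_rank_inj/ffunP e; exists (\row_i divz (x 0 i - y 0 i) 3).
apply/rowP => i; rewrite mulmxnE !mxE; have := e i; rewrite !ffunE => /(congr1 val) /=.
have m3 (z : int) : (absz (modz z 3) < 3)%N by have := ltz_pmod z (isT : 0 < 3 :> int); have := modz_ge0 z (isT : 3 != 0 :> int); lia.
by rewrite !inordK //; have := modz_ge0 (x 0 i) (isT : 3 != 0 :> int); have := modz_ge0 (y 0 i) (isT : 3 != 0 :> int); lia.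
Qed.

Section Net.
Variable A : {additive 'rV[int]_k -> 'rV[int]_k}.
Hypothesis A3 : forall x, exists z, A x - x = z *+ 3.

Let fixit j x : Prop := iter j A x = x.
Let dv m (x : 'rV[int]_k) : Prop := exists y, x = y *+ (3 ^ m)%N.

Let mulI n (x y : 'rV[int]_k) : (0 < n)%N -> x *+ n = y *+ n -> x = y.
Proof.
move=> n0 /rowP e; apply/rowP => i; have := e i; rewrite !mulmxnE => /eqP.
by rewrite eqrMn2r gtn_eqF // => /eqP.
Qed.

Let dvD m x y : dv m x -> dv m y -> dv m (x + y).
Proof. by move=> [u ->] [v ->]; exists (u + v); rewrite mulrnDl. Qed.

Let dvMn m x n : dv m x -> dv m (x *+ n).
Proof. by move=> [u ->]; exists (u *+ n); rewrite -!mulrnA mulnC. Qed.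

Let dvN m x : dv m (- x) -> dv m x.
Proof. by move=> [u e]; exists (- u); rewrite mulNrn -e opprK. Qed.

Let dvA m x : dv m x -> dv m (A x).
Proof. by move=> [u ->]; exists (A u); rewrite raddfMn. Qed.

Let dv_gauss m n x : coprime (3 ^ m) n -> dv m (x *+ n) -> dv m x.
Proof.
move=> cn [y e]; exists (\row_i divz (x 0 i) (3 ^ m)%N).
apply/rowP => i; rewrite mulmxnE mxE.
pose c := x 0 i; rewrite -/c.
have : ((3 ^ m)%N %| c)%Z.
  rewrite -(@Gauss_dvdzl _ c n) // /c; apply/dvdzP; exists (y 0 i).
  by move/rowP: e => /(_ i); rewrite !mulmxnE => e; rewrite -[n%:Z]natz mulr_natr e -mulr_natr natz.
by move=> /divzK {1}<-; rewrite -[LHS]/(_ * (3 ^ m)%:Z) -[(3 ^ m)%:Z]natz mulr_natr.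
Qed.

Let dv_all x : (forall m, (0 < m)%N -> dv m x) -> x = 0.
Proof.
move=> dx; apply/rowP => i; rewrite mxE; apply/eqP; rewrite -absz_eq0 -leqn0 leqNgt.
apply/negP => xi; have [y /rowP/(_ i)] := dx _ xi.
rewrite mulmxnE -mulr_natr natz => /(congr1 absz); rewrite abszM /=.
have := ltn_expl (absz (x 0%R i)) (isT : (1 < 3)%N).
move: (absz (x 0 i)) (absz (y 0 i)) xi => c d c0.
by case: d => [|d]; [rewrite mul0n|rewrite mulSn]; lia.
Qed.

Let quot j m x : fixit j x -> dv m x -> exists2 y, fixit j y & x = y *+ (3 ^ m)%N.
Proof.
move=> fx [y xy]; exists y => //; apply: (@mulI (3 ^ m)%N); first by rewrite expn_gt0.
by rewrite -xy -[RHS]fx xy; elim: (j) => //= i <-; rewrite raddfMn.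
Qed.

Let fixit_N j x : fixit j x -> fixit j (A x - x).
Proof.
have iB i y z : iter i A (y - z) = iter i A y - iter i A z.
  by elim: i => //= i ->; rewrite raddfB.
by rewrite /fixit iB -iterSr iterS => ->.
Qed.

Let NN j m x : (forall y, fixit j y -> dv m (A y - y)) -> fixit j x ->
  dv (m + m) (A (A x - x) - (A x - x)).
Proof.
move=> H fx; have [y fy ->] := quot (fixit_N fx) (H x fx).
rewrite raddfMn -mulrnBl; have [z ->] := H y fy; exists z.
by rewrite -mulrnA -expnD.
Qed.

(** Write [A = 1 + N]. On the fixed points of the [j]-th power of [A], [N] is divisible by [3 ^ m]
    and its square by [3 ^ (m + m)], so the binomial expansion makes [j N] divisible by the latter.
    For [j = 3] the expansion reads [3 N + 3 N^2 + N^3 = 0], and as [m] is positive the cube is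
    divisible by one more factor 3, which pays for the division. *)
Let net_step j m : (0 < m)%N -> coprime 3 j || (j == 3) ->
  (forall y, fixit j y -> dv m (A y - y)) -> forall x, fixit j x -> dv (m + m) (A x - x).
Proof.
move=> m0 /orP[cj|/eqP ->] H x fx.
  have [r rd e] : exists2 r, dv (m + m) r & iter j A x = x + (A x - x) *+ j + r.
    elim: (j) => [|i [r rd IH]]; first by exists 0; rewrite ?addr0 //; exists 0; rewrite mul0rn.
    exists ((A (A x - x) - (A x - x)) *+ i + A r).
      by apply: dvD; [apply: dvMn; exact: NN fx|exact: dvA].
    rewrite iterS IH 2!raddfD raddfMn !raddfB /=.
    by apply/rowP => t; rewrite !(mulmxnE, mxE) mulrS; ring.
  apply: (@dv_gauss _ j); first exact: coprimeXl.
  apply: dvN; move: e; rewrite fx -addrA => /eqP.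
  by rewrite -subr_eq0 opprD addrA subrr sub0r oppr_eq0 addr_eq0 => /eqP ->; rewrite opprK.
have [y2 e2] := NN H fx.
have [y fy ey] := quot (fixit_N fx) (H x fx).
have [z ez] := NN H fy.
pose N1 := A x - x; pose N2 := A N1 - N1; pose N3 := A N2 - N2.
have e3 : N3 = (z *+ (3 ^ m.-1)%N) *+ (3 ^ (m + m).+1)%N.
  have N2E : N2 = (A y - y) *+ (3 ^ m)%N by rewrite /N2 /N1 ey raddfMn mulrnBl.
  rewrite /N3 N2E raddfMn -mulrnBl ez -!mulrnA; congr (_ *+ _).
  by rewrite -!expnD; congr (_ ^ _)%N; lia.
have gen (a b c d : 'rV[int]_k) : d + a + (a + b) + (a + b + (b + c)) = d ->
    a *+ 3 + b *+ 3 + c = 0.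
  move=> /rowP h; apply/rowP => i; have := h i; rewrite !(mulmxnE, mxE); lia.
have e : N1 *+ 3 + N2 *+ 3 + N3 = 0.
  have A1 : A x = x + N1 by rewrite addrC subrK.
  have A2 : A N1 = N1 + N2 by rewrite addrC subrK.
  have A3' : A N2 = N2 + N3 by rewrite addrC subrK.
  have B1 : A (A x) = x + N1 + (N1 + N2) by rewrite [in LHS]A1 raddfD A1 A2.
  move: fx; rewrite /fixit /= B1 (raddfD _ (x + N1)) (raddfD _ x) (raddfD _ N1) A1 A2 A3'.
  exact: gen.
exists (- y2 - z *+ (3 ^ m.-1)%N); apply: (@mulI 3) => //.
move: e => /eqP; rewrite -addrA addr_eq0 => /eqP ->.
rewrite e3 /N2 /N1 e2 opprD mulrnBl mulrnBl mulNrn mulNrn -!mulrnA.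
by rewrite expnS mulnA [(_ * 3)%N]mulnC; congr (_ - _ *+ _); ring.
Qed.

Let net_prime j x : coprime 3 j || (j == 3) -> fixit j x -> A x = x.
Proof.
move=> cj fx; apply/eqP; rewrite -subr_eq0; apply/eqP/dv_all => m; move: x fx.
elim: m => // m IH x fx _; case: m IH => [_|m IH].
  by have [z ->] := A3 x; exists z.
have [y ->] := net_step (ltn0Sn m) cj (fun y fy => IH y fy isT) fx.
exists (y *+ (3 ^ m)%N); rewrite -mulrnA -expnD; congr (_ *+ (3 ^ _)%N); lia.
Qed.

Lemma net_coprime_or3 j x : coprime 3 j || (j == 3) -> iter j A x = x -> A x = x.
Proof. exact: net_prime. Qed.

End Net.

(** Factors 3 of the exponent are removed by passing to the cube of [A], which is again congruent to
    1 modulo 3. *)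
Lemma net (A : {additive 'rV[int]_k -> 'rV[int]_k}) j x :
  (forall x, exists z, A x - x = z *+ 3) -> (0 < j)%N -> iter j A x = x -> A x = x.
Proof.
elim/ltn_ind: j A x => j IH A x A3 j0 fx.
have [|n3] := boolP (coprime 3 j); first by move=> c3; apply: (@net_coprime_or3 A A3 j); rewrite ?c3.
have /dvdnP[i ji] : (3 %| j)%N by move: n3; rewrite prime_coprime // negbK.
apply: (@net_coprime_or3 A A3 3) => //=.
have i0 : (0 < i)%N by case: (i) ji j0 => // ->.
have [A' A'E] := @additive_ex _ _ (fun x => A (A (A x))) (fun x y => etrans (congr1 A (etrans (congr1 A (raddfB A x y)) (raddfB A _ _))) (raddfB A _ _)).
rewrite -A'E; apply: (IH i) => //; first by lia.
  move=> y; rewrite A'E.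
  have [u e1] := A3 y; have [v e2] := A3 (A y); have [w e3] := A3 (A (A y)).
  by exists (w + v + u); rewrite !mulrnDl -e1 -e2 -e3; apply/rowP => l; rewrite !mxE; ring.
rewrite -[RHS]fx ji; elim: (i) => // n e; rewrite iterS e A'E.
by rewrite mulSn addSn addSn addSn.
Qed.

Lemma HP_row (G : groupType) (a : G -> 'rV[int]_k -> 'rV[int]_k) :
  vact a -> (forall g x y, a g (x - y) = a g x - a g y) ->
  (forall g x n, (0 < n)%N -> iter n (a g) x = x -> a g x = x) ->
  (forall g, exists2 v, v != 0 & a g v = v) ->
  (forall v, v != 0 -> forall (H : groupType) (i : H -> G),
     is_hom i -> injective i -> (forall h, a (i h) v = v) -> HP R H) ->
  HP R G.
Proof.
move=> aA aB ai af st.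
by apply: (HP_lattice aA aB ai (col := residue) (q0 := l1)) => //; [exact: residueP|exact: lnorm_l1].
Qed.

End IntRow.

(** * Extensions of the integers by a lattice *)

Section IntHom.
Variables (R : realType) (G : groupType).

Definition zhom (chi : G -> int) : Prop := forall x y, chi (x * y)%g = chi x + chi y.

Variable chi : G -> int.
Hypothesis cM : zhom chi.

Lemma zhom1 : chi 1%g = 0.
Proof. by have := cM 1%g 1%g; rewrite mulg1; lia. Qed.

Lemma zhomV x : chi x^-1%g = - chi x.
Proof. by have := cM x x^-1%g; rewrite mulgV zhom1; lia. Qed.

Lemma zhomX x z : chi (zexp x z) = z * chi x.
Proof.
have N n : chi (x ^+ n)%g = n%:Z * chi x.
  by elim: n => [|n IH]; rewrite ?expg0 ?zhom1 ?mul0r // expgS cM IH; lia.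
by case: z => n /=; rewrite ?zhomV N // NegzE mulNr.
Qed.

Lemma zhom_gen : (exists x, chi x != 0) ->
  exists2 t, chi t != 0 & forall x, exists z, chi x = z * chi t.
Proof.
move=> [x0 x00]; pose Q n := `[< exists x, absz (chi x) = n.+1 >].
have exQ : exists n, Q n.
  by exists (absz (chi x0)).-1; apply/asboolP; exists x0; rewrite prednK ?absz_gt0.
case: (ex_minnP exQ) => n /asboolP[t tn] nmin.
have t0 : chi t != 0 by rewrite -absz_eq0 tn.
exists t => // x; exists (divz (chi x) (chi t)).
have [r0|r0] := eqVneq (modz (chi x) (chi t)) 0.
  by rewrite {1}(divz_eq (chi x) (chi t)) r0 addr0.
pose y := (x * zexp t (- divz (chi x) (chi t)))%g.
have yE : chi y = modz (chi x) (chi t) by rewrite cM zhomX /modz mulNr.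
have : (n <= (absz (chi y)).-1)%N.
  by apply: nmin; apply/asboolP; exists y; rewrite prednK ?absz_gt0 // yE.
rewrite yE; have := ltz_mod (chi x) t0; have := modz_ge0 (chi x) t0; move: r0 tn; lia.
Qed.

Lemma HP_cyclic : (forall x, chi x = 0 -> x = 1%g) -> HP R G.
Proof.
move=> ci; apply: HP_vc.
have ce x y : chi x = chi y -> x = y.
  move=> e; rewrite -[x]mulg1 -(mulVg y) mulgA.
  by rewrite (ci (x * y^-1)%g) ?mul1g // cM zhomV e subrr.
have [/zhom_gen[t t0 tP]|no] := pselect (exists x, chi x != 0).
  exists t, [:: 1%g] => x; exists 1%g; first by rewrite inE.
  have [z xz] := tP x; exists z; rewrite mul1g; apply: ce.
  by rewrite zhomX.
exists 1%g, [:: 1%g] => x; exists 1%g; first by rewrite inE.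
exists 0; rewrite mul1g; apply: ce; rewrite zhomX mul0r.
by apply/eqP/negPn/negP => x0; apply: no; exists x.
Qed.

End IntHom.

Lemma zhom_comp (G H : groupType) (i : H -> G) (chi : G -> int) :
  is_hom i -> zhom chi -> zhom (chi \o i).
Proof. by move=> iM cM x y; rewrite /= iM cM. Qed.

Lemma row_col'0 n (u : 'rV[int]_n.+1) i : col' i u = 0 -> u 0 i = 0 -> u = 0.
Proof.
move=> /rowP u' ui; apply/rowP => j; rewrite mxE.
by have [l ->|->//] := unliftP i j; have := u' l; rewrite !mxE.
Qed.

Lemma col'D n (u v : 'rV[int]_n.+1) i : col' i (u + v) = col' i u + col' i v.
Proof. by apply/rowP => j; rewrite !mxE. Qed.

(** Two coordinates define a map to Z^2. On a subgroup where they are linearly dependent one of them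
    vanishes with the others, and dropping it keeps the map injective. *)
Lemma HP_free_abelian (R : realType) d (G : groupType) (f : G -> 'rV[int]_d) :
  (forall x y, f (x * y)%g = f x + f y) -> (forall x, f x = 0 -> x = 1%g) -> HP R G.
Proof.
elim: d G f => [|[|d] IH] G f fM fi.
- apply: (@HP_cyclic R G (fun=> 0)); first by move=> x y; rewrite addr0.
  by move=> x _; apply: fi; exact: thinmx0.
- apply: (@HP_cyclic R G (fun x => f x 0 0)); first by move=> x y; rewrite fM mxE.
  by move=> x x0; apply: fi; apply/rowP => i; rewrite (ord1 i) mxE.
have cM i : zhom (fun x => f x 0 i) by move=> x y; rewrite fM mxE.
apply: (HP_plane (cM 0) (cM 1)) => H j jM ji [m1 [m2 [m0 E]]].
have drop i : (forall h, col' i (f (j h)) = 0 -> f (j h) 0 i = 0) -> HP R H.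
  move=> Hi; apply: (IH H (fun h => col' i (f (j h)))) => [x y|x x0].
    by rewrite jM fM col'D.
  by apply: ji; rewrite (hom1 jM); apply: fi; exact: row_col'0 x0 (Hi _ x0).
have [m10|m10] := eqVneq m1 0.
  apply: (drop 1) => h _; have := E h; rewrite m10 mul0r => /esym/eqP.
  by rewrite mulf_eq0; move: m0; rewrite m10 eqxx => /= /negbTE -> /eqP.
apply: (drop 0) => h /rowP/(_ 0); rewrite !mxE => b0; have := E h.
rewrite (_ : f (j h) 0 1 = 0) ?mulr0; last by rewrite -[RHS]b0; congr (f _ _ _); apply/val_inj.
by move=> /eqP; rewrite mulf_eq0 (negbTE m10) => /eqP.
Qed.

Lemma scale_rowz k (a : int) (u : 'rV[int]_k) : a *: u = u *~ a.
Proof. by rewrite -{1}[a]intz scaler_int. Qed.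

Lemma additive_mx k l (e : {additive 'rV[int]_k -> 'rV[int]_l}) :
  exists Q, forall v, e v = v *m Q.
Proof.
exists (\matrix_i e (delta_mx 0 i)) => v.
rewrite {1}[v]row_sum_delta raddf_sum mulmx_sum_row; apply: eq_bigr => i _.
by rewrite rowK !scale_rowz raddfMz.
Qed.

Definition commutes (G : groupType) (x y : G) : Prop := (x * y = y * x)%g.

(** What congruence to 1 modulo 3 leaves behind in the abstract group. It passes to subgroups, and
    gives isolated fixed vectors for conjugation on an abelian normal subgroup. *)
Definition isolated_centralisers (G : groupType) : Prop :=
  forall (x y : G) n, (0 < n)%N -> commutes (x ^+ n)%g y -> commutes x y.

Lemma isolated_centralisers_sub (G H : groupType) (i : H -> G) :
  is_hom i -> injective i -> isolated_centralisers G -> isolated_centralisers H.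
Proof.
move=> iM ii iG x y n n0 h; apply: ii; rewrite !iM; apply: (iG _ _ n n0).
by rewrite -(homX iM) /commutes -!iM h.
Qed.

Section Split.
Variables (R : realType) (E : groupType) (chi : E -> int) (k : nat).
Variables (ka : E -> 'rV[int]_k).
Hypothesis cM : zhom chi.
Hypothesis kM : forall x y, chi x = 0 -> chi y = 0 -> ka (x * y)%g = ka x + ka y.
Hypothesis ki : forall x, chi x = 0 -> ka x = 0 -> x = 1%g.
Hypothesis ks : forall v, exists2 x, chi x = 0 & ka x = v.
Hypothesis iso : isolated_centralisers E.
Variable t : E.
Hypothesis t0 : chi t != 0.
Hypothesis tP : forall x, exists z, chi x = z * chi t.

Let c1 := zhom1 cM.
Let cV := zhomV cM.
Let cX := zhomX cM.

Lemma ka1 : ka 1%g = 0.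
Proof. by have /eqP := kM c1 c1; rewrite mulg1 -subr_eq subrr => /eqP. Qed.

Lemma kaV x : chi x = 0 -> ka x^-1%g = - ka x.
Proof.
move=> x0; apply/eqP; rewrite -subr_eq0 opprK addrC -kM ?mulgV ?ka1 //.
by rewrite cV x0 oppr0.
Qed.

Lemma ka_inj x y : chi x = 0 -> chi y = 0 -> ka x = ka y -> x = y.
Proof.
move=> x0 y0 e; rewrite -[x]mulg1 -(mulVg y) mulgA.
rewrite (ki (x := (x * y^-1)%g)) ?mul1g //; first by rewrite cM cV x0 y0 subr0.
by rewrite kM ?kaV ?e ?subrr // cV y0 oppr0.
Qed.

Definition section_of v : E := s2val (cid2 (ks v)).

Let eps := section_of.

Lemma eps0 v : chi (eps v) = 0. Proof. exact: s2valP (cid2 (ks v)). Qed.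

Lemma epsK v : ka (eps v) = v. Proof. exact: s2valP' (cid2 (ks v)). Qed.

Lemma kaK x : chi x = 0 -> eps (ka x) = x.
Proof. by move=> x0; apply: ka_inj; rewrite ?eps0 ?epsK. Qed.

Lemma kernel_comm x y : chi x = 0 -> chi y = 0 -> (x * y = y * x)%g.
Proof. by move=> x0 y0; apply: ka_inj; rewrite ?cM ?kM ?x0 ?y0 // addrC. Qed.

Lemma chi_conj g x : chi (g * x * g^-1)%g = chi x.
Proof. by rewrite !cM cV; lia. Qed.

Definition cj g v := ka (g * eps v * g^-1)%g.

Lemma cjE g x : chi x = 0 -> cj g (ka x) = ka (g * x * g^-1)%g.
Proof. by move=> x0; rewrite /cj kaK. Qed.

Lemma cjM g h v : cj (g * h)%g v = cj g (cj h v).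
Proof. by rewrite [cj h v]/cj cjE ?chi_conj ?eps0 // /cj invgM !mulgA. Qed.

Lemma cj1 v : cj 1%g v = v.
Proof. by rewrite /cj mul1g invg1 mulg1 epsK. Qed.

Lemma cjD g u v : cj g (u + v) = cj g u + cj g v.
Proof.
rewrite -{1}[u]epsK -{1}[v]epsK -kM ?eps0 // cjE; last by rewrite cM !eps0.
by rewrite -kM ?chi_conj ?eps0 // !mulgA mulgVK.
Qed.

Lemma cjB g u v : cj g (u - v) = cj g u - cj g v.
Proof. by apply: (addIr (cj g v)); rewrite -cjD !subrK. Qed.

Lemma cjMz g u z : cj g (u *~ z) = cj g u *~ z.
Proof. by have [e eE] := additive_ex (cjB g); rewrite -!eE raddfMz. Qed.

Lemma cj_kernel u v : chi u = 0 -> cj u v = v.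
Proof. by move=> u0; rewrite /cj (kernel_comm u0 (eps0 v)) mulgK epsK. Qed.

Lemma cj_fix g v : cj g v = v <-> commutes g (eps v).
Proof.
rewrite /cj /commutes; split => [e|->]; last by rewrite mulgK epsK.
have := congr1 eps e; rewrite kaK ?chi_conj ?eps0 // => {2}<-.
by rewrite mulgVK.
Qed.

Definition expo g : int := divz (chi g) (chi t).

Lemma expoE g : chi g = expo g * chi t.
Proof. by have [z gz] := tP g; rewrite /expo gz mulzK. Qed.

Lemma expoM g h : expo (g * h)%g = expo g + expo h.
Proof. by apply: (mulIf t0); rewrite mulrDl -!expoE cM. Qed.

Lemma expo_kernel g : chi g = 0 -> expo g = 0.
Proof. by move=> g0; rewrite /expo g0 div0z. Qed.

Definition unip g : E := (g * zexp t (- expo g))%g.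

Lemma unip0 g : chi (unip g) = 0.
Proof. by rewrite /unip cM cX mulNr -expoE subrr. Qed.

Lemma unipE g : g = (unip g * zexp t (expo g))%g.
Proof. by rewrite /unip -mulgA -zexpD addNr /= expg0 mulg1. Qed.

Lemma cj_zexp g v : cj g v = cj (zexp t (expo g)) v.
Proof. by rewrite {1}(unipE g) cjM cj_kernel // unip0. Qed.

Definition tau g := ka (unip g).

Lemma tauM g h : tau (g * h)%g = tau g + cj g (tau h).
Proof.
rewrite (cj_zexp g) /tau cjE ?unip0 // -kM ?chi_conj ?unip0 //; congr ka.
rewrite /unip expoM -!mulgA; congr (_ * _)%g.
rewrite !mulgA -zexpD addNr /= expg0 mul1g -!mulgA; congr (_ * _)%g.
by rewrite -zexpN -zexpD opprD addrC.
Qed.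

Lemma tau_kernel g : chi g = 0 -> tau g = ka g.
Proof. by move=> g0; rewrite /tau /unip expo_kernel // oppr0 /= expg0 mulg1. Qed.

(** The group acts on the kernel by conjugation followed by the translation [tau g]; this is that
    affine action in homogeneous coordinates. *)
Definition affine g (x : 'rV[int]_(1 + k)) : 'rV[int]_(1 + k) :=
  row_mx (lsubmx x) (cj g (rsubmx x) + tau g *~ x 0 0).

Lemma affine0 g x : affine g x 0 0 = x 0 0.
Proof. by rewrite row0E row_mxKl -row0E. Qed.

Lemma affine_vact : vact affine.
Proof.
split=> [x|g h x].
  rewrite /affine cj1 tau_kernel // ka1 mul0rz addr0 hsubmxK //.
rewrite {2}/affine affine0 /affine !row_mxKl !row_mxKr cjD cjM cjMz tauM mulrzDl.
by rewrite [_ *~ _ + cj _ _ *~ _]addrC addrA.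
Qed.

Lemma affineB g x y : affine g (x - y) = affine g x - affine g y.
Proof.
rewrite /affine opp_row_mx add_row_mx !linearB /= cjB !mxE mulrzBr; congr row_mx.
by rewrite opprD addrACA.
Qed.

Lemma cj_matrix g : exists Q : 'M[int]_k, forall v, cj g v - v = v *m Q.
Proof.
have B u v : cj g (u - v) - (u - v) = (cj g u - u) - (cj g v - v).
  by rewrite cjB; apply/rowP => i; rewrite !mxE; ring.
have [e eE] := additive_ex B.
by have [Q QE] := additive_mx e; exists Q => v; rewrite -QE eE.
Qed.

(** Either conjugation minus 1 is singular and kills a vector of the kernel, or the affine fixed
    point equation is solvable over the rationals. In the second case the adjugate solves it over
    the integers once the homogeneous coordinate is the determinant. *)
Lemma affine_fix g : exists2 x, x != 0 & affine g x = x.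
Proof.
have [Q QE] := cj_matrix g; have [/det0P[v v0 vQ]|d0] := boolP (\det Q == 0).
  exists (row_mx 0 v); first by rewrite -row_mx0; apply: contra_neq v0 => /eq_row_mx[].
  rewrite /affine row_mxKl row_mxKr row0E row_mxKl mxE mulr0z addr0; congr row_mx.
  by apply/eqP; rewrite -subr_eq0 QE vQ.
pose v := - (tau g *m \adj Q); exists (row_mx (\det Q)%:M v).
  by apply: contra_neq d0 => /rowP/(_ 0); rewrite row0E row_mxKl !mxE eqxx mulr1n.
rewrite /affine row_mxKl row_mxKr row0E row_mxKl mxE eqxx mulr1n; congr row_mx.
have /eqP : cj g v - v + tau g *~ \det Q = 0.
  by rewrite QE /v mulNmx -mulmxA mul_adj_mx mul_mx_scalar scale_rowz addNr.
by rewrite addrAC subr_eq0 => /eqP.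
Qed.

Lemma cj_isolated g n v : (0 < n)%N -> cj (g ^+ n)%g v = v -> cj g v = v.
Proof. by move=> n0 /cj_fix e; apply/cj_fix; apply: iso e. Qed.

(** The displacement [y] of [x] has homogeneous coordinate 0 and is fixed by the [n]-th power of
    [g], hence by [g]. Then [n] steps move [x] by [y *+ n], which must be 0. *)
Lemma affine_isolated g x n : (0 < n)%N -> iter n (affine g) x = x -> affine g x = x.
Proof.
move=> n0 nx; pose y := affine g x - x.
have itE m z : iter m (affine g) z = affine (g ^+ m)%g z.
  elim: m => [|m IH]; first by rewrite expg0 affine_vact.1.
  by rewrite iterS IH expgS affine_vact.2.
have y0 : y 0 0 = 0 by rewrite /y mxE [X in _ + X]mxE affine0 subrr.
have lin h (z : 'rV[int]_(1 + k)) : z 0 0 = 0 -> affine h z = row_mx (0 : 'rV_1) (cj h (rsubmx z)).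
  move=> z0; rewrite /affine z0 mulr0z addr0; congr row_mx.
  by apply/rowP => i; rewrite (ord1 i) -row0E z0 mxE.
have ny : affine (g ^+ n)%g y = y.
  by rewrite /y affineB -affine_vact.2 -expgSr expgS affine_vact.2 -itE nx.
have gy : affine g y = y.
  rewrite lin // (@cj_isolated g n) -?lin //.
    by rewrite -{2}(affine_vact.1 y) lin // cj1.
  by have := ny; rewrite lin // => e; rewrite -{2}e row_mxKr.
have : iter n (affine g) x = x + y *+ n.
  elim: (n) => [|m IH]; first by rewrite addr0.
  have [e eE] := additive_ex (affineB g).
  rewrite iterS IH -eE raddfD raddfMn /= !eE gy mulrS addrA; congr (_ + _).
  by rewrite /y addrC subrK.
rewrite nx => /eqP; rewrite -subr_eq0 opprD addrA subrr sub0r oppr_eq0 => /eqP/rowP yn.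
apply/eqP; rewrite -subr_eq0; apply/eqP/rowP => i; have := yn i.
rewrite mulmxnE [X in _ = X]mxE => /eqP; rewrite mulrn_eq0 eqn0Ngt n0 /= => /eqP.
by rewrite -/y => ->; rewrite mxE.
Qed.

(* no nontrivial element of the kernel commutes with [t]: the affine action on the
   kernel, made linear in one dimension more, has abelian vertex stabilisers *)
Lemma HP_affine : (forall v, cj t v = v -> v = 0) -> HP R E.
Proof.
move=> free; have X0 n : (0 < n)%N -> (forall v, cj (t ^+ n)%g v = v -> v = 0).
  by move=> n0 v /(cj_isolated n0)/free.
have Z0 g v : chi g != 0 -> cj g v = v -> v = 0.
  rewrite cj_zexp expoE mulf_eq0 negb_or => /andP[e0 _].
  case: (expo g) e0 => n /= n0 h; first by apply: (X0 n) => //; rewrite lt0n.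
  by apply: (X0 n.+1) => //; rewrite -{1}h -cjM mulgV cj1.
apply: (HP_row affine_vact affineB affine_isolated affine_fix) => x x0 H i iM ii fx.
(* If the homogeneous coordinate of [x] is nonzero, its stabiliser meets the kernel trivially and is
   cyclic. If it is zero, the stabiliser is contained in the kernel and is free abelian. *)
have [r0|r0] := eqVneq (x 0 0) 0; last first.
  apply: (@HP_cyclic R H (chi \o i)) => [|h /= h0]; first exact: zhom_comp.
   apply: ii; rewrite (hom1 iM).
  apply: ki => //; have := fx h; rewrite /affine cj_kernel // tau_kernel //.
  move=> /(congr1 rsubmx); rewrite row_mxKr => /eqP; rewrite -subr_eq0 addrAC subrr add0r => /eqP e.
  by apply/rowP => l; have /rowP/(_ l) := e; rewrite mxMz !mxE => /eqP; rewrite mulrz_eq0 (negbTE r0) => /eqP.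
have v0 : rsubmx x != 0.
  apply: contra_neq x0 => v0; rewrite -[x]hsubmxK v0 -row_mx0; congr row_mx.
  by apply/rowP => l; rewrite (ord1 l) -row0E r0 mxE.
have c0 h : chi (i h) = 0.
  apply/eqP/negPn/negP => h0; move/eqP: v0; apply; apply: (Z0 _ _ h0).
  by have := fx h; rewrite /affine r0 mulr0z addr0 => /(congr1 rsubmx); rewrite row_mxKr.
apply: (@HP_free_abelian R k H (fun h => ka (i h))) => [h h'|h /ki e].
  by rewrite iM kM.
by apply: ii; rewrite (hom1 iM) e.
Qed.

Hypothesis IH : forall (H : groupType) (i : H -> E) (f : H -> 'rV[int]_k.-1),
  is_hom i -> injective i ->
  (forall x y, chi (i x) = 0 -> chi (i y) = 0 -> f (x * y)%g = f x + f y) ->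
  (forall x, chi (i x) = 0 -> f x = 0 -> x = 1%g) -> HP R H.

(** If [t] fixes a nonzero vector of the kernel, it also fixes a nonzero linear form, and invariance
    turns this form composed with the cocycle [tau] into a character. Together with [chi] it maps
    [E] to Z^2. Where the two are dependent, either [chi] vanishes or the kernel lies in a
    hyperplane, and its rank drops. *)
Lemma HP_split_step : HP R E.
Proof.
have [free|/existsNP[v /not_implyP[vt v0]]] := pselect (forall v, cj t v = v -> v = 0).
  exact: HP_affine.
have [Q QE] := cj_matrix t.
have dQ : \det Q == 0.
  by apply/det0P; exists v; [exact/eqP|rewrite -QE vt subrr].
move: dQ; rewrite -det_tr => /det0P[psi psi0 psiQ].
pose ps (v : 'rV[int]_k) : int := (v *m psi^T) 0 0.
have psD u w : ps (u + w) = ps u + ps w by rewrite /ps mulmxDl mxE.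
have pst w : ps (cj t w) = ps w.
  rewrite -[cj t w](subrK w) psD QE /ps -mulmxA -[Q]trmxK -trmx_mul psiQ trmx0 mulmx0.
  by rewrite mxE add0r.
have psX n w : ps (cj (t ^+ n)%g w) = ps w.
  by elim: n w => [|n IHn] w; rewrite ?expg0 ?cj1 // expgS cjM pst.
have psE g w : ps (cj g w) = ps w.
  rewrite cj_zexp; case: (expo g) => n /=; first exact: psX.
  by rewrite -(psX n.+1) -cjM mulgV cj1.
have aM : zhom (fun g => ps (tau g)) by move=> g h; rewrite tauM psD psE.
apply: (HP_plane aM cM) => H i iM ii [m1 [m2 [m0 eq]]].
have [m10|m10] := eqVneq m1 0.
  have c0 h : chi (i h) = 0.
    have := eq h; rewrite m10 mul0r => /esym/eqP.
    by rewrite mulf_eq0; move: m0; rewrite m10 eqxx => /= /negbTE -> /eqP.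
  apply: (@HP_free_abelian R k H (fun h => ka (i h))) => [h h'|h /ki e].
    by rewrite iM kM.
  by apply: ii; rewrite (hom1 iM) e.
have [j pj] : exists j, psi 0 j != 0.
  apply: contrapT => no; move/eqP: psi0; apply; apply/rowP => j; rewrite mxE.
  by apply/eqP/negPn/negP => pj; apply: no; exists j.
apply: (IH (i := i) (f := fun h => col' j (ka (i h)))) => //.
  by move=> x y x0 y0; rewrite iM kM //; apply/rowP => l; rewrite !mxE.
move=> x x0 /rowP fx; apply: ii; rewrite (hom1 iM); apply: ki => //.
have off l : l != j -> ka (i x) 0 l = 0.
  by rewrite eq_sym => /unlift_some[l' -> _]; have := fx l'; rewrite !mxE.
apply/rowP => l; rewrite mxE; have [->|/off //] := eqVneq l j.
have := eq x; rewrite x0 mulr0 tau_kernel // => /eqP.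
rewrite mulf_eq0 (negbTE m10) /= /ps mxE (bigD1 j) //= big1 ?addr0; last first.
  by move=> l' /off ->; rewrite mul0r.
by rewrite mxE mulf_eq0 (negbTE pj) orbF => /eqP.
Qed.

End Split.

Lemma HP_split (R : realType) d : forall (E : groupType) (chi : E -> int)
    (f : E -> 'rV[int]_d), zhom chi ->
  (forall x y, chi x = 0 -> chi y = 0 -> f (x * y)%g = f x + f y) ->
  (forall x, chi x = 0 -> f x = 0 -> x = 1%g) -> isolated_centralisers E -> HP R E.
Proof.
elim/ltn_ind: d => d IH E chi f cM fM fi iE.
have [/(zhom_gen cM)[t t0 tP]|no] := pselect (exists x, chi x != 0); last first.
  have c0 x : chi x = 0 by apply/eqP/negPn/negP => x0; apply: no; exists x.
  by apply: (@HP_free_abelian R d E f) => [x y|x]; [exact: fM|exact: fi].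
pose A v := exists2 x, chi x = 0 & v = f x.
have f1 : f 1%g = 0.
  by have /eqP := fM _ _ (zhom1 cM) (zhom1 cM); rewrite mulg1 -subr_eq subrr => /eqP.
have fV x : chi x = 0 -> f x^-1%g = - f x.
  move=> x0; apply/eqP; rewrite -subr_eq0 opprK addrC -fM ?mulgV ?f1 //.
  by rewrite (zhomV cM) x0 oppr0.
have sA : subzmod A.
  split; first by exists 1%g; rewrite ?f1 ?(zhom1 cM).
  move=> _ _ [x x0 ->] [y y0 ->]; exists (x * y^-1)%g.
    by rewrite cM (zhomV cM) x0 y0 subr0.
  by rewrite fM ?fV // (zhomV cM) y0 oppr0.
have [id' idE] := @additive_ex 'rV[int]_d 'rV[int]_d id (fun _ _ => erefl).
have [||k kd [g [gi gA]]] := @parametrised_sub _ d id' A _ sA.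
- by move=> u v; rewrite !idE.
- by move=> x _; exists x; rewrite idE.
have fg x : exists v, chi x = 0 -> f x = g v.
  have [x0|x0] := eqVneq (chi x) 0; last by exists 0 => e; rewrite e eqxx in x0.
  by have [v ->] : exists v, f x = g v; [apply/gA; exists x|exists v].
pose ka x := sval (cid (fg x)).
have kaE x : chi x = 0 -> f x = g (ka x) := svalP (cid (fg x)).
apply: (@HP_split_step R E chi k ka cM _ _ _ iE t t0 tP).
- by move=> x y x0 y0; apply: gi; rewrite raddfD -!kaE ?fM // cM x0 y0.
- by move=> x x0 kx; apply: fi => //; rewrite kaE // kx raddf0.
- move=> v; have [x x0 e] : A (g v) by apply/gA; exists v.
  by exists x => //; apply: gi; rewrite e kaE.
move=> H i h iM ii hM hi.
have [k0|k0] := posnP k; last first.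
  apply: (IH k.-1 _ H (chi \o i) h) => //; first by lia.
    exact: zhom_comp.
  exact: isolated_centralisers_sub iE.
apply: (@HP_cyclic R H (chi \o i)) => [|x /= x0]; first exact: zhom_comp.
 apply: hi => //.
by apply/rowP => -[l l_lt]; exfalso; rewrite k0 in l_lt.
Qed.

Definition enumerable (G : groupType) : Prop := exists e : nat -> G, forall g, exists n, e n = g.

Lemma enumerable_inj (G H : groupType) (i : H -> G) :
  injective i -> enumerable G -> enumerable H.
Proof.
move=> ii [e eP]; exists (fun n => xget 1%g [set h | i h = e n]) => h.
have [n en] := eP (i h); exists n; apply: ii; rewrite -en.
by apply: (@xgetPex _ 1%g [set h | i h = e n]); exists h.
Qed.

Lemma enumerable_surj (G H : groupType) (f : G -> H) :
  (forall h, exists g, f g = h) -> enumerable G -> enumerable H.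
Proof.
move=> fs [e eP]; exists (f \o e) => h; have [g <-] := fs h.
by have [n <-] := eP g; exists n.
Qed.

(** * Countable torsion-free abelian groups *)

Section Additive.
Variables (G : groupType) (cG : forall x y : G, commutes x y).

(** The vacuous [let] makes the alias depend on the proof [cG], from which its additive structure is
    built. *)
Definition additive_copy : Type := let _ := cG in G.

HB.instance Definition _ := Choice.on additive_copy.

Let add (x y : additive_copy) : additive_copy := (x * y : G)%g.
Let opp (x : additive_copy) : additive_copy := (x : G)^-1%g.
Let zero : additive_copy := (1 : G)%g.

Let addA : associative add. Proof. exact: mulgA. Qed.
Let addC : commutative add. Proof. exact: cG. Qed.
Let add0 : left_id zero add. Proof. exact: mul1g. Qed.
Let addN : left_inverse zero opp add. Proof. exact: mulVg. Qed.

HB.instance Definition _ := GRing.isZmodule.Build additive_copy addA addC add0 addN.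

Lemma additive_copyMn (x : additive_copy) n : x *+ n = (x ^+ n : G)%g.
Proof. by elim: n => [|n IH]; rewrite ?mulr0n ?expg0 // mulrS expgS IH. Qed.

End Additive.

(** Such a group is the increasing union of the subgroups generated by initial segments of an
    enumeration, and these are free of finite rank. *)
Lemma HP_abelian (R : realType) (G : groupType) : enumerable G ->
  (forall x y : G, commutes x y) ->
  (forall (x : G) n, (0 < n)%N -> (x ^+ n)%g = 1%g -> x = 1%g) -> HP R G.
Proof.
move=> [e eP] cG tf; pose V : zmodType := additive_copy cG.
have tfV (x : V) n : (0 < n)%N -> x *+ n = 0 -> x = 0.
  by move=> n0; rewrite additive_copyMn => /(tf _ _ n0).
pose w n : seq V := [seq (e i : V) | i <- iota 0 n].
apply: (@HP_union R G (fun n x => zspan (w n) (x : V))) => [n|n x y|n x|m n x mn|x|].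
- exact: (zspan_subzmod (w n)).1.
- exact: (subzmodD (zspan_subzmod (w n))).
- exact: (subzmodN (zspan_subzmod (w n))).
- apply: zspan_sub; first exact: zspan_subzmod.
  move=> y yw; have [i im ->] : exists2 i, i \in iota 0 m & y = e i.
    by apply/(@seq.mapP nat V (fun i => e i : V)).
  move: im; rewrite mem_iota => /andP[_ im].
  apply/zspan_mem/map_f; rewrite mem_iota /=; rewrite add0n in im *; exact: leq_trans im mn.
- have [n <-] := eP x; exists n.+1; apply/zspan_mem/map_f.
  by rewrite mem_iota /= add0n.
move=> n H i iM ii Hn.
have [k [f [fi fA]]] := parametrised_fg tfV (zspan_subzmod (w n)) (fun _ => id).
have fx h : exists u, (i h : V) = f u by apply/fA.
pose ka h := sval (cid (fx h)); have kaE h : (i h : V) = f (ka h) := svalP (cid (fx h)).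
apply: (@HP_free_abelian R k H ka) => [x y|x x0].
  by apply: fi; rewrite raddfD -!kaE iM.
by apply: ii; rewrite (hom1 iM); have := kaE x; rewrite x0 raddf0.
Qed.

(** * Groups with two virtually cyclic images and a lattice as common kernel *)

Section TwoCyclic.
Variable R : realType.

Definition cyclic_image (K Q : groupType) (f : K -> Q) : Prop :=
  exists q, forall x, exists z, f x = zexp q z.

Definition torsion_free_image (K Q : groupType) (f : K -> Q) : Prop :=
  forall x n, (0 < n)%N -> f (x ^+ n)%g = 1%g -> f x = 1%g.

Lemma torsion_free_image_sub (K Q H : groupType) (f : K -> Q) (i : H -> K) :
  is_hom i -> torsion_free_image f -> torsion_free_image (f \o i).
Proof. by move=> iM tf x n n0 /=; rewrite (homX iM); exact: tf. Qed.

Lemma zexp1g (Q : groupType) z : zexp (1 : Q)%g z = 1%g.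
Proof. by case: z => n /=; rewrite expg1n ?invg1. Qed.

Lemma zexpX (Q : groupType) (q : Q) z n : (zexp q z ^+ n)%g = zexp q (z * n%:Z).
Proof.
elim: n => [|n IH]; first by rewrite expg0 mulr0.
by rewrite expgS IH -zexpD; congr zexp; lia.
Qed.

Lemma cyclic_image_zhom (K Q : groupType) (f : K -> Q) : is_hom f ->
  torsion_free_image f -> cyclic_image f ->
  exists2 al : K -> int, zhom al & forall x, al x = 0 -> f x = 1%g.
Proof.
move=> fM tf [q qP].
have [triv|nt] := pselect (forall x, f x = 1%g).
  by exists (fun=> 0).
have uq z : zexp q z = 1%g -> z = 0.
  move=> qz; apply: contrapT => /eqP z0; apply: nt => x.
  apply: (tf _ (absz z)); first by rewrite absz_gt0.
  have [y xy] := qP x; rewrite (homX fM) xy zexpX.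
  have -> : y * `|z|%N = z * (Num.sg z * y) by rewrite abszE normrEsg; ring.
  by rewrite zexp_mul qz zexp1g.
pose al x := sval (cid (qP x)); have alE x : f x = zexp q (al x) := svalP (cid (qP x)).
exists al => [x y|x x0]; last by rewrite alE x0.
apply/eqP; rewrite -subr_eq0; apply/eqP/uq.
by rewrite zexpB zexpD -!alE fM mulgV.
Qed.

Lemma cyclic_image_sub (K Q H : groupType) (f : K -> Q) (i : H -> K) :
  cyclic_image f -> cyclic_image (f \o i).
Proof. by move=> [q qP]; exists q => x; exact: qP. Qed.

(** The preimage of the cyclic part has finite index, with the list [l] of representatives. *)
Lemma HP_cyclic_image (K Q : groupType) (f : K -> Q) : is_hom f -> vcimg f ->
  (forall (H : groupType) (i : H -> K), is_hom i -> injective i ->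
     cyclic_image (f \o i) -> HP R H) -> HP R K.
Proof.
move=> fM [c [l cl]] HK.
pose P x := exists z, f x = zexp (f c) z.
have P1 : P 1%g by exists 0; rewrite (hom1 fM).
have PM x y : P x -> P y -> P (x * y)%g.
  by move=> [z xz] [w yw]; exists (z + w); rewrite fM xz yw zexpD.
have PV x : P x -> P x^-1%g.
  by move=> [z xz]; exists (- z); rewrite (homV fM) xz zexpN.
pose S := sgroup P1 PM PV; pose j : subgrp S -> K := sval.
have jM : is_hom j by exact: sval_hom.
have ji : injective j by exact: sval_inj.
apply: (@HP_finite_index R (subgrp S) _ K j) => //.
  apply: (HK _ j) => //; exists (f c) => x.
  by have /sgroupP := svalP x.
exists l => x; have [r rl [z xz]] := cl x; exists r => //.
have pS : (r^-1 * x)%g \in S.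
  apply/sgroupP; exists z; rewrite fM (homV fM) xz fM mulgA mulVg mul1g.
  by rewrite (hom_zexp _ _ fM).
exists (Sub (r^-1 * x)%g pS : subgrp S); rewrite /j (_ : sval _ = (r^-1 * x)%g) ?mulgA ?mulgV ?mul1g //.
Qed.

(** On a subgroup of finite index both images become cyclic, and being torsion free they give two
    integral characters, that is, a map to Z^2. Where these are dependent, the vanishing of a
    suitable one of them forces that of the other, and the subgroup is an extension of a group of
    integers by a lattice. *)
Lemma HP_two_cyclic (K Q1 Q2 : groupType) (f1 : K -> Q1) (f2 : K -> Q2) k
    (F : K -> 'rV[int]_k) :
  is_hom f1 -> is_hom f2 -> vcimg f1 -> vcimg f2 ->
  torsion_free_image f1 -> torsion_free_image f2 -> isolated_centralisers K ->
  (forall x y, f1 x = 1%g -> f2 x = 1%g -> f1 y = 1%g -> f2 y = 1%g ->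
     F (x * y)%g = F x + F y) ->
  (forall x, f1 x = 1%g -> f2 x = 1%g -> F x = 0 -> x = 1%g) -> HP R K.
Proof.
move=> f1M f2M v1 v2 t1 t2 iK FM Fi.
apply: (HP_cyclic_image f1M v1) => H1 i1 i1M i1i c1.
have i2f : is_hom (f2 \o i1) by exact: hom_comp.
apply: (HP_cyclic_image i2f); first exact: vcimg_sub.
move=> H2 i2 i2M i2i c2; pose i := i1 \o i2.
have iM : is_hom i by exact: hom_comp.
have ii : injective i by exact: inj_comp.
have g1M : is_hom (f1 \o i) by exact: hom_comp.
have g2M : is_hom (f2 \o i) by exact: hom_comp.
have [a1 a1M a1P] := cyclic_image_zhom g1M (torsion_free_image_sub iM t1) (cyclic_image_sub i2 c1).
have [a2 a2M a2P] := cyclic_image_zhom g2M (torsion_free_image_sub iM t2) c2.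
apply: (HP_plane a1M a2M) => H j jM ji [m1 [m2 [m0 E]]].
have [chi cM cP] : exists2 chi : H -> int, zhom chi &
    forall h, chi h = 0 -> a1 (j h) = 0 /\ a2 (j h) = 0.
  have [m10|m10] := eqVneq m1 0.
    exists (a1 \o j) => [|h /= h0]; first exact: zhom_comp.
    split => //; have := E h; rewrite m10 mul0r => /esym/eqP.
    by rewrite mulf_eq0; move: m0; rewrite m10 eqxx => /= /negbTE -> /eqP.
  exists (a2 \o j) => [|h /= h0]; first exact: zhom_comp.
  by split => //; have := E h; rewrite h0 mulr0 => /eqP; rewrite mulf_eq0 (negbTE m10) => /eqP.
have ijM : is_hom (i \o j) by exact: hom_comp.
have iji : injective (i \o j) by exact: inj_comp.
have ker h : chi h = 0 -> f1 (i (j h)) = 1%g /\ f2 (i (j h)) = 1%g.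
  by move=> /cP[/a1P ? /a2P].
apply: (@HP_split R k H chi (fun h => F (i (j h))) cM) => [x y x0 y0|x x0|].
- by have [? ?] := ker x x0; have [? ?] := ker y y0; rewrite jM iM FM.
- have [? ?] := ker x x0; move=> Fx; apply: iji; rewrite (hom1 ijM).
  by apply: Fi.
- exact: isolated_centralisers_sub iK.
Qed.

End TwoCyclic.

(** * Matrices congruent to 1 modulo 3 *)

Lemma lattice_net (V : zmodType) (L : V -> Prop) k (F : V -> V) j z :
  parametrised L k -> (forall x y, F (x - y) = F x - F y) ->
  (forall x, L x -> exists2 y, L y & F x - x = y *+ 3) ->
  (0 < j)%N -> L z -> iter j F z = z -> F z = z.
Proof.
move=> [e [ei eL]] FB F3 j0 Lz fz.
have Fe u : exists v, F (e u) = e v.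
  have Lu : L (e u) by apply/eL; exists u.
  have [y /eL[v ->] h] := F3 _ Lu; exists (v *+ 3 + u).
  by rewrite raddfD raddfMn /= -h subrK.
pose A0 u := sval (cid (Fe u)); have A0E u : F (e u) = e (A0 u) := svalP (cid (Fe u)).
have [A AE] := @additive_ex _ _ A0 (fun u v => ei _ _ (etrans (esym (A0E _))
  (etrans (congr1 F (raddfB e u v)) (etrans (FB _ _) (etrans
  (congr2 (fun a b => a - b) (A0E u) (A0E v)) (esym (raddfB e _ _))))))).
have [u zu] : exists u, z = e u by apply/eL.
have itE i v : e (iter i A v) = iter i F (e v) by elim: i => //= i IH; rewrite AE -A0E IH.
rewrite zu A0E -AE; congr (e _); apply: (@net k A j) => //; last first.
  by apply: ei; rewrite itE -zu.
move=> x; have Lx : L (e x) by apply/eL; exists x.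
have [y /eL[v ->] h] := F3 _ Lx; exists v; apply: ei.
by rewrite raddfB raddfMn /= AE -A0E.
Qed.

Lemma hom_image (H Q : groupType) (f : H -> Q) : is_hom f ->
  exists (I : groupType) (g : H -> I) (i : I -> Q),
    [/\ is_hom g, is_hom i, injective i, forall h, i (g h) = f h
      & forall y, exists h, g h = y].
Proof.
move=> fM; pose P y := exists h, f h = y.
have P1 : P 1%g by exists 1%g; rewrite (hom1 fM).
have PM x y : P x -> P y -> P (x * y)%g.
  by move=> [a <-] [b <-]; exists (a * b)%g; rewrite fM.
have PV x : P x -> P x^-1%g by move=> [a <-]; exists a^-1%g; rewrite (homV fM).
pose S := sgroup P1 PM PV.
have fS h : f h \in S by apply/sgroupP; exists h.
exists (subgrp S), (sub_hom fS), sval; split.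
- exact: sub_hom_hom.
- exact: sval_hom.
- exact: sval_inj.
- by move=> h; exact: sub_homE.
- move=> y; have /sgroupP[h hy] := svalP y; exists h.
  by apply: val_inj; exact: etrans (sub_homE fS h) hy.
Qed.

Section Crep.
Variables (R : realType) (K : numClosedFieldType).

Lemma mx_torsion_free m n (x : 'M[K]_(m, n)) l : (0 < l)%N -> x *+ l = 0 -> x = 0.
Proof.
move=> l0 /matrixP e; apply/matrixP => i j; have := e i j; rewrite mulmxnE !mxE => /eqP.
by rewrite mulrn_eq0 eqn0Ngt l0 => /eqP.
Qed.

(* [pi] is a representation by matrices congruent to 1 modulo 3 in the order [L] *)
Definition crep n (N : groupType) (pi : N -> 'M[K]_n) (L : 'M[K]_n -> Prop) : Prop :=
  [/\ pi 1%g = 1%:M, forall x y, pi (x * y)%g = pi x *m pi y,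
    [/\ subzmod L, L 1%:M & forall x y, L x -> L y -> L (x *m y)],
    exists w, forall x, L x -> zspan w x
  & forall g, exists2 y, L y & pi g = 1%:M + y *+ 3].

Lemma crep_comp n (N H : groupType) (pi : N -> 'M[K]_n) L (i : H -> N) :
  is_hom i -> crep pi L -> crep (pi \o i) L.
Proof.
move=> iM [p1 pM sL wL p3]; split => //=; first by rewrite (hom1 iM).
by move=> x y; rewrite iM pM.
Qed.

Lemma crep_lattice n (N : groupType) (pi : N -> 'M[K]_n) L : crep pi L ->
  exists k, parametrised L k.
Proof.
move=> [_ _ [sL _ _] [w wL] _].
exact: (parametrised_fg (fun x l => @mx_torsion_free n n x l) sL wL).
Qed.

Section Conj.
Variables (n : nat) (N : groupType) (pi : N -> 'M[K]_n) (L : 'M[K]_n -> Prop).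
Hypothesis crp : crep pi L.

Let p1 : pi 1%g = 1%:M. Proof. by case: crp. Qed.
Let pM x y : pi (x * y)%g = pi x *m pi y. Proof. by case: crp. Qed.

Lemma crepV g : pi g *m pi g^-1%g = 1%:M.
Proof. by rewrite -pM mulgV. Qed.

Lemma crepVl g : pi g^-1%g *m pi g = 1%:M.
Proof. by rewrite -pM mulVg. Qed.

Definition conj_by g z := pi g *m z *m pi g^-1%g.

Lemma conj_byB g x y : conj_by g (x - y) = conj_by g x - conj_by g y.
Proof. by rewrite /conj_by mulmxBr mulmxBl. Qed.

Lemma conj_by1 z : conj_by 1%g z = z.
Proof. by rewrite /conj_by invg1 p1 mul1mx mulmx1. Qed.

Lemma conj_byM g h z : conj_by (g * h)%g z = conj_by g (conj_by h z).
Proof. by rewrite /conj_by invgM !pM !mulmxA. Qed.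

Lemma conj_by_fix g z : conj_by g z = z <-> pi g *m z = z *m pi g.
Proof.
split=> [{2}<-|e]; first by rewrite /conj_by -!mulmxA crepVl mulmx1.
by rewrite /conj_by e -mulmxA crepV mulmx1.
Qed.

Lemma conj_by_iter m g z : iter m (conj_by g) z = conj_by (g ^+ m)%g z.
Proof.
elim: m => [|m IH]; first by rewrite expg0 conj_by1.
by rewrite iterS IH expgS conj_byM.
Qed.

Lemma conj_by3 g z : L z -> exists2 y, L y & conj_by g z - z = y *+ 3.
Proof.
move=> Lz; have [_ _ [sL _ LM] _ p3] := crp.
have [a La ga] := p3 g; have [b Lb gb] := p3 g^-1%g.
exists (a *m z + z *m b + (a *m z *m b) *+ 3).
  apply: subzmodD => //; first by apply: subzmodD => //; exact: LM.
  by rewrite -[_ *+ 3]/(_ *~ 3); apply: subzmodMz => //; apply: (LM) => //; exact: LM.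
rewrite /conj_by ga gb mulmxDl mul1mx mulmxDr mulmx1 mulmxDl.
have mn (x y : 'M[K]_n) : (x *+ 3) *m y = (x *m y) *+ 3 by rewrite !mulrS !mulmxDl mulr0n mul0mx.
have nm (x y : 'M[K]_n) : x *m (y *+ 3) = (x *m y) *+ 3 by rewrite !mulrS !mulmxDr mulr0n mulmx0.
rewrite !mn !nm; apply/matrixP => i j; rewrite !(mulmxnE, mxE); ring.
Qed.

Lemma conj_by_isolated g z m : L z -> (0 < m)%N -> conj_by (g ^+ m)%g z = z ->
  conj_by g z = z.
Proof.
move=> Lz m0 e; have [k kL] := crep_lattice crp.
apply: (lattice_net (j := m) kL (conj_byB g) (conj_by3 g)) => //.
by rewrite conj_by_iter.
Qed.

(** Writing [pi y] as [1 + 3 z], an element commutes with [y] exactly when its conjugation fixes the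
    vector [z] of the lattice [L], where fixed vectors are isolated. *)
Lemma crep_isolated : injective pi -> isolated_centralisers N.
Proof.
move=> pin x y m m0 e; have [_ _ _ _ p3] := crp; have [z Lz yz] := p3 y.
have D g : conj_by g (pi y) = pi (g * y * g^-1)%g by rewrite /conj_by !pM.
have E g : conj_by g (pi y) - pi y = (conj_by g z - z) *+ 3.
  have c1 : conj_by g 1%:M = 1%:M by rewrite /conj_by mulmx1 crepV.
  rewrite yz -[z *+ 3]opprK conj_byB c1 opprK.
  have [f fE] := additive_ex (conj_byB g).
  by rewrite -!fE raddfN raddfMn /= !opprK opprD addrACA subrr add0r mulrnBl.
have zx : conj_by x z = z.
  apply: (conj_by_isolated Lz m0); apply/eqP; rewrite -subr_eq0; apply/eqP.
  by apply: (@mx_torsion_free _ _ _ 3) => //; rewrite -E D e mulgK subrr.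
have := E x; rewrite zx subrr mul0rn D => /eqP; rewrite subr_eq0 => /eqP/pin xy.
by rewrite /commutes -{2}xy mulgVK.
Qed.

(** Left multiplication by [pi x] is congruent to 1 modulo 3 on the lattice [L], and its [m]-th
    power fixes the vector 1. *)
Lemma crep_torsion x m : (0 < m)%N -> pi (x ^+ m)%g = 1%:M -> pi x = 1%:M.
Proof.
move=> m0 e; have [_ _ [sL L1 LM] _ p3] := crp; have [k kL] := crep_lattice crp.
have it l : iter l (mulmx (pi x)) 1%:M = pi (x ^+ l)%g.
  by elim: l => [|l IH]; rewrite ?expg0 ?p1 // expgS pM iterS IH.
suff : pi x *m 1%:M = 1%:M by rewrite mulmx1.
apply: (lattice_net (j := m) (F := mulmx (pi x)) kL) => //.
- by move=> a b; rewrite mulmxBr.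
- move=> a La; have [b Lb ->] := p3 x; exists (b *m a); first exact: LM.
  by rewrite mulmxDl mul1mx addrC addKr !mulrS !mulmxDl mulr0n mul0mx.
- by rewrite it.
Qed.

End Conj.

(** [W] is an eigenspace of [z], proper because [z] is not scalar and nonzero because the field is
    algebraically closed. Matrices act on row vectors; [r1] is the block on [W] and [r2] the block
    on the quotient, both multiplicative on the matrices preserving [W]. In the last clause [x] maps
    everything into [W], which [y] kills. *)
Lemma block_split n (z : 'M[K]_n) : (forall c, z <> c%:M) ->
  exists r s (W : 'M[K]_n) (r1 : 'M[K]_n -> 'M[K]_r) (r2 : 'M[K]_n -> 'M[K]_s),
  [/\ (r < n)%N /\ (s < n)%N, forall x, x *m z = z *m x -> (W *m x <= W)%MS,
    (r1 1%:M = 1%:M /\ r2 1%:M = 1%:M) /\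
      (forall x y, r1 (x - y) = r1 x - r1 y /\ r2 (x - y) = r2 x - r2 y),
    forall x y, (W *m x <= W)%MS -> (W *m y <= W)%MS ->
      r1 (x *m y) = r1 x *m r1 y /\ r2 (x *m y) = r2 x *m r2 y
  & forall x y, (W *m x <= W)%MS -> (W *m y <= W)%MS -> r2 x = 0 -> r1 y = 0 ->
      x *m y = 0].
Proof.
case: n z => [z zn|n z zn]; first by case: (zn 0); rewrite [z]flatmx0 [RHS]flatmx0.
have [a az] : exists a, root (char_poly z) a.
  by apply/closed_rootP; rewrite size_char_poly.
pose W := kermx (z - a%:M).
have W0 : W != 0 by move: az; rewrite -eigenvalue_root_char.
have Wn : (\rank W < n.+1)%N.
  rewrite ltn_neqAle rank_leq_row andbT; apply/negP => Wf.
  have /row_fullP[B BW] : row_full W by [].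
  apply: (zn a); apply/eqP; rewrite -subr_eq0 -[z - _]mul1mx -BW -mulmxA.
  by rewrite mulmx_ker mulmx0.
have [B' BB'] : exists B', row_base W *m B' = 1%:M by apply/row_freeP; exact: row_base_free.
pose B := row_base W; pose Q := col_base (cokermx W).
have [D DQ] : exists D, D *m Q = 1%:M by apply/row_fullP; exact: col_base_full.
have QW (m : nat) (u : 'M[K]_(m, n.+1)) : (u <= W)%MS = (u *m Q == 0).
  have h : u *m cokermx W = (u *m Q) *m row_base (cokermx W).
    by rewrite -mulmxA /Q mulmx_base.
  rewrite submxE h; apply/eqP/eqP => [e|->]; last by rewrite mul0mx.
  by apply: (row_free_inj (row_base_free (cokermx W))); rewrite e mul0mx.
have EB x : (W *m x <= W)%MS -> B *m x = (B *m x *m B') *m B.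
  move=> Wx; have : (B *m x <= B)%MS.
    rewrite (eqmxMr _ (eq_row_base W)) (submx_trans Wx) //.
    by rewrite eq_row_base.
  by move=> /submxP[E e]; rewrite e -[E *m B *m B']mulmxA BB' mulmx1.
have EQ x : (W *m x <= W)%MS -> x *m Q = Q *m (D *m x *m Q).
  move=> Wx; apply/eqP; rewrite -subr_eq0.
  have -> : x *m Q - Q *m (D *m x *m Q) = (1%:M - Q *m D) *m x *m Q.
    by rewrite mulmxBl mul1mx mulmxBl !mulmxA.
  rewrite -QW; apply: submx_trans Wx; apply: submxMr.
  by rewrite QW mulmxBl mul1mx -mulmxA DQ mulmx1 subrr.
exists (\rank W), (\rank (cokermx W)), W, (fun x => B *m x *m B'), (fun x => D *m x *m Q).
split.
- by split => //; rewrite mxrank_coker ltn_subrL lt0n mxrank_eq0 W0.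
- move=> x xz; apply/sub_kermxP; rewrite -mulmxA mulmxBr xz scalar_mxC -mulmxBl mulmxA.
  by rewrite mulmx_ker mul0mx.
- split; first by rewrite !mulmx1.
  by move=> x y; rewrite !mulmxBr !mulmxBl.
- move=> x y Wx Wy; split; first by rewrite [in LHS]mulmxA {1}(EB x Wx) -!mulmxA.
  by rewrite -!mulmxA {1}(EQ y Wy) -!mulmxA.
move=> x y Wx Wy xQ yB; have By : B *m y = 0 by rewrite EB // yB mul0mx.
have : (x <= W)%MS by rewrite QW EQ // xQ mulmx0.
rewrite -(eq_row_base W) => /submxP[E ->].
by rewrite -mulmxA -/B By mulmx0.
Qed.

(** * Induction on the degree of the representation *)

Section Induction.
Variable n : nat.
Hypothesis IH : forall m, (m < n)%N ->
  forall (N : groupType) (pi : N -> 'M[K]_m) (L : 'M[K]_m -> Prop),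
  enumerable N -> crep pi L -> injective pi -> HP R N.

(** The block of a matrix congruent to 1 modulo 3 in [L] is congruent to 1 modulo 3 in the image of
    [L]. So the image group falls under the induction hypothesis, and it has no torsion. *)
Lemma HP_crep_image m (N : groupType) (pi : N -> 'M[K]_n) (L : 'M[K]_n -> Prop)
    (rho : 'M[K]_n -> 'M[K]_m) : (m < n)%N -> enumerable N -> crep pi L ->
  rho 1%:M = 1%:M -> (forall x y, rho (x - y) = rho x - rho y) ->
  (forall x y, L x -> L y -> rho (x *m y) = rho x *m rho y) ->
  exists (I : groupType) (f : N -> I), [/\ is_hom f, HP R I, torsion_free_image f
    & forall x, f x = 1%g -> rho (pi x) = 1%:M].
Proof.
move=> mn eN crp r1 rB rM; have [p1 pM [sL L1 LM] [w wL] p3] := crp.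
have [ro roE] := additive_ex rB.
have Lp g : L (pi g).
  have [y Ly ->] := p3 g; apply: subzmodD => //.
  by rewrite -[_ *+ 3]/(_ *~ 3); apply: subzmodMz.
have rpM x y : rho (pi (x * y)%g) = rho (pi x) *m rho (pi y) by rewrite pM rM.
have un g : rho (pi g) \in unitmx.
  by apply: (proj1 (mulmx1_unit (B := rho (pi g^-1%g)) _)); rewrite -rpM mulgV p1.
pose g0 x : GL m K := exist _ (rho (pi x)) (un x).
have g0M : is_hom g0 by move=> x y; apply/val_inj; exact: rpM.
have [I [f [i [fM iM ii fi fs]]]] := hom_image g0M.
pose q (y : I) : 'M[K]_m := val (i y).
have qf x : q (f x) = rho (pi x) by rewrite /q fi.
have cq : crep q (fun y => exists2 x, L x & y = rho x).
  split.
  - by rewrite -(hom1 fM) qf p1.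
  - by move=> x y; rewrite /q iM.
  - split; first split.
    + by exists 0; [exact: sL.1|rewrite -roE raddf0].
    + by move=> _ _ [x Lx ->] [y Ly ->]; exists (x - y); [exact: sL.2|].
    + by exists 1%:M.
    + by move=> _ _ [x Lx ->] [y Ly ->]; exists (x *m y); [exact: LM|rewrite rM].
  - exists (map rho w) => _ [x /wL wx ->].
    apply: (zspan_sub (w := w) (A := fun x => zspan (map rho w) (rho x)) _ _ wx).
      have sz := zspan_subzmod (map rho w).
      by split => [|a b ? ?]; [rewrite -roE raddf0; exact: sz.1|rewrite rB; exact: sz.2].
    by move=> y yw; apply/zspan_mem/map_f.
  - move=> y; have [x <-] := fs y; have [z Lz xz] := p3 x; exists (rho z); first by exists z.
    by rewrite qf xz -!roE raddfD raddfMn /= !roE r1.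
have qi : injective q by move=> x y /val_inj/ii.
exists I, f; split => //.
- by apply: (IH mn _ cq qi); apply: (enumerable_surj fs).
- move=> x l l0; rewrite (homX fM) => e; apply: qi.
  have q1 : q 1%g = 1%:M by case: cq.
  by rewrite q1; apply: (crep_torsion cq l0); rewrite e q1.
- by move=> x x1; rewrite -qf x1 -(hom1 fM) qf p1.
Qed.

(** Both diagonal blocks have images covered by induction, and two extensions reduce to subgroups
    with virtually cyclic image in each. On the common kernel of the blocks the product of
    [pi x - 1] and [pi y - 1] vanishes, so that [pi - 1] is additive there and embeds the kernel
    into the lattice. *)
Lemma HP_commuting (N : groupType) (pi : N -> 'M[K]_n) (L : 'M[K]_n -> Prop) z :
  enumerable N -> crep pi L -> injective pi -> (forall c, z <> c%:M) ->
  (forall g, pi g *m z = z *m pi g) -> HP R N.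
Proof.
move=> eN crp pin zn comm.
have [r [s [W [r1 [r2 [[rn sn] Wz [[r11 r21] rB] rM rN]]]]]] := block_split zn.
pose P x := (W *m x <= W)%MS.
have PB x y : P x -> P y -> P (x - y).
  by move=> Px Py; rewrite /P mulmxBr addmx_sub ?eqmx_opp.
have P1 : P 1%:M by rewrite /P mulmx1.
have P3 y : P (y *+ 3) -> P y.
  rewrite /P -scaler_nat -scalemxAr eqmx_scale // pnatr_eq0 //.
have Pp g : P (pi g) by apply: Wz.
pose L1 x := L x /\ P x.
have cr1 : crep pi L1.
  have [p1 pM [sL L1' LM] [w wL] p3] := crp; split => //.
  - split; last first.
    + move=> x y [Lx Px] [Ly Py]; split; first exact: LM.
      by rewrite /P mulmxA (submx_trans _ Py) // submxMr.
    + by split.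
    + split; first by split; [exact: sL.1|rewrite /P mulmx0 sub0mx].
      by move=> x y [Lx Px] [Ly Py]; split; [exact: sL.2|exact: PB].
  - by exists w => x [/wL].
  - move=> g; have [y Ly gy] := p3 g; exists y => //; split => //; apply: P3.
    by have := PB _ _ (Pp g) P1; rewrite gy addrC addKr.
have [||I1 [f1 [f1M hp1 t1 k1]]] := HP_crep_image rn eN cr1 r11.
- by move=> x y; case: (rB x y).
- by move=> x y [_ Px] [_ Py]; case: (rM x y Px Py).
have [||I2 [f2 [f2M hp2 t2 k2]]] := HP_crep_image sn eN cr1 r21.
- by move=> x y; case: (rB x y).
- by move=> x y [_ Px] [_ Py]; case: (rM x y Px Py).
apply: (HP_ext hp1 f1M) => H1 i1 i1M i1i v1.
have f2i1 : is_hom (f2 \o i1) by exact: hom_comp.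
apply: (HP_ext hp2 f2i1) => H2 i2 i2M i2i v2.
pose i := i1 \o i2; have iM : is_hom i by exact: hom_comp.
have ii : injective i by exact: inj_comp.
have [k [e [ei eL]]] := crep_lattice cr1.
have Fx x : exists u, pi (i x) - 1%:M = e u.
  apply/eL; have [_ _ [sL _ _] _ /(_ (i x))[y Ly ->]] := cr1.
  by rewrite addrC addKr -[_ *+ 3]/(_ *~ 3); apply: subzmodMz.
pose ka x := sval (cid (Fx x)).
have kaE x : pi (i x) - 1%:M = e (ka x) := svalP (cid (Fx x)).
have p1 : pi 1%g = 1%:M by case: crp.
have f1i : is_hom (f1 \o i) by exact: hom_comp.
have f2i : is_hom (f2 \o i) by exact: hom_comp.
apply: (@HP_two_cyclic R H2 I1 I2 (f1 \o i) (f2 \o i) k ka) => //.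
- by have := vcimg_sub i2M (hom_comp i1M f1M) v1.
- exact: torsion_free_image_sub.
- exact: torsion_free_image_sub.
- exact: isolated_centralisers_sub iM ii (crep_isolated crp pin).
- move=> x y /= x1 x2 y1 y2; apply: ei; rewrite raddfD -!kaE iM.
  have := rN (pi (i x) - 1%:M) (pi (i y) - 1%:M).
  have r0 (m : nat) (f : 'M[K]_n -> 'M[K]_m) g : (forall a b, f (a - b) = f a - f b) ->
      f 1%:M = 1%:M -> f (pi g) = 1%:M -> f (pi g - 1%:M) = 0.
    by move=> -> -> ->; rewrite subrr.
  rewrite (r0 _ r1) ?(r0 _ r2) ?k1 ?k2 //; last 2 first.
  + by move=> a b; case: (rB a b).
  + by move=> a b; case: (rB a b).
  move=> /(_ (PB _ _ (Pp _) P1) (PB _ _ (Pp _) P1) erefl erefl).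
  have -> : pi (i x * i y)%g = pi (i x) *m pi (i y) by case: crp.
  rewrite mulmxBl mulmxBr mulmx1 mul1mx => /eqP; rewrite subr_eq0 => /eqP h.
  by rewrite -h; apply/matrixP => a b; rewrite !mxE; ring.
- move=> x /= _ _ x0; apply: ii; rewrite (hom1 iM); apply: pin.
  by apply/eqP; rewrite p1 -subr_eq0 kaE x0 raddf0.
Qed.

(** [n] times the usual traceless part, which avoids a division; its kernel consists of scalar
    matrices. *)
Definition traceless (z : 'M[K]_n) : 'M[K]_n := n%:R *: z - (\tr z)%:M.

Lemma tracelessB x y : traceless (x - y) = traceless x - traceless y.
Proof.
have tB : \tr (x - y) = \tr x - \tr y by exact: raddfB.
by apply/matrixP => i j; rewrite /traceless tB !mxE mulrnBl; ring.
Qed.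

Lemma traceless_scalar z c : traceless z = c%:M -> exists d, z = d%:M.
Proof.
move=> e; have [n0|n0] := posnP n.
  by exists 0; apply/matrixP => -[i i_lt]; exfalso; rewrite n0 in i_lt.
exists (n%:R^-1 * (c + \tr z)); apply: (@scalerI _ _ n%:R); first by rewrite pnatr_eq0 -lt0n.
rewrite scale_scalar_mx mulrA mulfV ?pnatr_eq0 -?lt0n // mul1r raddfD /= -e.
by rewrite /traceless subrK.
Qed.

Lemma traceless_tr z : \tr (traceless z) = 0.
Proof. by rewrite /traceless raddfB /= mxtraceZ mxtrace_scalar mulr_natl subrr. Qed.

Lemma HP_crep_step (N : groupType) (pi : N -> 'M[K]_n) (L : 'M[K]_n -> Prop) :
  enumerable N -> crep pi L -> injective pi -> HP R N.
Proof.
move=> eN crp pin; have [p1 pM [sL L1 LM] [w wL] p3] := crp.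
have [sc|/existsNP[z0 /not_implyP[Lz0 zn0]]] := pselect (forall x, L x -> exists c, x = c%:M).
  apply: (@HP_abelian R N eN).
    move=> x y; apply: pin; rewrite !pM.
    have [a /sc[c ->] ->] := p3 x.
    have -> : c%:M *+ 3 = (c *+ 3)%:M :> 'M[K]_n by rewrite raddfMn.
    by rewrite -raddfD /= scalar_mxC.
  by move=> x l l0 xl; apply: pin; rewrite p1; apply: (crep_torsion crp l0); rewrite xl.
pose M y := exists2 z, L z & y = traceless z.
have [T TE] := additive_ex tracelessB.
have sM : subzmod M.
  split; first by exists 0; [exact: sL.1|rewrite -TE raddf0].
  by move=> _ _ [x Lx ->] [y Ly ->]; exists (x - y); [exact: sL.2|rewrite tracelessB].
have wM y : M y -> zspan (map traceless w) y.
  move=> [z /wL wz ->].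
  apply: (zspan_sub (w := w) (A := fun x => zspan (map traceless w) (traceless x)) _ _ wz).
    have sz := zspan_subzmod (map traceless w).
    by split => [|a b ? ?]; [rewrite -TE raddf0; exact: sz.1|rewrite tracelessB; exact: sz.2].
  by move=> y' yw; apply/zspan_mem/map_f.
have [k [e [ei eM]]] := parametrised_fg (fun x l => @mx_torsion_free n n x l) sM wM.
have kM : parametrised M k by exists e.
have cT g z : conj_by pi g (traceless z) = traceless (conj_by pi g z).
  rewrite /conj_by /traceless mulmxBr mulmxBl -scalemxAr -scalemxAl; congr (_ - _).
  rewrite scalar_mxC -[in LHS]mulmxA (crepV crp) mulmx1; congr (_%:M).
  by rewrite mxtrace_mulC mulmxA (crepVl crp) mul1mx.
have cM3 g x : M x -> exists2 y, M y & conj_by pi g x - x = y *+ 3.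
  move=> [z Lz ->]; have [y Ly yz] := conj_by3 crp g Lz; exists (traceless y); first by exists y.
  by rewrite cT -tracelessB yz -!TE raddfMn.
have cMe g u : exists v, conj_by pi g (e u) = e v.
  have [y My h] := cM3 g (e u) ((eM _).2 (ex_intro _ u erefl)).
  apply/eM; rewrite -[conj_by _ _ _](subrK (e u)) h; apply: subzmodD => //.
    by rewrite -[_ *+ 3]/(_ *~ 3); apply: subzmodMz.
  by apply/eM; exists u.
pose a g u := sval (cid (cMe g u)).
have aE g u : e (a g u) = conj_by pi g (e u) := esym (svalP (cid (cMe g u))).
have eM' u : M (e u) by apply/eM; exists u.
apply: (@HP_row R k N a).
- split=> [u|g h u]; apply: ei; first by rewrite aE (conj_by1 crp).
  by rewrite !aE (conj_byM crp).
- by move=> g x y; apply: ei; rewrite raddfB !aE raddfB conj_byB.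
- move=> g x l l0 fx; apply: ei; rewrite aE.
  have itE i : e (iter i (a g) x) = iter i (conj_by pi g) (e x).
    by elim: i => //= i <-; rewrite aE.
  apply: (lattice_net (j := l) kM (conj_byB pi g) (cM3 g)) => //.
  by rewrite -itE fx.
- move=> g; have [y Ly gy] := p3 g.
  have [x [u [xu x0 cx]]] : exists x u, [/\ x = e u, x != 0 & pi g *m x = x *m pi g].
    (* If the traceless part of [y] vanishes, then [g] is represented by a scalar and every vector
       is fixed; the nonscalar [z0] supplies a nonzero one. *)
    have [ty|ty] := eqVneq (traceless y) 0.
      have [d yd] : exists d, y = d%:M by apply: (@traceless_scalar y 0); rewrite ty raddf0.
      have [u tu] : exists u, traceless z0 = e u by apply/eM; exists z0.
      exists (traceless z0), u; split => //.
        apply/eqP => t0; apply: zn0; apply: (@traceless_scalar z0 0); by rewrite t0 raddf0.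
      rewrite gy yd.
      have -> : d%:M *+ 3 = (d *+ 3)%:M :> 'M[K]_n by rewrite raddfMn.
      by rewrite -raddfD /= scalar_mxC.
    have [u tu] : exists u, traceless y = e u by apply/eM; exists y.
    exists (traceless y), u; split => //.
    have cy : pi g *m y = y *m pi g.
      by rewrite gy mulmxDl mulmxDr mul1mx mulmx1 !mulrS !mulmxDl !mulmxDr mulr0n mulmx0 mul0mx.
    by rewrite /traceless mulmxBr mulmxBl -scalemxAr -scalemxAl cy scalar_mxC.
  exists u; first by apply: contra_neq x0 => u0; rewrite xu u0 raddf0.
  by apply: ei; rewrite aE -xu; apply/(conj_by_fix crp).
move=> v v0 H i iM ii fv.
have ev0 : e v != 0 by apply: contra_neq v0 => h; apply: ei; rewrite h raddf0.
have [z Lz vz] := eM' v.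
apply: (@HP_commuting H (pi \o i) L (e v)).
- exact: enumerable_inj ii eN.
- exact: crep_comp.
- exact: inj_comp.
(* A scalar matrix of trace 0 is 0, in characteristic 0 and positive degree; so a nonzero vector of
   this lattice is never scalar. *)
- move=> c vc; move/eqP: ev0; apply.
  have n0 : n != 0%N.
    by apply: contra_notN zn0 => /eqP n0; exists 0; apply/matrixP => -[l l_lt]; exfalso; rewrite n0 in l_lt.
  have := traceless_tr z; rewrite -vz vc mxtrace_scalar => /eqP.
  by rewrite mulrn_eq0 (negbTE n0) /= => /eqP ->; rewrite raddf0.
- by move=> h /=; apply/(conj_by_fix crp); rewrite -aE fv.
Qed.

End Induction.

Lemma HP_crep n (N : groupType) (pi : N -> 'M[K]_n) (L : 'M[K]_n -> Prop) :
  enumerable N -> crep pi L -> injective pi -> HP R N.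
Proof. by elim/ltn_ind: n N pi L => n IH N pi L; exact: HP_crep_step. Qed.

End Crep.

(** * Words *)

Section Words.
Variable m : nat.
Notation word := (seq 'I_m).
Implicit Types u v w : word.

(* [u] is smaller than [v] at the first letter where they differ; false if one of them
   is a prefix of the other *)
Fixpoint prec u v : bool :=
  match u, v with
  | x :: u', y :: v' => (x < y)%N || ((x == y) && prec u' v')
  | _, _ => false
  end.

Lemma prec_trans : transitive prec.
Proof.
elim=> [|y v IH] [|x u] [|z w] //=.
move=> /orP[xy|/andP[/eqP -> uv]] /orP[yz|/andP[/eqP <- vw]].
- by rewrite (ltn_trans xy yz).
- by rewrite xy.
- by rewrite yz.
- by rewrite eqxx (IH _ _ uv vw) orbT.
Qed.

Lemma prec_irr u : prec u u = false.
Proof. by elim: u => //= x u ->; rewrite ltnn andbF. Qed.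

Lemma prec_catl p u v : prec (p ++ u) (p ++ v) = prec u v.
Proof. by elim: p => //= x p ->; rewrite ltnn eqxx. Qed.

Lemma prec_catr u v s t : prec u v -> prec (u ++ s) (v ++ t).
Proof.
elim: u v => [|x u IH] [|y v] //= /orP[->//|/andP[/eqP -> uv]].
by rewrite eqxx IH // orbT.
Qed.

Lemma prec_total u v : (size v <= size u)%N -> [|| prec u v, prec v u | prefix v u].
Proof.
elim: u v => [|x u IH] [|y v] //=.
rewrite ltnS => /IH; rewrite [y == x]eq_sym.
by case: ltngtP => /= [//|_|/val_inj <-]; rewrite ?orbT ?eqxx.
Qed.

(** The word read in base [m]: among words of equal length this turns the lexicographic order into
    the order of natural numbers, on which one can induct. *)
Definition lex_num w : nat := foldl (fun c (x : 'I_m) => c * m + x)%N 0%N w.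

Lemma lex_num_foldl w c : foldl (fun c (x : 'I_m) => c * m + x)%N c w = (c * m ^ size w + lex_num w)%N.
Proof.
rewrite /lex_num; elim: w c => [|x w IH] c /=; first by rewrite muln1 addn0.
by rewrite IH [in RHS]IH expnS mul0n add0n mulnDl addnA mulnA.
Qed.

Lemma lex_num_cons x w : lex_num (x :: w) = (x * m ^ size w + lex_num w)%N.
Proof. by rewrite /lex_num /= mul0n add0n lex_num_foldl. Qed.

Lemma lex_num_lt w : (lex_num w < m ^ size w)%N.
Proof.
elim: w => [|x w IH]; first by rewrite /lex_num.
rewrite lex_num_cons /= expnS; apply: leq_trans (_ : (x.+1 * m ^ size w <= _)%N).
  by rewrite mulSn addnC ltn_add2r.
by rewrite leq_mul2r ltn_ord orbT.
Qed.

Lemma prec_lex_num u v : size u = size v -> prec u v -> (lex_num u < lex_num v)%N.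
Proof.
elim: u v => [|x u IH] [|y v] //= [suv] /orP[xy|/andP[/eqP -> /(IH _ suv) uv]]; last first.
  by rewrite !lex_num_cons suv ltn_add2l.
rewrite !lex_num_cons suv; apply: leq_trans (leq_addr _ _).
apply: leq_trans (_ : (x.+1 * m ^ size v <= _)%N); last by rewrite leq_mul2r xy orbT.
by rewrite mulSn addnC ltn_add2r -suv lex_num_lt.
Qed.

Definition descending (L : seq word) : bool := pairwise (fun u v => prec v u) L.

(** At the first place where the permuted list differs it has a factor that stands later in [L],
    hence a strictly smaller one. As [prec] is decided at a differing letter, whatever follows is
    irrelevant. *)
Lemma descending_flatten L L' : descending L -> perm_eq L' L -> L' != L ->
  prec (flatten L') (flatten L).
Proof.
elim: L L' => [|a L IH] L'; first by move=> _ /perm_nilP ->.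
rewrite /descending /= => /andP[/allP aL dL].
case: L' => [|b L'] pL; first by have := perm_size pL.
move: pL; have [->|ba] := eqVneq b a => pL ne /=.
  rewrite prec_catl; apply: IH => //; first by rewrite perm_cons in pL.
  by apply: contra_neq ne => ->.
apply/prec_catr/aL; have := perm_mem pL b; rewrite !inE eqxx (negbTE ba) /=.
by move=> <-.
Qed.

Lemma descending_uniq L : descending L -> uniq L.
Proof.
elim: L => //= a L IH /andP[/allP aL dL]; rewrite IH // andbT.
by apply/negP => /aL; rewrite prec_irr.
Qed.

Lemma descending_prefix (S L : seq word) : all2 (@prefix 'I_m) S L -> descending S -> descending L.
Proof.
elim: S L => [|s S IH] [|a L] //= /andP[sa SL] /andP[sS dS].
rewrite /descending /= -/(descending L) (IH L SL dS) andbT.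
elim: S L SL sS {IH dS} => [|t S IH] [|b L] //= /andP[tb SL] /andP[ts sS].
rewrite (IH L SL sS) andbT; move: sa tb => /prefixP[p ->] /prefixP[q ->].
exact: prec_catr.
Qed.

Lemma periodic e k v : prefix (drop e v) v -> (k * e <= size v)%N ->
  take (k * e) v = flatten (nseq k (take e v)).
Proof.
elim: k => [|k IH] pv kv; first by rewrite mul0n take0.
rewrite mulSn takeD /=; congr (_ ++ _).
have /prefixP[t vt] := pv.
have ke : (k * e <= size (drop e v))%N by rewrite size_drop leq_subRL; lia.
rewrite -IH //; last by lia.
by rewrite {2}vt takel_cat.
Qed.

Lemma pigeon (T : eqType) (U bs : seq T) c : {subset bs <= U} ->
  (size U * c < size bs)%N -> exists z, z \in U /\ (c < count_mem z bs)%N.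
Proof.
elim: U bs => [|z U IH] bs sb lt.
  by case: bs sb lt => // b bs /(_ b); rewrite mem_head => /(_ isT).
have [cz|cz] := ltnP c (count_mem z bs); first by exists z; rewrite mem_head.
have [|| y [yU cy]] := IH [seq b <- bs | b != z].
- move=> b; rewrite mem_filter => /andP[bz /sb]; rewrite inE (negbTE bz) //.
- rewrite size_filter; have := count_predC (pred1 z) bs.
  have -> : count (predC (pred1 z)) bs = count (fun b => b != z) bs by apply: eq_count.
  by move: lt cz => /=; rewrite mulSn; lia.
exists y; split; first by rewrite inE yU orbT.
apply: leq_trans cy _; rewrite count_filter; apply: sub_count => b /=.
by case/andP.
Qed.

Lemma blocks l c w : (c * l <= size w)%N -> exists bs y,
  [/\ w = flatten bs ++ y, size bs = c & forall b, b \in bs -> size b = l].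
Proof.
elim: c w => [|c IH] w cw; first by exists [::], w.
have [|bs [y [e sb bl]]] := IH (drop l w).
  by rewrite size_drop leq_subRL; lia.
exists (take l w :: bs), y; split => /=; first by rewrite -catA -e cat_take_drop.
  by rewrite sb.
move=> b; rewrite inE => /orP[/eqP ->|/bl //].
by rewrite size_takel //; apply: leq_trans cw; rewrite mulSn leq_addr.
Qed.

Lemma occurrences z c bs : (c <= count_mem z bs)%N -> exists w0 gs,
  flatten bs = w0 ++ flatten [seq z ++ g | g <- gs] /\ size gs = c.
Proof.
elim: bs c => [|b bs IH] c.
  by rewrite leqn0 => /eqP ->; exists [::], [::].
case: c => [_|c]; first by exists (flatten (b :: bs)), [::]; rewrite cats0.
rewrite /=; have [->|bz] := eqVneq b z.
  rewrite add1n ltnS => /IH[w0 [gs [-> sg]]].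
  by exists [::], (w0 :: gs); rewrite /= -!catA sg.
rewrite add0n => /IH[w0 [gs [-> sg]]].
by exists (b ++ w0), gs; rewrite -catA.
Qed.

(** If [z = q_i s_i] for each [i], the word [z g_1 z g_2 ...] regroups as
    [q_1 (s_1 g_1 q_2) (s_2 g_2 q_3) ...], whose factors begin with the prescribed suffixes. *)
Lemma cut_at_suffixes z S gs : size S = size gs ->
  (forall s, s \in S -> exists q, z = q ++ s) -> exists q L,
  [/\ flatten [seq z ++ g | g <- gs] = q ++ flatten L, size L = size gs & all2 (@prefix 'I_m) S L].
Proof.
elim: S gs => [|s S IH] [|g gs] //=; first by move=> _ _; exists [::], [::].
move=> [sS] suf; have [|q' [L [e sL pL]]] := IH gs sS.
  by move=> t tS; apply: suf; rewrite inE tS orbT.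
have [q zq] : exists q, z = q ++ s by apply: suf; rewrite mem_head.
exists q, ((s ++ g ++ q') :: L); split => /=.
- by rewrite e {1}zq -!catA.
- by rewrite sL.
- by rewrite prefix_prefix pL.
Qed.

(* Some block [z] of length [l] has [d] disjoint occurrences. If one of the first [d]
   suffixes of [z] is a prefix of another, [z] has a small period; otherwise cutting the
   word at these suffixes, in decreasing order, produces a descending product. *)
Lemma shirshov d k : exists N, forall w, (N <= size w)%N ->
  (exists x u y, [/\ w = x ++ flatten (nseq k u) ++ y, (0 < size u)%N & (size u < d)%N]) \/
  (exists x L y, [/\ w = x ++ flatten L ++ y, size L = d & descending L]).
Proof.
(* After fewer than [d] letters are dropped, a block of this length still has room for [k] periods
   of length less than [d]. *)
pose l := (k * d + d)%N; pose U := [seq val t | t : l.-tuple 'I_m].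
exists ((size U * d).+1 * l)%N => w /blocks[bs [y [wE sb bl]]].
have [||z [zU cz]] := @pigeon _ U bs d.
- move=> b bb; have sbl : size b == l by rewrite bl.
  by apply/mapP; exists (Tuple sbl); rewrite ?mem_enum.
- by rewrite sb.
have sz : size z = l by case/mapP: zU => t _ ->; rewrite size_tuple.
have [w0 [gs [bE sg]]] := occurrences (ltnW cz).
have [[i [j [ij jd pre]]]|no] :=
  pselect (exists i j, [/\ (i < j)%N, (j < d)%N & prefix (drop j z) (drop i z)]).
  left; pose v := drop i z; pose e := (j - i)%N.
  have pv : prefix (drop e v) v by rewrite drop_drop subnK // ltnW.
  have ke : (k * e <= size v)%N.
    rewrite size_drop sz /l; have : (k * e <= k * d)%N by rewrite leq_mul2l; lia.
    lia.
  have zE : z = take i z ++ flatten (nseq k (take e v)) ++ drop (k * e) v.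
    by rewrite -(periodic pv ke) cat_take_drop cat_take_drop.
  have zb : z \in bs by rewrite -has_pred1 has_count; apply: leq_ltn_trans cz.
  have [b1 [b2 bsE]] : exists b1 b2, bs = b1 ++ z :: b2.
    by case/splitPr: zb => b1 b2; exists b1, b2.
  exists (flatten b1 ++ take i z), (take e v), (drop (k * e) v ++ flatten b2 ++ y).
  rewrite wE bsE flatten_cat /= {1}zE -!catA; split => //.
    by rewrite size_take size_drop sz; case: ifP; lia.
  by rewrite size_take size_drop sz; case: ifP; lia.
right; pose T := [seq drop i z | i <- iota 0 d].
pose leT u v := (u == v) || prec v u.
have leT_trans : transitive leT.
  move=> b a c /orP[/eqP -> //|ba] /orP[/eqP <-|cb]; first by rewrite /leT ba orbT.
  by rewrite /leT (prec_trans cb ba) orbT.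
have inc i j : (i < j)%N -> (j < d)%N -> prec (drop i z) (drop j z) || prec (drop j z) (drop i z).
  move=> ij jd; have := @prec_total (drop i z) (drop j z).
  have -> : (size (drop j z) <= size (drop i z))%N by rewrite !size_drop; lia.
  move=> /(_ isT)/or3P[->//|->|pre]; first by rewrite orbT.
  by case: no; exists i, j.
have TP a : a \in T -> exists2 i, (i < d)%N & a = drop i z.
  by move=> /(@seq.mapP nat _ (fun i => drop i z))[i ii ->]; exists i => //; move: ii; rewrite mem_iota.
have tot : {in T &, total leT}.
  move=> a b /TP[i id ->] /TP[j jd ->]; rewrite /leT.
  have [ij|ij|->] := ltngtP i j; last by rewrite eqxx.
    by have /orP[->|->] := inc i j ij jd; rewrite !orbT.
  by have /orP[->|->] := inc j i ij id; rewrite !orbT.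
have uT : uniq T.
  rewrite map_inj_in_uniq ?iota_uniq // => i j; rewrite !mem_iota !add0n => /andP[_ id] /andP[_ jd].
  move=> /(congr1 size); rewrite !size_drop sz /l; lia.
pose S := sort leT T.
have dS : descending S.
  have srt : sorted leT S by apply: (sort_sorted_in tot); apply/allP.
  have : pairwise leT S by rewrite -sorted_pairwise.
  have uS : uniq S by rewrite sort_uniq.
  elim: (S) uS => //= a s IH /andP[as' us] /andP[al pw]; rewrite /descending /= -/(descending s) IH // andbT.
  apply/allP => b bs'; have /allP/(_ b bs')/orP[/eqP ab|//] := al.
  by rewrite ab bs' in as'.
have [||q [L [LE sL pL]]] := @cut_at_suffixes z S gs.
- by rewrite size_sort size_map size_iota.
- move=> s; rewrite mem_sort => /TP[i _ ->]; exists (take i z).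
  by rewrite cat_take_drop.
exists (w0 ++ q), L, y; split; first by rewrite wE bE LE -!catA.
  by rewrite sL.
exact: descending_prefix dS.
Qed.

End Words.

(** * An alternating identity for matrices *)

Section StandardIdentity.
Variables (K : fieldType) (n : nat).

(** There is one factor more than the dimension of the matrix algebra. Expanded in matrix units, the
    alternating sum has as coefficients the determinants of the [Mg g], and two rows of each agree
    because [g] cannot be injective. *)
Lemma standard_identity (X : 'I_(n.+1 * n.+1).+1 -> 'M[K]_n.+1) :
  \sum_(s : 'S_(n.+1 * n.+1).+1) (-1) ^+ s *: \prod_i X (s i) = 0 :> 'M[K]_n.+1.
Proof.
pose d := (n.+1 * n.+1).+1.
pose E (e : 'I_n.+1 * 'I_n.+1) : 'M[K]_n.+1 := delta_mx e.1 e.2.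
have XE i : X i = \sum_(e : 'I_n.+1 * 'I_n.+1) X i e.1 e.2 *: E e.
  by rewrite {1}[X i]matrix_sum_delta pair_bigA.
pose Mg (g : {ffun 'I_d -> 'I_n.+1 * 'I_n.+1}) : 'M[K]_d := \matrix_(i, j) X j (g i).1 (g i).2.
transitivity (\sum_(g : {ffun 'I_d -> 'I_n.+1 * 'I_n.+1}) \det (Mg g) *: \prod_i E (g i)).
  under eq_bigr => s _.
    under eq_bigr => i _ do rewrite XE.
    rewrite bigA_distr_bigA scaler_sumr; over.
  rewrite exchange_big; apply: eq_bigr => g _ /=.
  rewrite /determinant scaler_suml; apply: eq_bigr => s _.
  rewrite scaler_prod scalerA; congr (_ * _ *: _).
  by apply: eq_bigr => i _; rewrite mxE.
rewrite big1 // => g _.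
have : ~~ injectiveb g.
  apply/negP => /injectiveP/leq_card; rewrite card_ord card_prod !card_ord.
  by rewrite ltnn.
move=> /injectivePn[i [j ij gij]].
rewrite (@determinant_alternate _ _ (Mg g) i j) ?scale0r // => l.
by rewrite !mxE gij.
Qed.

End StandardIdentity.

(** * Integrality *)

Lemma subzmod_sum (V : zmodType) (A : V -> Prop) (I : Type) (r : seq I) (P : pred I)
    (F : I -> V) :
  subzmod A -> (forall i, P i -> A (F i)) -> A (\sum_(i <- r | P i) F i).
Proof.
move=> sA AF; apply: (big_ind A) => //; first by case: sA.
by move=> x y; exact: subzmodD.
Qed.

Section IntegralMatrix.
Variables (K : closedFieldType) (n : nat) (g : 'M[K]_n.+1).
Hypothesis gi : forall i, integralOver (intr : int -> K) (char_poly g)`_i.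

(** The eigenvalues are algebraic integers, as roots of a monic polynomial with integral
    coefficients. The product of monic integer polynomials vanishing at them is a multiple of the
    characteristic polynomial, so it annihilates [g] by Cayley-Hamilton. *)
Lemma integral_matrix : exists D (c : nat -> int), g ^+ D = \sum_(i < D) g ^+ i *~ c i.
Proof.
have [rs rE] := closed_field_poly_normal (char_poly g).
rewrite (monicP (char_poly_monic g)) scale1r in rE.
have ri z : z \in rs -> integralOver (intr : int -> K) z.
  move=> zr; apply: (@integral_root_monic _ _ _ _ (char_poly g)).
  - exact: char_poly_monic.
  - by rewrite rE root_prod_XsubC.
  - by move=> _ /(nthP 0)[i _ <-].
have [P Pm [q Pq]] : exists2 P : {poly int}, P \is monic &
    exists q, map_poly intr P = q * \prod_(z <- rs) ('X - z%:P) :> {poly K}.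
  elim: (rs) ri => [_|z s IH zs].
    by exists 1; [exact: monic1|exists 1; rewrite big_nil rmorph1 mulr1].
  have [|P Pm [q Pq]] := IH; first by move=> y ys; apply: zs; rewrite inE ys orbT.
  have [p pm /factor_theorem[q' pq]] := zs z (mem_head _ _).
  exists (p * P); first by rewrite monicMl.
  by exists (q' * q); rewrite big_cons rmorphM /= pq Pq mulrACA.
pose phi (p : {poly int}) := horner_mx g (map_poly intr p).
have phi0 : phi P = 0.
  by rewrite /phi Pq -rE rmorphM /= Cayley_Hamilton mulr0.
have phiX i (c : int) : phi (c *: 'X^i) = g ^+ i *~ c.
  rewrite /phi map_polyZ map_polyXn linearZ rmorphXn /= horner_mx_X.
  by rewrite scaler_int.
have phiS (I : finType) (F : I -> {poly int}) : phi (\sum_i F i) = \sum_i phi (F i).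
  by rewrite /phi !raddf_sum.
have sP : size P = (size P).-1.+1 by rewrite prednK // size_poly_gt0 monic_neq0.
exists (size P).-1, (fun i => - P`_i); apply/eqP; rewrite -subr_eq0; apply/eqP.
rewrite -[RHS]phi0 -[P in RHS]coefK poly_def sP phiS big_ord_recr /= phiX.
rewrite -[P`_ _]/(lead_coef P) (monicP Pm) addrC -sumrN; congr (_ + _).
by apply: eq_bigr => i _; rewrite phiX mulrNz opprK.
Qed.

End IntegralMatrix.

(** * The additive group spanned by the words in finitely many matrices *)

Section Span.
Variables (K : fieldType) (n m : nat) (a : 'I_m -> 'M[K]_n.+1).

Definition ev (w : seq 'I_m) : 'M[K]_n.+1 := \prod_(x <- w) a x.

Lemma ev_cat u v : ev (u ++ v) = ev u * ev v.
Proof. by rewrite /ev big_cat. Qed.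

Lemma ev_nseq k u : ev (flatten (nseq k u)) = ev u ^+ k.
Proof.
elim: k => [|k IH]; first by rewrite /ev big_nil.
by rewrite /= ev_cat IH exprS.
Qed.

Lemma ev_flatten I (s : seq I) (f : I -> seq 'I_m) :
  ev (flatten [seq f i | i <- s]) = \prod_(i <- s) ev (f i).
Proof.
elim: s => [|i s IH]; first by rewrite /ev !big_nil.
by rewrite /= ev_cat IH big_cons.
Qed.

Definition short_words N : seq (seq 'I_m) :=
  flatten [seq [seq val t | t <- enum {: l.-tuple 'I_m}] | l <- iota 0 N].

Lemma mem_short_words N w : (size w < N)%N -> w \in short_words N.
Proof.
move=> wN; apply/flattenP; exists [seq val t | t <- enum {: (size w).-tuple 'I_m}].
  by apply: (map_f (fun l => [seq val t | t <- enum {: l.-tuple 'I_m}])); rewrite mem_iota.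
by apply/mapP; exists (in_tuple w); rewrite ?mem_enum.
Qed.

Hypothesis integral : forall w, exists D (c : nat -> int),
  ev w ^+ D = \sum_(i < D) ev w ^+ i *~ c i.

Lemma span_words : exists B, forall w, zspan B (ev w).
Proof.
pose d := (n.+1 * n.+1).+1.
pose De w := sval (cid (integral w)).
have DeP w : exists c : nat -> int, ev w ^+ De w = \sum_(i < De w) ev w ^+ i *~ c i.
  exact: svalP (cid (integral w)).
(* A power large enough for the integral relation of every word of length less than [d]: the sum of
   their degrees bounds each one. *)
pose k := (\sum_(u <- short_words d) De u)%N.
have Dk u : (size u < d)%N -> (De u <= k)%N.
  by move=> /mem_short_words ud; rewrite /k (big_rem u ud) leq_addr.
have [N NP] := shirshov m d k.
exists [seq ev w | w <- short_words N]; set B := map _ _.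
have zB := zspan_subzmod B.
suff H s c (w : seq 'I_m) : size w = s -> lex_num w = c -> zspan B (ev w) by move=> w; exact: (H _ _ w erefl erefl).
(* The outer induction is on the length, the inner one on [lex_num]: an integral relation shortens
   the word, while the alternating identity keeps the length and lowers the number. *)
elim/ltn_ind: s c w => s IHs c; elim/ltn_ind: c => c IHc w sw cw.
have [wN|/NP[]] := ltnP (size w) N.
- by apply/zspan_mem/map_f/mem_short_words.
- move=> [x [u [y [wE u0 ud]]]]; have [e eE] := DeP u.
  have kE : k = (De u + (k - De u))%N by rewrite subnKC // Dk.
  have sz i : size (flatten (nseq i u)) = (i * size u)%N.
    by elim: i => //= i IH; rewrite size_cat IH mulSn.
  have nk i j : flatten (nseq (i + j) u) = flatten (nseq i u) ++ flatten (nseq j u).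
    by elim: i => //= i ->; rewrite catA.
  rewrite wE kE nk !ev_cat ev_nseq eE mulr_suml mulr_suml mulr_sumr.
  apply: subzmod_sum => // i _; rewrite !mulrzAl mulrzAr; apply: subzmodMz => //.
  rewrite -!ev_nseq -!ev_cat; apply: (IHs _ _ _ _ erefl erefl).
  rewrite -sw wE {2}kE nk !size_cat !sz ltn_add2l ltn_add2r ltn_add2r.
  by rewrite ltn_mul2r u0 /=.
move=> [x [L [y [wE sL dL]]]].
pose X (i : 'I_d) := ev (nth [::] L i).
pose Ls (s : 'S_d) := [seq nth [::] L (s i) | i <- enum 'I_d].
have LE : L = [seq nth [::] L (nat_of_ord i) | i <- enum 'I_d].
  rewrite (map_comp (nth [::] L) (@nat_of_ord d)) val_enum_ord -sL.
  by rewrite map_nth_iota0 // take_size.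
have LsE (s' : 'S_d) : \prod_i X (s' i) = ev (flatten (Ls s')).
  by rewrite /Ls ev_flatten [index_enum _]unlock -enumT.
have pL s' : perm_eq (Ls s') L.
  rewrite [X in perm_eq _ X]LE /Ls (map_comp (fun i : 'I_d => nth [::] L i) s').
  apply: perm_map; apply: uniq_perm; last move=> i.
  - by rewrite map_inj_uniq; [exact: enum_uniq|exact: perm_inj].
  - exact: enum_uniq.
  rewrite mem_enum; apply/mapP; exists ((s'^-1)%g i); rewrite ?mem_enum ?permKV //.
have nL s' : s' != 1%g -> Ls s' != L.
  apply: contra_neq => e; apply/permP => i; rewrite perm1; apply/val_inj/eqP.
  rewrite -(nth_uniq [::] _ _ (descending_uniq dL)) ?sL ?ltn_ord //.
  have := congr1 (fun s => nth [::] s i) e; rewrite /Ls (nth_map i) ?size_enum_ord //.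
  by rewrite nth_ord_enum => ->.
have LE1 : ev (flatten L) = \prod_i X ((1%g : 'S_d) i).
  by rewrite LsE /Ls; congr (ev (flatten _)); rewrite {1}LE; apply: eq_map => i; rewrite perm1.
have := standard_identity X; rewrite (bigD1 (1%g : 'S_d)) //= odd_perm1 expr0 scale1r -LE1.
move=> /eqP; rewrite addr_eq0 => /eqP LN.
rewrite wE !ev_cat LN mulNr mulrN; apply: subzmodN => //.
rewrite mulr_suml mulr_sumr; apply: subzmod_sum => // s' s1.
have Bs : zspan B (ev (x ++ flatten (Ls s') ++ y)).
  apply: (IHc _ _ _ _ erefl); last first.
    by rewrite -sw wE !size_cat (perm_size (perm_flatten (pL s'))).
  rewrite -cw wE; apply: prec_lex_num.
    by rewrite !size_cat (perm_size (perm_flatten (pL s'))).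
  by rewrite prec_catl; apply: prec_catr; apply: descending_flatten => //; exact: nL.
rewrite LsE -scalerAl -scalerAr -!ev_cat.
case: (odd_perm s'); rewrite ?expr0 ?scale1r // expr1 scaleN1r.
exact: subzmodN.
Qed.

End Span.

(* the elements congruent to 1 modulo 3 form a subgroup of finite index *)
Lemma HP_span (R : realType) (K : numClosedFieldType) n (H : groupType)
    (pi : H -> 'M[K]_n) (B : seq 'M[K]_n) : enumerable H -> pi 1%g = 1%:M ->
  (forall x y, pi (x * y)%g = pi x *m pi y) -> injective pi ->
  (forall h, zspan B (pi h)) -> HP R H.
Proof.
move=> eH p1 pM pin pB.
(* The additive group generated by the image, as an intersection of subgroups. Because the image is
   closed under products it is a ring, and it lies in the span of [B], hence is a lattice. *)
pose L x := forall A : 'M[K]_n -> Prop, subzmod A -> (forall h, A (pi h)) -> A x.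
have sL : subzmod L.
  split=> [A sA _|x y Lx Ly A sA Ap]; first by case: sA.
  by apply: sA.2; [exact: Lx|exact: Ly].
have Lp h : L (pi h) by move=> A _.
have LM x y : L x -> L y -> L (x *m y).
  move=> Lx Ly; apply: (Ly (fun v => L (x *m v))) => [|h].
    by split=> [|u v Lu Lv]; [rewrite mulmx0; exact: sL.1|rewrite mulmxBr; exact: sL.2].
  apply: (Lx (fun u => L (u *m pi h))) => [|g]; last by rewrite -pM.
  by split=> [|u v Lu Lv]; [rewrite mul0mx; exact: sL.1|rewrite mulmxBl; exact: sL.2].
have L1 : L 1%:M by rewrite -p1.
have Ln x l : L x -> L (x *+ l) by move=> Lx; exact: (subzmodMz l%:Z sL Lx).
have LB x : L x -> zspan B x by move=> /(_ _ (zspan_subzmod B) pB).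
have mn (x y : 'M[K]_n) : (x *+ 3) *m y = (x *m y) *+ 3.
  by rewrite !mulrS !mulmxDl mulr0n mul0mx.
have nm (x y : 'M[K]_n) : x *m (y *+ 3) = (x *m y) *+ 3.
  by rewrite !mulrS !mulmxDr mulr0n mulmx0.
pose P h := exists2 y, L y & pi h = 1%:M + y *+ 3.
have P1 : P 1%g by exists 0; [exact: sL.1|rewrite p1 mul0rn addr0].
have PM x y : P x -> P y -> P (x * y)%g.
  move=> [u Lu xu] [v Lv yv]; exists (u + v + (u *m v) *+ 3).
    by apply: (subzmodD sL); [exact: (subzmodD sL)|apply: Ln; exact: LM].
  rewrite pM xu yv mulmxDl mul1mx mulmxDr mulmx1 mn nm.
  by apply/matrixP => i j; rewrite !(mulmxnE, mxE); ring.
have PV x : P x -> P x^-1%g.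
  move=> [u Lu xu]; exists (- (pi x^-1%g *m u)).
    by apply: (subzmodN sL); exact: LM.
  have := pM x^-1%g x; rewrite mulVg p1 xu mulmxDr mulmx1 nm => ->.
  by rewrite mulNrn addrK.
pose S := sgroup P1 PM PV; pose j : subgrp S -> H := sval.
have jM : is_hom j by exact: sval_hom.
have ji : injective j by exact: sval_inj.
have HS : HP R (subgrp S).
  apply: (@HP_crep R K n (subgrp S) (pi \o j) L).
  - exact: enumerable_inj ji eH.
  - split => //.
    + by move=> x y; rewrite /comp jM pM.
    + by exists B.
    + by move=> g; have /sgroupP := svalP g.
  - exact: inj_comp.
apply: (HP_finite_index HS jM ji).
have [k [e [ei eL]]] := parametrised_fg (fun x l => @mx_torsion_free K n n x l) sL LB.
have fe h : exists u, pi h = e u by apply/eL.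
pose ka h := sval (cid (fe h)); have kaE h : pi h = e (ka h) := svalP (cid (fe h)).
(* Representatives are chosen by the coordinates of [pi h] modulo 3: if [r] and [g] have the same
   residue, [pi r - pi g] lies in [3 L], and multiplying by the inverse of [pi r], again in [L],
   gives the congruence to 1. *)
exists [seq xget 1%g [set h | residue (ka h) = r] | r <- enum 'I_#|{ffun 'I_k -> 'I_3}|] => g.
pose r := xget 1%g [set h | residue (ka h) = residue (ka g)].
have rE : residue (ka r) = residue (ka g).
  by apply: (@xgetPex _ 1%g [set h | residue (ka h) = residue (ka g)]); exists g.
exists r.
  by apply/mapP; exists (residue (ka g)); rewrite ?mem_enum.
have [z rz] := residueP rE.
have pS : (r^-1 * g)%g \in S.
  apply/sgroupP; exists (- (pi r^-1%g *m e z)).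
    apply: (subzmodN sL); apply: LM => //; by apply/eL; exists z.
  have gE : pi g = pi r - e z *+ 3.
    by rewrite !kaE -raddfMn -rz raddfB opprB addrC subrK.
  by rewrite pM gE mulmxBr nm -pM mulVg p1 mulNrn.
exists (Sub (r^-1 * g)%g pS : subgrp S).
by rewrite /j (_ : sval _ = (r^-1 * g)%g) ?mulgA ?mulgV ?mul1g.
Qed.

(** [P N] is the subgroup generated by the first [N] elements of an enumeration. Inverses are listed
    among the letters, so that its elements are values of positive words. *)
Lemma HP_integral (R : realType) (K : numClosedFieldType) n (G : groupType)
    (pi : G -> 'M[K]_n.+1) : enumerable G -> pi 1%g = 1%:M ->
  (forall x y, pi (x * y)%g = pi x *m pi y) -> injective pi ->
  (forall g i, integralOver (intr : int -> K) (char_poly (pi g))`_i) -> HP R G.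
Proof.
move=> [e eP] p1 pM pin pI.
pose letters N := [seq e i | i <- iota 0 N] ++ [seq (e i)^-1%g | i <- iota 0 N].
have lV N x : x \in letters N -> x^-1%g \in letters N.
  rewrite !mem_cat => /orP[] /(@seq.mapP nat)[i iN ->].
    by apply/orP; right; apply: (map_f (fun i => (e i)^-1%g)).
  by rewrite invgK; apply/orP; left; apply: map_f.
have lS M N x : (M <= N)%N -> x \in letters M -> x \in letters N.
  move=> MN; rewrite !mem_cat => /orP[] /(@seq.mapP nat)[i iN ->]; move: iN; rewrite mem_iota => /andP[_ iM].
    apply/orP; left; apply: map_f; rewrite mem_iota /=; exact: leq_trans iM MN.
  apply/orP; right; apply: (map_f (fun i => (e i)^-1%g)); rewrite mem_iota /=.
  exact: leq_trans iM MN.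
pose prd (w : seq G) := foldr (fun x y => (x * y)%g) 1%g w.
have prd_cat u v : prd (u ++ v) = (prd u * prd v)%g.
  by elim: u => [|x u IH]; rewrite /= ?mul1g // IH mulgA.
pose P N x := exists2 w, {subset w <= letters N} & x = prd w.
have PM N x y : P N x -> P N y -> P N (x * y)%g.
  move=> [u ul ->] [v vl ->]; exists (u ++ v); last by rewrite prd_cat.
  by move=> z; rewrite mem_cat => /orP[/ul|/vl].
apply: (@HP_union R G P) => [N|//|N _ [w wl ->]|M N x MN [w wl ->]|x|N H i iM ii Hi].
- by exists [::].
- elim: w wl => [|x w IH] wl; first by exists [::]; rewrite //= invg1.
  rewrite /= invgM; apply: PM; first by apply: IH => z zw; apply: wl; rewrite inE zw orbT.
  exists [:: x^-1%g]; last by rewrite /= mulg1.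
  by move=> z; rewrite inE => /eqP ->; apply: lV; apply: wl; rewrite mem_head.
- by exists w => // z /wl; exact: lS.
- have [l <-] := eP x; exists l.+1, [:: e l]; last by rewrite /= mulg1.
  move=> z; rewrite inE => /eqP ->; rewrite mem_cat; apply/orP; left.
  by apply: map_f; rewrite mem_iota /= add0n.
pose m := size (letters N); pose b (l : 'I_m) := nth 1%g (letters N) l.
have bw w : {subset w <= letters N} -> exists v, w = map b v.
  elim: w => [|x w IH] wl; first by exists [::].
  have [|v ->] := IH; first by move=> z zw; apply: wl; rewrite inE zw orbT.
  have xl : x \in letters N by apply: wl; rewrite mem_head.
  have il : (index x (letters N) < m)%N by rewrite index_mem.
  by exists (Ordinal il :: v); rewrite /= /b /= nth_index.
have evE v : ev (pi \o b) v = pi (prd (map b v)).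
  elim: v => [|l v IH]; first by rewrite /ev big_nil /= p1.
  by rewrite /ev big_cons -/(ev (pi \o b) v) IH /= pM.
have [|B BP] := @span_words K n m (pi \o b).
  by move=> v; rewrite evE; apply: integral_matrix; exact: pI.
apply: (@HP_span R K n.+1 H (pi \o i) B).
- by apply: (enumerable_inj ii); exists e.
- by rewrite /= (hom1 iM).
- by move=> x y; rewrite /= iM pM.
- exact: inj_comp.
move=> h /=; have [w wl ->] := Hi h; have [v ->] := bw _ wl.
by rewrite -evE.
Qed.

Lemma enumerable_subgrp (G : groupType) (H : groupClosed G) :
  countable [set` H] -> enumerable (subgrp H).
Proof.
move=> /countable_injP[f fi].
exists (fun k => xget 1%g [set g : subgrp H | f (val g) = k]) => g.
exists (f (val g)).
have : f (val (xget 1%g [set h : subgrp H | f (val h) = f (val g)])) = f (val g).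
  by apply: (@xgetPex _ 1%g [set h : subgrp H | f (val h) = f (val g)]); exists g.
by move=> /fi e; apply: val_inj; apply: e; apply/mem_set; exact: (svalP _).
Qed.

Lemma HP_GL (R : realType) (K : numClosedFieldType) n (G : groupClosed (GL n.+1 K)) :
  enumerable (subgrp G) -> integral_characteristic G -> HP R (subgrp G).
Proof.
move=> eG hG.
apply: (@HP_integral R K n (subgrp G) (fun g => val (val g))) => //.
  by move=> x y /val_inj/val_inj.
by move=> g i; exact: (hG _ (svalP g) i).
Qed.

Theorem theorem5p9 (R : realType) (n : nat) (hn : (1 <= n)%N)
    (G : groupClosed (GL n R[i])) (hcount : countable [set` G])
    (hG : integral_characteristic G) :
  HFF R virtually_cyclic (subgrp G).
Proof.
apply: HP_HFF; case: n hn G hcount hG => // n _ G hcount hG.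
by apply: HP_GL => //; exact: enumerable_subgrp.
Qed.
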